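(* Up to isomorphism, the set of forbidden minors of the class of planar graphs consists of exactly the two graphs $K_5$ and $K_{3,3}$: $$F(Planar) = \{K_5, K_{3,3}\}.$$
   Context: Graphs are finite and simple, considered up to isomorphism. $H$ is a minor of $G$, written $H \prec G$, if $H$ can be obtained from $G$ by vertex deletions, edge deletions and edge contractions (every graph is a minor of itself). $Planar$ is the class of graphs embeddable in the plane. For a minor closed class $A$ of graphs, $F(A)$ is its set of forbidden minors, i.e. the set of minor-minimal graphs not in $A$: graphs $G \notin A$ such that every $H \notin A$ with $H \prec G$ satisfies $H \cong G$. *)

(* Defs.v *)
From HB Require Import structures.
From mathcomp Require Import all_boot all_order all_algebra.
From mathcomp Require Import all_classical all_reals all_analysis.
Import Order.TTheory GRing.Theory Num.Theory.
Import numFieldNormedType.Exports.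

Set Implicit Arguments.
Unset Strict Implicit.
Unset Printing Implicit Defensive.

Local Open Scope ring_scope.
Local Open Scope classical_set_scope.

Record sgraph : Type := SGraph {
  vertex :> finType;
  edge : rel vertex;
  edge_sym : symmetric edge;
  edge_irrefl : irreflexive edge }.

Definition isomorphic (G H : sgraph) : Prop :=
  exists2 f : G -> H, bijective f & forall x y, edge (f x) (f y) = edge x y.

Section Operations.
Variable G : sgraph.

Definition del_vertex_rel (v : G) : rel {x : G | x != v} :=
  fun x y => edge (val x) (val y).

Lemma del_vertex_sym v : symmetric (@del_vertex_rel v).
Proof. by move=> x y; rewrite /del_vertex_rel edge_sym. Qed.

Lemma del_vertex_irrefl v : irreflexive (@del_vertex_rel v).
Proof. by move=> x; rewrite /del_vertex_rel edge_irrefl. Qed.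

Definition del_vertex (v : G) : sgraph :=
  SGraph (@del_vertex_sym v) (@del_vertex_irrefl v).

Definition del_edge_rel (u v : G) : rel G :=
  fun x y => edge x y && ([set x; y]%SET != [set u; v]%SET).

Lemma del_edge_sym u v : symmetric (del_edge_rel u v).
Proof. by move=> x y; rewrite /del_edge_rel edge_sym finset.setUC. Qed.

Lemma del_edge_irrefl u v : irreflexive (del_edge_rel u v).
Proof. by move=> x; rewrite /del_edge_rel edge_irrefl. Qed.

Definition del_edge (u v : G) : sgraph :=
  SGraph (del_edge_sym u v) (del_edge_irrefl u v).

(* [u] plays the role of the vertex obtained by merging [u] and [v]; loops are
   dropped and parallel edges are identified, so that the graph stays simple. *)
Definition contract_rel (u v : G) : rel {x : G | x != v} :=
  fun x y => (x != y) &&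
    [|| edge (val x) (val y),
        (val x == u) && edge v (val y) |
        (val y == u) && edge v (val x)].

Lemma contract_sym u v : symmetric (@contract_rel u v).
Proof.
move=> x y; rewrite /contract_rel eq_sym edge_sym.
by congr (_ && (_ || _)); rewrite orbC.
Qed.

Lemma contract_irrefl u v : irreflexive (@contract_rel u v).
Proof. by move=> x; rewrite /contract_rel eqxx. Qed.

Definition contract_edge (u v : G) : sgraph :=
  SGraph (@contract_sym u v) (@contract_irrefl u v).

End Operations.

Inductive minor (H : sgraph) : sgraph -> Prop :=
| minor_iso (G : sgraph) : isomorphic H G -> minor H G
| minor_del_vertex (G : sgraph) (v : G) : minor H (del_vertex v) -> minor H G
| minor_del_edge (G : sgraph) (u v : G) :
    edge u v -> minor H (del_edge u v) -> minor H G
| minor_contract (G : sgraph) (u v : G) :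
    edge u v -> minor H (contract_edge u v) -> minor H G.

Definition forbidden_minors (A : sgraph -> Prop) (G : sgraph) : Prop :=
  ~ A G /\ forall H : sgraph, ~ A H -> minor H G -> isomorphic H G.

Section Complete.
Variables m n : nat.

Definition complete_rel : rel 'I_n := fun x y => x != y.

Lemma complete_sym : symmetric complete_rel.
Proof. by move=> x y; rewrite /complete_rel eq_sym. Qed.

Lemma complete_irrefl : irreflexive complete_rel.
Proof. by move=> x; rewrite /complete_rel eqxx. Qed.

Definition complete_graph : sgraph := SGraph complete_sym complete_irrefl.

Definition bipartite_rel : rel ('I_m + 'I_n)%type := fun x y =>
  match x, y with
  | inl _, inr _ | inr _, inl _ => true
  | _, _ => false
  end.

Lemma bipartite_sym : symmetric bipartite_rel.
Proof. by move=> [x|x] [y|y]. Qed.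

Lemma bipartite_irrefl : irreflexive bipartite_rel.
Proof. by move=> [x|x]. Qed.

Definition complete_bipartite : sgraph :=
  SGraph bipartite_sym bipartite_irrefl.

End Complete.

Section Planar.
Variable R : realType.

Definition is_arc (a b : R * R) (A : set (R * R)) : Prop :=
  exists g : R -> R * R,
    [/\ {within `[0, 1], continuous g}, {in `[0, 1] &, injective g},
        g 0 = a, g 1 = b & A = g @` `[0, 1]].

(* The values of [arc] on sets that are not pairs of adjacent vertices are
   irrelevant. The last two conditions say that the interior of an edge contains
   no vertex and no point of another edge. *)
Definition planar (G : sgraph) : Prop :=
  exists (pos : G -> R * R) (arc : {set G} -> set (R * R)),
    [/\ injective pos,
        forall x y, edge x y -> is_arc (pos x) (pos y) (arc [set x; y]%SET),
        forall x y z, edge x y ->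
          ~ (arc [set x; y]%SET `\` [set pos x; pos y]) (pos z) &
        forall x y u v, edge x y -> edge u v ->
          [set x; y]%SET != [set u; v]%SET ->
          (arc [set x; y]%SET `\` [set pos x; pos y])
            `&` arc [set u; v]%SET = set0].

End Planar.

(* Main.v *)
(* Nonplanar graphs contain K5 or K33.  If a graph has no K5 and no K33 minor, its vertices carry
   three linear orders such that every edge lies below every other vertex in at least one of them
   (Schnyder's condition).  The orders are built by removing ears from the graph and putting them
   back on top of the third order, along a path that separates the placed part from the rest; an
   ear that cannot be chosen so as to keep this path exposed yields a K5 or a K33 minor.  Connected
   sets with at most two neighbours are cut off, replaced by a virtual edge, and their orders are
   inserted afterwards.  If the k-th order puts the vertex v at height r_k, projecting
   (3^r_0, 3^r_1, 3^r_2) centrally onto a plane gives a straight-line drawing.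

   K5 and K33 are not planar.  For two disjoint arcs sampled on a fine enough grid, the parity of
   the crossings of their difference vector with a half-axis satisfies a discrete Stokes formula:
   it sums to zero over the boundary of the grid.  Adding these relations over all pairs of
   independent edges, every winding number of an edge around a vertex occurs an even number of
   times, and what is left is the parity of the pairs of vertices that occur reversed, which is odd.

   Finally, the numbers of vertices and edges decrease along minors, and neither of K5 (5, 10) and
   K33 (6, 9) dominates the other, so both are minor-minimal. *)
Require Import Defs.
From mathcomp Require Import all_boot zify.
Set Implicit Arguments.
Unset Strict Implicit.
Unset Printing Implicit Defensive.

(** * Connected sets *)

Section Connectivity.
Variables (V : finType) (e : rel V).
Implicit Types (X Y Z A B D W : {set V}) (x y z : V).

(** No faces occur in the construction. The outer face is replaced by a path [L] from [s] to [t]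
    that descends in the first order and ascends in the second, and [under] expresses that its edges
    are visible from the third corner. The delicate case is an ear that covers a vertex of [L] with
    unplaced neighbours. It yields K33 as soon as some vertex of [L] outside the covered interval
    also sees the unplaced part. To guarantee such a witness, the ear [Z] found first on the bare
    edge [st] is kept unplaced as long as possible, because both [s] and [t] see it. Only an ear
    running from [s] to [t] escapes, and there three pairwise linkable sets, all seeing [s] and [t],
    give K5 or K33. Once no ear avoids [Z], a single unplaced neighbour of [t] is left and takes
    over its role. The corner conditions in [normalized] strengthen the induction: they allow a
    piece behind a cut to be inserted at its virtual edge. For nonplanarity the parity argument
    replaces the Jordan curve theorem, since it only uses that arcs of independent edges stay
    apart. *)

Definition adj X Y := [exists x in X, exists y in Y, e x y].

(** Stated through closed subsets instead of paths: most proofs of connectedness below exhibit a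
    closed set, and paths are extracted only where their order matters ([conn_upath]). *)
Definition conn X := (X != set0) && [forall Y : {set V},
  [&& Y \subset X, Y != set0 & ~~ adj Y (X :\: Y)] ==> (Y == X)].

Definition nbrs X := [set y | (y \notin X) && [exists x in X, e x y]].

Definition restr X : rel V := [rel x y | [&& x \in X, y \in X & e x y]].

Definition comp X x := [set y in X | connect (restr X) x y].

Lemma adjP X Y : reflect (exists x y, [/\ x \in X, y \in Y & e x y]) (adj X Y).
Proof.
apply: (iffP exists_inP) => [[x xX /exists_inP[y yY exy]]|[x [y [xX yY exy]]]].
  by exists x, y.
by exists x => //; apply/exists_inP; exists y.
Qed.

Lemma adjI x y X Y : x \in X -> y \in Y -> e x y -> adj X Y.
Proof. by move=> xX yY exy; apply/adjP; exists x, y. Qed.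

Lemma nbrsP X y : reflect (y \notin X /\ exists2 x, x \in X & e x y) (y \in nbrs X).
Proof.
rewrite inE; apply: (iffP andP) => [[yX /exists_inP]|[yX H]]; first by split.
by split=> //; apply/exists_inP.
Qed.

Lemma adjS X X' Y Y' : X \subset X' -> Y \subset Y' -> adj X Y -> adj X' Y'.
Proof.
by move=> /subsetP sX /subsetP sY /adjP[x [y [/sX ? /sY ? ?]]]; apply/adjP; exists x, y.
Qed.

Lemma conn_neq0 X : conn X -> X != set0.
Proof. by case/andP. Qed.

Lemma conn_closed X Y : conn X -> Y != set0 -> Y \subset X ->
  (forall x y, x \in Y -> y \in X -> e x y -> y \in Y) -> Y = X.
Proof.
case/andP=> _ /forallP/(_ Y)/implyP H Y0 YX cl; apply/eqP/H.
rewrite YX Y0 /=; apply/adjP=> [[x [y [xY]]]]; rewrite inE => /andP[yY yX] exy.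
by rewrite (cl x y) in yY.
Qed.

Lemma connI X : X != set0 ->
  (forall Y, Y != set0 -> Y \subset X ->
    (forall x y, x \in Y -> y \in X -> e x y -> y \in Y) -> X \subset Y) -> conn X.
Proof.
move=> X0 H; rewrite /conn X0 /=; apply/forallP=> Y; apply/implyP.
case/and3P=> YX Y0 nadj; rewrite eqEsubset YX /=; apply: H => // x y xY yX exy.
by apply: contraNT nadj => nyY; apply: (adjI xY _ exy); rewrite inE nyY.
Qed.

Lemma conn1 x : conn [set x].
Proof.
apply: connI; first by apply/set0Pn; exists x; rewrite inE.
move=> Y /set0Pn[y yY] /subsetP YX _; apply/subsetP=> z /set1P->.
by have /set1P <- := YX _ yY.
Qed.

(** The induction principle for connected sets: [Y] plays the predicate and may reach outside [X],
    as only its trace on [X] has to be closed. *)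
Lemma conn_meet X Y : conn X ->
  (forall x y, x \in Y -> x \in X -> y \in X -> e x y -> y \in Y) ->
  (exists2 x, x \in X & x \in Y) -> X \subset Y.
Proof.
move=> cX cl [x xX xY].
have <- : X :&: Y = X.
  apply: conn_closed => //; first by apply/set0Pn; exists x; rewrite inE xX.
    exact: subsetIl.
  by move=> a b; rewrite !inE => /andP[aX aY] bX eab; rewrite bX (cl a).
exact: subsetIr.
Qed.

Lemma restrP X x y : reflect [/\ x \in X, y \in X & e x y] (restr X x y).
Proof. exact: and3P. Qed.

Hypothesis esym : symmetric e.

Lemma adjC X Y : adj X Y = adj Y X.
Proof.
by apply/adjP/adjP=> -[x [y [xX yY exy]]]; exists y, x; rewrite esym.
Qed.

Lemma connU X Y : conn X -> conn Y -> (exists2 x, x \in X & x \in Y) \/ adj X Y ->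
  conn (X :|: Y).
Proof.
move=> cX cY H; apply: connI => [|Z /set0Pn[z zZ] /subsetP ZXY cl].
  by have /set0Pn[x xX] := conn_neq0 cX; apply/set0Pn; exists x; rewrite inE xX.
have sX : (exists2 x, x \in X & x \in Z) -> X \subset Z.
  move=> h; apply: conn_meet cX _ h => x y xZ _ yX; apply: cl => //.
  by rewrite inE yX.
have sY : (exists2 x, x \in Y & x \in Z) -> Y \subset Z.
  move=> h; apply: conn_meet cY _ h => x y xZ _ yX; apply: cl => //.
  by rewrite inE yX orbT.
have XY : X \subset Z -> Y \subset Z.
  move=> /subsetP XZ; apply: sY.
  case: H => [[x xX xY]|/adjP[x [y [xX yY exy]]]]; first by exists x => //; apply: XZ.
  by exists y => //; apply: cl exy; [apply: XZ | rewrite inE yY orbT].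
have YX : Y \subset Z -> X \subset Z.
  move=> /subsetP YZ; apply: sX.
  case: H => [[x xX xY]|/adjP[x [y [xX yY exy]]]]; first by exists x => //; apply: YZ.
  by exists x => //; apply: (cl y); [apply: YZ | rewrite inE xX | rewrite esym].
have := ZXY z zZ; rewrite inE subUset; case/orP=> zz.
  by have hX := sX (ex_intro2 _ _ z zz zZ); rewrite hX XY.
by have hX := sY (ex_intro2 _ _ z zz zZ); rewrite hX YX.
Qed.

Lemma conn_path x p : path e x p -> conn [set z in x :: p].
Proof.
elim: p x => [|y p IH] x /=; first by rewrite (_ : [set _ in _] = [set x]) ?conn1 //; apply/setP=> z; rewrite !inE.
case/andP=> exy /IH cp.
rewrite (_ : [set _ in _] = [set x] :|: [set z in y :: p]); last by apply/setP=> z; rewrite !inE.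
apply: connU => //; first exact: conn1.
by right; apply: (adjI _ _ exy); rewrite ?inE ?eqxx.
Qed.

Lemma conn_seq p : p != [::] -> sorted e p -> conn [set z in p].
Proof. by case: p => // x p _; apply: conn_path. Qed.

Lemma restr_sym X : symmetric (restr X).
Proof. by move=> x y; rewrite /restr /= esym; case: (x \in X) (y \in X) => [] []. Qed.

Lemma restr_csym X : connect_sym (restr X).
Proof. exact/sym_connect_sym/restr_sym. Qed.

Lemma mem_comp X x : x \in X -> x \in comp X x.
Proof. by move=> xX; rewrite inE xX connect0. Qed.

Lemma comp_sub X x : comp X x \subset X.
Proof. by apply/subsetP=> y; rewrite inE => /andP[]. Qed.

Lemma comp_closed X x y z : y \in comp X x -> z \in X -> e y z -> z \in comp X x.
Proof.
rewrite !inE => /andP[yX cxy] zX eyz; rewrite zX (connect_trans cxy) //.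
by apply: connect1; apply/restrP.
Qed.

Lemma conn_comp X x : x \in X -> conn (comp X x).
Proof.
move=> xX; apply: connI => [|Y /set0Pn[y yY] /subsetP YC cl].
  by apply/set0Pn; exists x; apply: mem_comp.
apply/subsetP=> z zC.
have /andP[yX cxy] : (y \in X) && connect (restr X) x y by have := YC _ yY; rewrite inE.
have : connect (restr X) y z.
  by move: zC; rewrite inE => /andP[_]; apply: connect_trans; rewrite restr_csym.
case/connectP=> p; elim: p y yY {yX cxy} => [|w p IH] y yY /=; first by move=> _ ->.
case/andP=> /restrP[yX wX eyw] pth lst; apply: IH pth lst.
by apply: (cl y) => //; apply: (comp_closed (y := y)) => //; apply: YC.
Qed.

Lemma conn_connect X x y : conn X -> x \in X -> y \in X -> connect (restr X) x y.
Proof.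
move=> cX xX yX.
have /subsetP/(_ y yX) : X \subset [set y in X | connect (restr X) x y].
  apply: conn_meet cX _ _; last by exists x; rewrite // inE xX connect0.
  move=> a b aC aX bX eab; exact: comp_closed aC bX eab.
by rewrite inE => /andP[].
Qed.

Lemma comp_max X Y x : conn Y -> Y \subset X -> (exists2 y, y \in Y & y \in comp X x) ->
  Y \subset comp X x.
Proof.
move=> cY /subsetP YX h; apply: conn_meet cY _ h => a b aC aY bY.
by apply: comp_closed aC _; apply: YX.
Qed.

Lemma restr_path X x p : path (restr X) x p -> path e x p /\ {subset p <= X}.
Proof.
elim: p x => [|y p IH] x //= /andP[/restrP[xX yX exy] /IH[pp sp]].
by rewrite exy pp; split=> // z; rewrite inE => /orP[/eqP->|/sp].
Qed.

Lemma conn_upath X x y : conn X -> x \in X -> y \in X ->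
  exists p, [/\ path e x p, last x p = y, uniq (x :: p) & {subset x :: p <= X}].
Proof.
move=> cX xX yX; have /connectP[p pth ->] := conn_connect cX xX yX.
case/shortenP: pth => q /restr_path[pq sq] uq _.
by exists q; split=> // z; rewrite inE => /orP[/eqP->|/sq].
Qed.

(** If no component of the remainder touches both sets, then [X] and the components touching it form
    a closed part of [W], which would be all of [W] and yet miss [Y]. *)
Lemma conn_link W X Y : conn W -> X \subset W -> X != set0 ->
  (exists2 y, y \in W & y \in Y) -> [disjoint X & Y] ->
  adj X Y \/ exists D, [/\ conn D, D \subset W :\: (X :|: Y), adj X D & adj D Y].
Proof.
move=> cW XW /set0Pn[x0 x0X] [y0 y0W y0Y] dXY.
set R := W :\: (X :|: Y).
case nXY: (adj X Y); first by left.
right.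
case: (boolP [exists z in R, adj X (comp R z) && adj (comp R z) Y]).
  case/exists_inP=> z zR /andP[a1 a2]; exists (comp R z).
  by split=> //; [apply: conn_comp | apply: comp_sub].
rewrite negb_exists => /forallP noD.
have /subsetP/(_ y0 y0W) : W \subset X :|: [set z in R | adj X (comp R z)].
  apply: conn_meet cW _ _; last by exists x0; rewrite ?inE ?x0X // (subsetP XW).
  move=> x y xT xW yW exy; rewrite !inE.
  case yX: (y \in X) => //=.
  case yY: (y \in Y) => /=.
    move: xT; rewrite !inE => /orP[xX|/andP[/andP[xnXY _] a]].
      by rewrite (adjI xX yY exy) in nXY.
    have xR : x \in R by rewrite !inE xnXY.
    have := noD x; rewrite xR a /= => /negP; case.
    by apply: (adjI _ yY exy); apply: mem_comp.
  rewrite yW /=.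
  have yR : y \in R by rewrite !inE yX yY yW.
  move: xT; rewrite inE [x \in [set _ in _ | _]]inE => /orP[xX|/andP[xR a]].
    by apply: (adjI xX _ exy); apply: mem_comp.
  have yC : y \in comp R x by apply: comp_closed exy => //; apply: mem_comp.
  suff -> : comp R y = comp R x by [].
  apply/setP=> z; rewrite !inE; congr (_ && _).
  by apply: (same_connect (restr_csym _)); apply: connect1; apply/restrP; rewrite esym.
rewrite !inE y0Y orbT /= => /orP[y0X|]; last by [].
by have := disjointFr dXY y0X; rewrite y0Y.
Qed.

End Connectivity.

(** * Ears *)

Lemma split_first (T : eqType) (a : pred T) (s : seq T) : has a s ->
  exists s1 x s2, [/\ s = s1 ++ x :: s2, a x & ~~ has a s1].
Proof.
elim: s => //= y s IH; case ay: (a y) => /=; first by exists [::], y, s.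
case/IH=> s1 [x [s2 [-> ax ns1]]]; exists (y :: s1), x, s2; by rewrite /= ay.
Qed.

Lemma sorted_catl (T : eqType) (r : rel T) (s1 s2 : seq T) :
  sorted r (s1 ++ s2) -> sorted r s1.
Proof. by case: s1 => //= x s1; rewrite cat_path => /andP[]. Qed.

Lemma sorted_catr (T : eqType) (r : rel T) (s1 s2 : seq T) :
  sorted r (s1 ++ s2) -> sorted r s2.
Proof.
case: s1 => //= x s1; rewrite cat_path => /andP[_].
by case: s2 => //= y s2 /andP[].
Qed.

Lemma last_cat_cons (T : Type) (x y : T) s1 s2 : last x (s1 ++ y :: s2) = last y s2.
Proof. by rewrite last_cat. Qed.

Section Ear.
Variables (V : finType) (e : rel V).
Hypothesis esym : symmetric e.
Variables (L U D : {set V}).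
Hypotheses (LU : [disjoint L & U]) (cU : conn e U) (cD : conn e D) (DU : D \subset U).
Hypothesis Uout : forall x y, x \in U -> e x y -> y \in U :|: L.
Hypothesis tight : forall X, conn e X -> X \subset U :\: D -> 2 < #|nbrs e X|.

Implicit Types (X Y : {set V}) (x y u w : V) (P p : seq V).

Definition NL X := L :&: nbrs e X.

(** A long ear is an induced path, attached to [L] by exactly one edge at each end; only a
    one-vertex ear may see more of [L]. *)
Definition ear_shape P :=
  (exists2 u, P = [:: u] & 1 < #|NL [set u]|) \/
  (exists u u' q w w', [/\ w \in L, w' \in L, w != w', P = u :: rcons q u' &
     (forall x l, x \in P -> l \in L ->
        e x l = (x == u) && (l == w) || (x == u') && (l == w')) /\
     (forall P1 x P2 y P3, P = P1 ++ x :: P2 ++ y :: P3 -> e x y -> P2 = [::])]).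

Lemma NLI X x l : X \subset U -> x \in X -> l \in L -> e x l -> l \in NL X.
Proof.
move=> /subsetP XU xX lL exl; rewrite inE lL; apply/nbrsP; split; last by exists x.
by apply: contraL lL => /XU lU; rewrite (disjointFl LU).
Qed.

Lemma NLP X l : reflect (exists2 x, x \in X & [/\ l \in L, l \notin X & e x l]) (l \in NL X).
Proof.
rewrite inE; apply: (iffP andP) => [[lL /nbrsP[lX [x xX exl]]]|[x xX [lL lX exl]]].
  by exists x.
by split=> //; apply/nbrsP; split=> //; exists x.
Qed.

Lemma NL2 X x y w w' : X \subset U -> x \in X -> y \in X -> w \in L -> w' \in L ->
  e x w -> e y w' -> w != w' -> 1 < #|NL X|.
Proof.
move=> XU xX yX wL w'L exw eyw ww; apply/card_gt1P; exists w, w'.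
by split=> //; [apply: (NLI XU xX) | apply: (NLI XU yX)].
Qed.

(** * The maximal component of the core and its boundary *)

Section Max.
Variables (d : V) (Y0 : {set V}).
Hypothesis dD : d \in D.
Hypotheses (cY0 : conn e Y0) (Y0U : Y0 \subset U :\: D) (NY0 : 1 < #|NL Y0|).
Variables (K X bd : {set V}).
Hypothesis KE : K = comp e (U :\: Y0) d.
Hypothesis XE : X = U :\: K.
Hypothesis bdE : bd = [set u in X | adj e [set u] K].
Hypothesis Ymax : forall Y, conn e Y -> Y \subset U :\: D -> 1 < #|NL Y| ->
  #|comp e (U :\: Y) d| <= #|K|.

Let inX x : (x \in X) = (x \notin K) && (x \in U). Proof. by rewrite XE inE. Qed.

Let dU : d \in U :\: Y0.
Proof.
rewrite inE (subsetP DU) // andbT; apply/negP=> /(subsetP Y0U).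
by rewrite inE dD.
Qed.

Let cK : conn e K. Proof. by rewrite KE; exact: conn_comp. Qed.
Let KU : K \subset U.
Proof. by rewrite KE; apply: subset_trans (comp_sub _ _ _) (subsetDl _ _). Qed.
Let DK : D \subset K.
Proof.
rewrite KE; apply: comp_max => //; last by exists d => //; apply: mem_comp.
apply/subsetP=> x xD; rewrite inE (subsetP DU) // andbT; apply/negP=> /(subsetP Y0U).
by rewrite inE xD.
Qed.
Let XU : X \subset U. Proof. by rewrite XE subsetDl. Qed.
Let XD : X \subset U :\: D. Proof. by rewrite XE setDS. Qed.
Let Y0X : Y0 \subset X.
Proof.
apply/subsetP=> y yY; have := subsetP Y0U y yY; rewrite inX inE => /andP[_ ->].
by rewrite andbT KE !inE yY.
Qed.

Let bdP u : reflect (u \in X /\ exists2 k, k \in K & e u k) (u \in bd).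
Proof.
rewrite bdE inE; apply: (iffP andP) => [[uX /adjP[x [k [/set1P-> kK exk]]]]|[uX [k kK euk]]].
  by split=> //; exists k.
by split=> //; apply: (adjI _ kK euk); rewrite inE.
Qed.

(** A vertex of [bd] outside [Y] could be added to [K], giving a larger component after the removal
    of [Y], against [Ymax]. *)
Let bd_sub Y : conn e Y -> Y \subset X -> 1 < #|NL Y| -> bd \subset Y.
Proof.
move=> cY YX NY; apply/subsetP=> u ub; apply/negPn/negP=> nuY.
have [uX [k kK euk]] := bdP _ ub.
have := Ymax cY (subset_trans YX XD) NY; rewrite leqNgt => /negP; apply.
apply: (@leq_trans #|u |: K|).
  by rewrite cardsU1; move: uX; rewrite inX => /andP[->].
apply: subset_leq_card; apply: comp_max => //.
- apply: connU => //; first exact: conn1.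
  by right; apply: (adjI _ kK euk); rewrite inE.
- rewrite subUset sub1set inE nuY (subsetP XU) //=; apply/subsetP=> x xK.
  rewrite inE (subsetP KU) // andbT; apply/negP=> /(subsetP YX).
  by rewrite inX xK.
- exists d; first by rewrite !inE (subsetP DK) ?orbT.
  apply: mem_comp => //; rewrite inE (subsetP DU) // andbT; apply/negP=> /(subsetP YX).
  by rewrite inX (subsetP DK).
Qed.

(** A component that avoids [bd] has no edge to [K], so all its neighbours are in [B] or on [L], and
    [tight] bounds their number from below. *)
Let comp_nbrs (B : {set V}) y : B \subset X -> y \in X :\: B ->
  [disjoint comp e (X :\: B) y & bd] ->
  2 < #|B :|: NL (comp e (X :\: B) y)|.
Proof.
move=> BX yX dis; set Y := comp _ _ _.
have YX : Y \subset X by apply: subset_trans (comp_sub _ _ _) (subsetDl _ _).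
apply: leq_trans (tight (conn_comp esym yX) (subset_trans YX XD)) _.
apply: subset_leq_card; apply/subsetP=> x xN; have := xN.
case/nbrsP=> xY [z zY ezx]; rewrite inE.
have zX := subsetP YX _ zY; have zU := subsetP XU _ zX.
have := Uout zU ezx; rewrite inE => /orP[xU|xL]; last by rewrite inE xL xN orbT.
case xB: (x \in B) => //=.
case xK: (x \in K).
  have zb : z \in bd by apply/bdP; split=> //; exists x.
  by have := disjointFr dis zY; rewrite zb.
case/negP: xY; apply: comp_closed zY _ ezx.
by rewrite in_setD xB inX xK xU.
Qed.

(** A component missing [bd] would have two neighbours on [L] by [tight], hence contain [bd] by
    [bd_sub], although [a] was removed. *)
Let bd_meet a y : a \in bd -> y \in X :\ a ->
  exists2 b, b \in bd & b \in comp e (X :\ a) y.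
Proof.
move=> ab yX; set Y := comp _ _ _.
have aX : a \in X by have [] := bdP _ ab.
case: (boolP [disjoint Y & bd]) => [dis|]; last first.
  by rewrite -setI_eq0 => /set0Pn[b]; rewrite inE => /andP[bY bb]; exists b.
have YX : Y \subset X by apply: subset_trans (comp_sub _ _ _) (subsetDl _ _).
have := comp_nbrs (B := [set a]) _ yX dis.
rewrite sub1set aX => /(_ isT) h.
have : 1 < #|NL Y|.
  rewrite -ltnS; apply: leq_trans h _.
  by apply: leq_trans (leq_card_setU _ _) _; rewrite cards1.
move/(bd_sub (conn_comp esym yX) YX)/subsetP/(_ a ab) => aY.
by have := subsetP (comp_sub _ _ _) _ aY; rewrite !inE eqxx.
Qed.

Let sub_of (s : seq V) Y : {subset s <= Y} -> [set z in s] \subset Y.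
Proof. by move=> h; apply/subsetP=> z; rewrite inE => /h. Qed.

Section Path.
Variables (x : V) (p : seq V) (w w' : V).
Hypotheses (pth : path e x p) (up : uniq (x :: p)) (sp : {subset x :: p <= X}).
Hypotheses (wL : w \in L) (w'L : w' \in L) (ww : w != w').
Hypotheses (exw : e x w) (elw : e (last x p) w').

Let cP : conn e [set z in x :: p]. Proof. exact: conn_path. Qed.

Lemma bdp : bd \subset [set z in x :: p].
Proof.
apply: bd_sub => //; first exact: sub_of.
have sPX : [set z in x :: p] \subset X by exact: sub_of.
apply: (NL2 (subset_trans sPX XU) _ _ wL w'L exw elw ww); rewrite inE ?mem_head ?mem_last //.
Qed.

(** Otherwise let [a] be the first vertex of [bd] on the path. The component of [x] in [X :\ a]
    contains a boundary vertex, which lies beyond [a]; so it swallows the rest of the path, sees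
    both [w] and [w'], and must contain [a] by [bd_sub]. *)
Lemma headb : x \in bd.
Proof.
apply/negPn/negP=> nxb.
have /split_first[P1 [a [P2 [eP ab nP1]]]] : has (mem bd) (x :: p).
  have : bd != set0.
    apply/negP=> /eqP b0.
    have h : U \subset K.
      apply: conn_meet cU _ _; last by exists d; [case/setDP: dU | rewrite KE; apply: mem_comp].
      move=> a b aK aU bU eab; apply/negPn/negP=> nbK.
      have : b \in bd by apply/bdP; split; [rewrite inX nbK | exists a => //; rewrite esym].
      by rewrite b0 inE.
    have := sp (mem_head _ _); rewrite inX => /andP[nK xU].
    by rewrite (subsetP h) in nK.
  case/set0Pn=> b bb; apply/hasP; exists b => //.
  by have := subsetP bdp _ bb; rewrite inE.
case: P1 => [|x1 P1] in eP nP1 *; first by case: eP => xa _; rewrite xa (ab : a \in bd) in nxb.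
case: eP => ex ep; rewrite -{x1}ex in nP1.
have aP : a \notin x :: P1 ++ P2.
  move: up; rewrite ep -cat_cons cat_uniq /= negb_or -cat_cons mem_cat negb_or.
  by case/and3P=> _ /andP[-> _] /andP[->].
have xXa : x \in X :\ a.
  rewrite in_setD1 sp ?mem_head // andbT; apply: contraNneq aP => <-; exact: mem_head.
set Y := comp e (X :\ a) x.
have YX : Y \subset X by apply: subset_trans (comp_sub _ _ _) (subsetDl _ _).
have cY : conn e Y by exact: conn_comp.
have [b bb bY] := bd_meet ab xXa.
have bp : b \in x :: p by have := subsetP bdp _ bb; rewrite inE.
have bY' : b != a by have := subsetP (comp_sub _ _ _) _ bY; rewrite !inE => /andP[].
have bP2 : b \in P2.
  move: bp; rewrite ep -cat_cons mem_cat [b \in a :: _]in_cons (negPf bY') /=; case/orP=> // bP1.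
  by case/hasP: nP1; exists b.
have P2Y : [set z in P2] \subset Y.
  apply: comp_max => //.
  - apply: conn_seq => //; first by case: (P2) bP2.
    by move: pth; rewrite ep cat_path => /andP[_] /= /andP[_ /path_sorted].
  - apply: sub_of => z zP2; rewrite in_setD1 sp ?andbT; last first.
      by rewrite ep -cat_cons mem_cat [z \in a :: _]in_cons zP2 !orbT.
    apply: contraNneq aP => <-; by rewrite -cat_cons mem_cat zP2 orbT.
  - by exists b => //; rewrite inE.
have lY : last x p \in Y.
  apply: (subsetP P2Y); rewrite ep last_cat_cons inE.
  by case: (P2) bP2 => //= c P3 _; apply: mem_last.
have : 1 < #|NL Y|.
  by apply: (NL2 (subset_trans YX XU) (mem_comp _ xXa) lY wL w'L exw elw ww).
move/(bd_sub cY YX)/subsetP/(_ a ab) => aY.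
by have := subsetP (comp_sub _ _ _) _ aY; rewrite !inE eqxx.
Qed.

Lemma single : p = [::] -> X = [set x].
Proof.
move=> p0; apply/eqP; rewrite eqEsubset sub1set sp ?mem_head // andbT.
apply/subsetP=> y yX; rewrite inE; apply/negPn/negP=> nyx.
have yXx : y \in X :\ x by rewrite in_setD1 nyx.
have [b bb bY] := bd_meet headb yXx.
have := subsetP bdp _ bb; rewrite p0 !inE => /eqP bx.
by have := subsetP (comp_sub _ _ _) _ bY; rewrite bx !inE eqxx.
Qed.

(** The argument of [headb] again: another neighbour [l] would let a component of [X :\ x] see both
    [l] and [w'] without containing [x]. *)
Lemma nohead y l : p != [::] -> y \in X -> y != x -> l \in L -> e y l -> l = w'.
Proof.
move=> p0 yX yx lL eyl; apply/eqP/negPn/negP=> lw.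
have yXx : y \in X :\ x by rewrite in_setD1 yx.
have [b bb bY] := bd_meet headb yXx.
have bp : b \in p.
  have := subsetP bdp _ bb; rewrite inE in_cons => /orP[/eqP bx|//].
  by have := subsetP (comp_sub _ _ _) _ bY; rewrite bx !inE eqxx.
set Y := comp e (X :\ x) y in bY.
have YX : Y \subset X by apply: subset_trans (comp_sub _ _ _) (subsetDl _ _).
have cY : conn e Y by exact: conn_comp.
have pY : [set z in p] \subset Y.
  apply: comp_max => //.
  - by apply: conn_seq => //; apply: path_sorted pth.
  - apply: sub_of => z zp; rewrite in_setD1 sp ?andbT; last by rewrite in_cons zp orbT.
    by apply: contraTneq zp => ->; case/andP: up.
  - by exists b => //; rewrite inE.
have lY : last x p \in Y.
  by apply: (subsetP pY); rewrite inE; case: (p) p0 => //= c q _; apply: mem_last.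
have : 1 < #|NL Y|.
  exact: (NL2 (subset_trans YX XU) (mem_comp _ yXx) lY lL w'L eyl elw lw).
move/(bd_sub cY YX)/subsetP/(_ x headb) => xY.
by have := subsetP (comp_sub _ _ _) _ xY; rewrite !inE eqxx.
Qed.

End Path.

(** The set [X] is the ear: every vertex of [X] lies in [bd], and [bd] lies on the path, so nothing
    else remains. *)
Lemma max_ear : exists P, [/\ ear_shape P, uniq P, sorted e P, P != [::] &
  [/\ [set z in P] \subset U :\: D, conn e (U :\: [set z in P]) &
      adj e [set z in P] (U :\: [set z in P])]].
Proof.
have [w [w' [/NLP[x xY [wL _ exw]] /NLP[y yY [w'L _ eyw]] ww]]] := card_gt1P NY0.
have [p [pth lst up sp0]] := conn_upath cY0 xY yY.
have sp : {subset x :: p <= X} by move=> z /sp0 /(subsetP Y0X).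
rewrite -lst in eyw.
have hb := headb pth up sp wL w'L ww exw eyw.
have bp := bdp pth sp wL w'L ww exw eyw.
have KU' : U :\: X = K.
  by rewrite XE setDDr setDv set0U; apply/setIidPr.
have aXK : adj e X K.
  by have [xX [k kK exk]] := bdP _ hb; apply: adjI xX kK exk.
case: (altP (p =P [::])) => [p0|p0].
  have Xx := single pth up sp wL w'L ww exw eyw p0.
  have Xe : [set z in [:: x]] = X by rewrite Xx; apply/setP=> z; rewrite !inE.
  exists [:: x]; rewrite Xe KU'; split=> //.
  left; exists x => //; rewrite -Xx.
  apply: (NL2 XU (sp _ (mem_head _ _)) (sp _ (mem_last _ _)) wL w'L exw eyw ww).
have [q pE] : exists q, p = rcons q (last x p).
  by clear -p0; case/lastP: p p0 => // q z _; exists q; rewrite last_rcons.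
set u' := last x p in lst eyw pE.
(* Reversing the path exchanges [w] and [w'], so what was shown for the head also holds for the last
   vertex. *)
have rE : rev (x :: p) = u' :: rev (x :: q).
  by rewrite pE -rcons_cons rev_rcons.
have rlast : last u' (rev (x :: q)) = x by rewrite rev_cons last_rcons.
have rpth : path e u' (rev (x :: q)).
  have : sorted e (rev (x :: p)).
    rewrite rev_sorted; rewrite (eq_sorted (e' := e)) // => a b /=; exact: esym.
  by rewrite rE.
have rup : uniq (u' :: rev (x :: q)) by rewrite -rE rev_uniq.
have rsp : {subset u' :: rev (x :: q) <= X} by move=> z; rewrite -rE mem_rev => /sp.
have w'w : w' != w by rewrite eq_sym.
have hexw : e (last u' (rev (x :: q))) w by rewrite rlast.
have hb' := headb rpth rup rsp w'L wL w'w eyw hexw.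
have q0 : rev (x :: q) != [::] by rewrite -size_eq0 size_rev.
have n1 y' l : y' \in X -> y' != x -> l \in L -> e y' l -> l = w'.
  by move=> h1 h2 h3 h4; exact: (nohead pth up sp wL w'L ww exw eyw p0 h1 h2 h3 h4).
have n2 y' l : y' \in X -> y' != u' -> l \in L -> e y' l -> l = w.
  by move=> h1 h2 h3 h4; exact: (nohead rpth rup rsp w'L wL w'w eyw hexw q0 h1 h2 h3 h4).
have nomiss (T : {set V}) : conn e T -> T \subset X -> x \in T -> u' \in T -> bd \subset T.
  move=> cT TX xT uT; apply: bd_sub => //.
  exact: (NL2 (subset_trans TX XU) xT uT wL w'L exw eyw ww).
(* A component [Y] of [X :\: bd] has no neighbour on [L], so [tight] gives it three neighbours [a],
   [b], [c] on the path. The detour from [a] to [c] through [Y] joins both ends and avoids [b],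
   contrary to [nomiss]. *)
have Xbd : X \subset bd.
  apply/subsetP=> z zX; apply/negPn/negP=> nzb.
  have zXb : z \in X :\: bd by rewrite inE nzb.
  set Y := comp e (X :\: bd) z.
  have bX : bd \subset X by apply/subsetP=> b /bdP[].
  have YXb : Y \subset X :\: bd by exact: comp_sub.
  have YX : Y \subset X by apply: subset_trans YXb (subsetDl _ _).
  have cY : conn e Y by exact: conn_comp.
  have dis : [disjoint Y & bd].
    rewrite disjoint_subset; apply/subsetP=> b /(subsetP YXb).
    by rewrite !inE => /andP[].
  have NY : NL Y = set0.
    apply/eqP; rewrite -subset0; apply/subsetP=> l /NLP[y' yY' [lL _ eyl]].
    have yX' := subsetP YX _ yY'.
    have yx : y' != x by apply: contraTneq yY' => ->; rewrite (disjointFl dis).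
    have yu : y' != u' by apply: contraTneq yY' => ->; rewrite (disjointFl dis).
    by case/eqP: ww; rewrite -(n1 _ _ yX' yx lL eyl) {1}(n2 _ _ yX' yu lL eyl).
  have sN : nbrs e Y \subset bd.
    apply/subsetP=> b /nbrsP[bY [y' yY' eyb]].
    have yX' := subsetP YX _ yY'.
    have := Uout (subsetP XU _ yX') eyb; rewrite inE => /orP[bU|bL]; last first.
      have : b \in NL Y by apply: (NLI (subset_trans YX XU) yY' bL).
      by rewrite NY inE.
    case bK: (b \in K).
      have : y' \in bd by apply/bdP; split=> //; exists b.
      by rewrite (disjointFr dis).
    apply/negPn/negP=> nbb; case/negP: bY; apply: comp_closed yY' _ eyb.
    by rewrite in_setD nbb inX bK bU.
  have c3 : 2 < #|nbrs e Y| by apply: tight => //; apply: subset_trans YX XD.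
  have inxp b : b \in nbrs e Y -> b \in x :: p.
    by move=> /(subsetP sN) /(subsetP bp); rewrite inE.
  have /split_first[P1 [a [P2 [eP aN nP1]]]] : has (mem (nbrs e Y)) (x :: p).
    have /card_gt0P[b bN] : 0 < #|nbrs e Y| by apply: leq_trans c3.
    by apply/hasP; exists b => //; apply: inxp.
  have inP2 b : b \in nbrs e Y -> b != a -> b \in P2.
    move=> bN ba; have := inxp b bN; rewrite eP mem_cat in_cons (negPf ba) /=.
    by case/orP=> // bP1; case/hasP: nP1; exists b.
  have c2 : 1 < #|nbrs e Y :\ a| by move: c3; rewrite (cardsD1 a) (aN : a \in _).
  have /split_first[P3 [b [P4 [eP2 bN nP3]]]] : has (mem (nbrs e Y :\ a)) P2.
    have /card_gt0P[b bN] : 0 < #|nbrs e Y :\ a| by apply: leq_trans c2.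
    apply/hasP; exists b => //; move: bN; rewrite in_setD1 => /andP[ba bN]; exact: inP2.
  have /card_gt0P[c] : 0 < #|nbrs e Y :\ a :\ b|.
    by move: c2; rewrite (cardsD1 b) (bN : b \in _).
  rewrite !in_setD1 => /and3P[cb ca cN].
  have cP4 : c \in P4.
    have := inP2 c cN ca; rewrite eP2 mem_cat in_cons (negPf cb) /=.
    by case/orP=> // cP3; case/hasP: nP3; exists c => //=; rewrite in_setD1 ca.
  move: (bN : b \in nbrs e Y :\ a); rewrite in_setD1 => /andP[ba bN'].
  have eP' : x :: p = (P1 ++ [:: a]) ++ P3 ++ b :: P4 by rewrite eP eP2 -catA.
  set Q1 := P1 ++ [:: a] in eP'.
  have aQ1 : a \in Q1 by rewrite mem_cat mem_head orbT.
  have Q1X : {subset Q1 <= X} by move=> v vQ; apply: sp; rewrite eP' mem_cat vQ.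
  have P4X : {subset P4 <= X}.
    by move=> v vQ; apply: sp; rewrite eP' 2!mem_cat [v \in b :: _]in_cons vQ !orbT.
  have spx : sorted e (Q1 ++ P3 ++ b :: P4) by rewrite -eP'.
  have cQ1 : conn e [set v in Q1].
    apply: conn_seq => //; first by rewrite /Q1; case: (P1).
    exact: sorted_catl spx.
  have cP4' : conn e [set v in P4].
    apply: conn_seq => //; first by case: (P4) cP4.
    by have /path_sorted := sorted_catr (sorted_catr spx).
  have [_ [y1 y1Y e1]] := nbrsP _ _ _ aN.
  have [_ [y2 y2Y e2]] := nbrsP _ _ _ cN.
  have cT : conn e ([set v in Q1] :|: (Y :|: [set v in P4])).
    apply: connU => //.
      by apply: connU => //; right; apply: (adjI y2Y _ e2); rewrite inE.
    by right; apply: (adjI (x := a) (y := y1)); [rewrite inE | rewrite inE y1Y | rewrite esym].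
  have /subsetP/(_ b) : bd \subset [set v in Q1] :|: (Y :|: [set v in P4]).
    apply: nomiss => //.
    - by rewrite !subUset YX !sub_of.
    - rewrite !inE; suff -> : x \in Q1 by [].
      by rewrite /Q1; case: (P1) eP => [|x1 P1'] [-> _]; rewrite ?inE eqxx.
    - rewrite /u' -(last_cat_cons x x [::] p) /= -[last x p]/(last x (x :: p)) eP' catA last_cat_cons.
      by rewrite !inE; case: (P4) cP4 => //= v P5 _; rewrite mem_last !orbT.
  rewrite (subsetP sN) // => /(_ isT).
  rewrite in_setU [b \in _ :|: _]in_setU (disjointFl dis (subsetP sN _ bN')) /= inE [b \in [set _ in P4]]inE.
  have := up; rewrite eP' !cat_uniq /= !negb_or => /and3P[_ /hasPn h /and3P[_ _ /andP[h2 _]]].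
  rewrite (negPf h2) orbF => bQ.
  by have := h b; rewrite mem_cat mem_head orbT bQ => /(_ isT).
have XP : [set z in x :: p] = X.
  apply/eqP; rewrite eqEsubset sub_of //=; exact: subset_trans Xbd bp.
exists (x :: p); rewrite XP KU'; split=> //.
right; exists x, u', q, w, w'; split=> //; first by rewrite pE.
have xu : x != u'.
  by apply/eqP=> xu; move: up; rewrite pE -xu /= mem_rcons mem_head.
split=> [y' l yP lL|P1 a P2 b P3 eP eab].
  have yX := sp _ yP; apply/idP/orP=> [eyl|[]/andP[/eqP-> /eqP->] //].
  case: (eqVneq y' x) => [yx|yx]; [left|right].
    by rewrite (n2 y' l) ?eqxx // yx.
  case: (eqVneq y' u') => [yu|yu]; first by rewrite (n1 y' l) ?eqxx // yu.
  by case/eqP: ww; rewrite -(n1 _ _ yX yx lL eyl) -(n2 _ _ yX yu lL eyl).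
(* The chord from [a] to [b] joins the two outer pieces of the path into a connected set that
   contains both ends but misses [c], a vertex of [bd]. *)
case: P2 => // c P2 in eP *; exfalso.
have eP' : x :: p = (P1 ++ [:: a]) ++ (c :: P2) ++ (b :: P3) by rewrite eP -catA.
have spx : sorted e ((P1 ++ [:: a]) ++ (c :: P2) ++ (b :: P3)) by rewrite -eP'.
have cQ1 : conn e [set v in P1 ++ [:: a]].
  by apply: conn_seq => //; [case: (P1) | exact: sorted_catl spx].
have cP4' : conn e [set v in b :: P3].
  by apply: conn_seq => //; exact: (sorted_catr (sorted_catr spx)).
have cb : c \in bd.
  by apply: (subsetP Xbd); apply: sp; rewrite eP' !mem_cat mem_head orbT.
have /subsetP/(_ c cb) : bd \subset [set v in P1 ++ [:: a]] :|: [set v in b :: P3].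
  apply: nomiss.
  - apply: connU => //; right; apply: (adjI _ _ eab); rewrite inE ?mem_cat mem_head ?orbT //.
  - rewrite subUset !sub_of // => v vQ; apply: sp; rewrite eP' !(mem_cat, in_cons) in vQ *.
      by case/orP: vQ => ->; rewrite ?orbT.
    by case/orP: vQ => ->; rewrite ?orbT.
  - rewrite !inE; suff -> : x \in P1 ++ [:: a] by [].
    by case: (P1) eP => [|x1 P1'] [-> _]; rewrite ?inE eqxx.
  - rewrite /u' -[last x p]/(last x (x :: p)) eP' catA last_cat_cons.
    by rewrite !inE -in_cons mem_last orbT.
have := up; rewrite eP' !cat_uniq => /and3P[_ /hasPn h /and3P[/andP[h1 _] /hasPn h2 _]].
have nQ : c \notin P1 ++ [:: a] by apply: h; rewrite mem_cat mem_head.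
rewrite inE [c \in [set _ in P1 ++ _]]inE (negPf nQ) inE /= => cQ.
by have := h2 c cQ; rewrite /= mem_head.
Qed.

End Max.

(* Among the sets avoiding [D] with two neighbours on [L], choose [X] such that the component of
   [D] in [U :\: X] is as large as possible: then [X] is the complement of that component. *)
Lemma ear_exists : (exists X, [/\ conn e X, X \subset U :\: D & 1 < #|NL X|]) ->
  exists P, [/\ ear_shape P, uniq P, sorted e P, P != [::] &
  [/\ [set z in P] \subset U :\: D, conn e (U :\: [set z in P]) &
      adj e [set z in P] (U :\: [set z in P])]].
Proof.
case=> X0 [cX0 X0D N0]; have /set0Pn[d dD] := conn_neq0 cD.
pose good (Y : {set V}) := [&& conn e Y, Y \subset U :\: D & 1 < #|NL Y|].
have g0 : good X0 by rewrite /good cX0 X0D.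
case: (@arg_maxnP _ X0 good (fun Y => #|comp e (U :\: Y) d|) g0) => Y /and3P[cY YD NY] Ymax.
apply: (max_ear dD cY YD NY erefl erefl erefl) => Z cZ ZD NZ.
by apply: Ymax; apply/and3P.
Qed.

End Ear.

(** * Realizers *)

Lemma path_pair (T : eqType) (r : rel T) x p w : path r x p -> p != [::] -> w \in x :: p ->
  exists y z, [/\ r y z, y \in belast x p, z \in p & (w == y) || (w == z)].
Proof.
elim: p x => // y p IH x /= /andP[rxy pth] _; rewrite in_cons => /orP[/eqP->|].
  by exists x, y; rewrite rxy !mem_head eqxx.
rewrite in_cons => /orP[/eqP->|wp]; first by exists x, y; rewrite rxy !mem_head eqxx orbT.
have p0 : p != [::] by case: (p) wp.
have wyp : w \in y :: p by rewrite in_cons wp orbT.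
have [a [b [rab aB bp wab]]] := IH y pth p0 wyp.
by exists a, b; rewrite rab !in_cons aB bp !orbT.
Qed.

Lemma sorted_cat_cons (T : Type) (r : rel T) s1 x s2 :
  sorted r (s1 ++ x :: s2) = sorted r (rcons s1 x) && path r x s2.
Proof. by case: s1 => //= y s1; rewrite cat_path rcons_path /= andbA. Qed.

Definition o0 : 'I_3 := @Ordinal 3 0 isT.
Definition o1 : 'I_3 := @Ordinal 3 1 isT.
Definition o2 : 'I_3 := @Ordinal 3 2 isT.

Ltac nlia := repeat match goal with
  | H : is_true (leq _ _) |- _ => revert H
  | H : is_true (leq _ _ && leq _ _) |- _ => revert H
  | H : is_true (_ && _ || _ && leq _ _) |- _ => revert H
  | H : is_true (leq _ _ || leq _ _) |- _ => revert H
  | H : @eq nat _ _ |- _ => revert H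
  end; clear; intros; lia.

Section Realizer.
Variables (V : finType) (e : rel V).
Implicit Types (A S : {set V}) (r : 'I_3 -> V -> nat).

(* The coordinates [r i] may have ties, and all comparisons are strict. *)
Definition realizer A r :=
  (forall x y z, x \in A -> y \in A -> z \in A -> e x y -> z != x -> z != y ->
     exists i, r i x < r i z /\ r i y < r i z) /\
  (forall x z, x \in A -> z \in A -> x != z -> exists i, r i x < r i z).

(* [s] and [t] are two corners of the outer triangle; the third one is virtual, on top of [r o2]. *)
Definition normalized s t A r :=
  [/\ r o0 t < r o0 s, r o1 s < r o1 t &
   forall z, z \in A -> z != s -> z != t ->
     [/\ r o0 t < r o0 z < r o0 s, r o1 s < r o1 z < r o1 t, r o2 s < r o2 z & r o2 t < r o2 z]].

Definition under r S : rel V := fun x y => [forall z in S, (z != x) ==> (z != y) ==>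
  ((r o0 x < r o0 z) && (r o0 y < r o0 z) || (r o1 x < r o1 z) && (r o1 y < r o1 z))].

Lemma underP r S x y : reflect (forall z, z \in S -> z != x -> z != y ->
   (r o0 x < r o0 z) && (r o0 y < r o0 z) || (r o1 x < r o1 z) && (r o1 y < r o1 z))
   (under r S x y).
Proof.
apply: (iffP forall_inP) => H z zS; last by apply/implyP=> zx; apply/implyP=> zy; exact: H.
by move=> zx zy; have /implyP/(_ zx)/implyP/(_ zy) := H z zS.
Qed.

Definition left_right r : rel V := fun x y => (r o0 y < r o0 x) && (r o1 x < r o1 y).

(* [l] is the part of the boundary of [S] seen from the third corner: new vertices are always put
   on top of [r o2], so an edge between consecutive vertices of [l] must already be separated
   from the other vertices of [S] by [r o0] and [r o1]. *)
Definition frontier s t S (l : seq V) r :=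
  [/\ realizer S r, normalized s t S r, {subset l <= S}, pairwise (left_right r) l &
      sorted (under r S) l].

Hypothesis esym : symmetric e.
Hypothesis eirr : irreflexive e.

(** The new vertex goes just above [b] in the first order, just above [a] in the second, and on top
    of the third. Old edges are below [v] in the third order; a new edge is separated from an old
    vertex by the order that separates a consecutive pair of the frontier from it. *)
Lemma frontier_place s t S L1 a M b L2 r v :
  s \in S -> t \in S ->
  frontier s t S (L1 ++ a :: M ++ b :: L2) r -> v \notin S ->
  (forall x, x \in S -> e v x -> x \in a :: rcons M b) ->
  exists r', frontier s t (v |: S) (L1 ++ a :: v :: b :: L2) r'.
Proof.
move=> sS tS [[rE rD] [ts st rN] LS pw sC] vS vM.
pose top := (\sum_x r o2 x).+1.
have topP x : r o2 x < top by rewrite ltnS (bigD1 x) //= leq_addr.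
(* Doubling the old values leaves odd values free between them for [v]. *)
pose r' (i : 'I_3) x : nat := if x == v then
  (if i == o0 then (2 * r o0 b).+1 else if i == o1 then (2 * r o1 a).+1 else 2 * top)
  else 2 * r i x.
have r'v0 : r' o0 v = (2 * r o0 b).+1 by rewrite /r' eqxx.
have r'v1 : r' o1 v = (2 * r o1 a).+1 by rewrite /r' eqxx.
have r'v2 : r' o2 v = 2 * top by rewrite /r' eqxx.
have Sv x : x \in S -> x != v by apply: contraTneq => ->.
have r'S i x : x \in S -> r' i x = 2 * r i x by move=> /Sv/negPf xv; rewrite /r' xv.
clearbody r' top.
have aS : a \in S by apply: LS; rewrite !(mem_cat, in_cons) eqxx ?orbT.
have bS : b \in S by apply: LS; rewrite !(mem_cat, in_cons) eqxx ?orbT.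
have MS : {subset M <= S} by move=> x xM; apply: LS; rewrite !(mem_cat, in_cons) xM ?orbT.
have L1S : {subset L1 <= S} by move=> x xM; apply: LS; rewrite !(mem_cat, in_cons) xM ?orbT.
have L2S : {subset L2 <= S} by move=> x xM; apply: LS; rewrite !(mem_cat, in_cons) xM ?orbT.
have /(sorted_catr (s1 := L1)) := pairwise_sorted pw.
rewrite /= -cat_rcons cat_path => /andP[sLM _].
move: pw; rewrite pairwise_cat => /and3P[/allrelP pw1 pwL1 /=].
rewrite all_cat pairwise_cat => /andP[/andP[/allP paM /= /andP[pab /allP paL2]]].
case/and3P=> /allrelP pMb pwM /= /andP[/allP pbL2 pwL2].
have lowA x : x \in a :: M -> r o0 b < r o0 x /\ r o0 x <= r o0 a.
  rewrite in_cons => /orP[/eqP->|xM]; first by case/andP: pab.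
  by have /andP[? _] := pMb x b xM (mem_head _ _); have /andP[/ltnW ? _] := paM x xM.
have lowB x : x \in rcons M b -> r o1 a < r o1 x /\ r o1 x <= r o1 b.
  rewrite mem_rcons in_cons => /orP[/eqP->|xM]; first by case/andP: pab.
  by have /andP[_ /ltnW ?] := pMb x b xM (mem_head _ _); have /andP[_ ?] := paM x xM.
move: sC; rewrite sorted_cat_cons => /andP[sC1]; rewrite -cat_rcons cat_path last_rcons.
case/andP=> sCM sC2.
(* every vertex of the interval lies on a consecutive pair, which controls the new edge *)
have newE w z : w \in a :: rcons M b -> z \in S -> z != w ->
  (r' o0 v < r' o0 z) && (r' o0 w < r' o0 z) || (r' o1 v < r' o1 z) && (r' o1 w < r' o1 z).
  move=> wM zS zw.
  have wS : w \in S.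
    by move: wM; rewrite in_cons mem_rcons in_cons => /or3P[/eqP->|/eqP->|/MS].
  have r0 : rcons M b != [::] by case: (M).
  have pth : path [rel x y | under r S x y && left_right r x y] a (rcons M b).
    by rewrite path_relI sCM.
  have [x [y [/= /andP[/underP Cxy /andP[xy0 xy1]] xB yB wxy]]] := path_pair pth r0 wM.
  rewrite belast_rcons in xB; have [x1 x2] := lowA _ xB; have [y1 y2] := lowB _ yB.
  have xS : x \in S by move: xB; rewrite in_cons => /orP[/eqP->|/MS].
  have yS : y \in S by move: yB; rewrite mem_rcons in_cons => /orP[/eqP->|/MS].
  rewrite r'v0 r'v1 !r'S //.
  case: (eqVneq z x) => [zx|zx].
    have wy : w = y by case/orP: wxy => /eqP // wx; rewrite zx wx eqxx in zw.
    by rewrite wy zx; nlia.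
  case: (eqVneq z y) => [zy|zy].
    have wx : w = x by case/orP: wxy => /eqP // wy; rewrite zy wy eqxx in zw.
    by rewrite wx zy; nlia.
  have := Cxy z zS zx zy.
  by case/orP: wxy => /eqP->; nlia.
have newD z : z \in S -> (r' o0 v < r' o0 z) || (r' o1 v < r' o1 z).
  move=> zS; case: (eqVneq z a) => [->|za].
    by rewrite r'v0 r'S //; have [] := lowA a (mem_head _ _); nlia.
  by have := newE a z (mem_head _ _) zS za; nlia.
exists r'; split.
- split=> [x y z|x z].
    rewrite !in_setU1; case: (eqVneq z v) => [-> xS yS _ _ vx vy|zv /=].
      exists o2; rewrite eq_sym (negPf vx) /= in xS; rewrite eq_sym (negPf vy) /= in yS.
      by rewrite r'v2 !r'S //; have := topP x; have := topP y; nlia.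
    case: (eqVneq x v) => [-> _|xv /= xS].
      case: (eqVneq y v) => [-> _ _|yv /= yS]; first by rewrite eirr.
      move=> zS evy _ zy; have := newE y z (vM y yS evy) zS zy.
      by case/orP=> /andP[? ?]; [exists o0 | exists o1].
    case: (eqVneq y v) => [-> _ zS|yv /= yS zS exy zx zy].
      rewrite esym => evx zx _; have := newE x z (vM x xS evx) zS zx.
      by case/orP=> /andP[? ?]; [exists o0 | exists o1].
    have [i [h1 h2]] := rE x y z xS yS zS exy zx zy.
    by exists i; rewrite !r'S //; split; nlia.
  rewrite !in_setU1; case: (eqVneq x v) => [->|xv /= xS].
    case: (eqVneq z v) => [_ _ //|_ _ /= zS _].
    by case/orP: (newD z zS) => ?; [exists o0 | exists o1].
  case: (eqVneq z v) => [-> _ _|_ /= zS xz].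
    by exists o2; rewrite r'v2 r'S //; have := topP x; nlia.
  by have [i h] := rD x z xS zS xz; exists i; rewrite !r'S //; nlia.
- have norm_b : r o0 t <= r o0 b /\ r o0 b <= r o0 s.
    case: (eqVneq b s) => [->|bs]; first nlia.
    case: (eqVneq b t) => [->|bt]; first nlia.
    by have [? _ _ _] := rN b bS bs bt; nlia.
  have norm_a : r o1 s <= r o1 a /\ r o1 a <= r o1 t.
    case: (eqVneq a s) => [->|bs]; first nlia.
    case: (eqVneq a t) => [->|bt]; first nlia.
    by have [_ ? _ _] := rN a aS bs bt; nlia.
  have norm_a0 : r o0 a <= r o0 s.
    case: (eqVneq a s) => [->|bs]; first nlia.
    case: (eqVneq a t) => [->|bt]; first nlia.
    by have [? _ _ _] := rN a aS bs bt; nlia.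
  have norm_b1 : r o1 b <= r o1 t.
    case: (eqVneq b s) => [->|bs]; first nlia.
    case: (eqVneq b t) => [->|bt]; first nlia.
    by have [_ ? _ _] := rN b bS bs bt; nlia.
  case: norm_b => ? ?; case: norm_a => ? ?.
  have [ab0 _] := lowA a (mem_head _ _).
  have [ab1 _] : r o1 a < r o1 b /\ r o1 b <= r o1 b.
    by apply: lowB; rewrite mem_rcons mem_head.
  split; rewrite ?r'S //; try nlia.
  move=> z; rewrite in_setU1; case: (eqVneq z v) => [-> _ vs vt|zv /= zS zs zt].
    by rewrite r'v0 r'v1 r'v2 ?r'S //; have := topP s; have := topP t; split; nlia.
  have [/andP[? ?] /andP[? ?] ? ?] := rN z zS zs zt.
  by rewrite !r'S //; split; nlia.
- move=> x; rewrite mem_cat !in_cons in_setU1.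
  by case/or4P=> [/L1S->|/eqP->|->|/orP[/eqP->|/L2S->]]; rewrite ?aS ?bS ?orbT.
- have lrS x y : x \in S -> y \in S -> left_right r x y -> left_right r' x y.
    by move=> xS yS; rewrite /left_right !r'S // => /andP[? ?]; apply/andP; split; nlia.
  have lr2 (A B : seq V) : {subset A <= S} -> {subset B <= S} ->
      {in A & B, forall x y, left_right r x y} -> {in A & B, forall x y, left_right r' x y}.
    by move=> AS BS h x y xA yB; apply: lrS; [apply: AS | apply: BS | apply: h].
  have pwS l : {subset l <= S} -> pairwise (left_right r) l -> pairwise (left_right r') l.
    elim: l => //= x l IH lS /andP[/allP h pl]; rewrite IH // ?andbT; last first.
      by move=> y yl; apply: lS; rewrite in_cons yl orbT.
    apply/allP=> y yl; apply: lrS (h y yl); apply: lS; by rewrite in_cons ?yl ?eqxx ?orbT.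
  have ab : (r o0 b < r o0 a) && (r o1 a < r o1 b) by [].
  have av : left_right r' a v.
    by rewrite /left_right r'v0 r'v1 !r'S //; case/andP: ab => ? ?; apply/andP; split; nlia.
  have vb : left_right r' v b.
    by rewrite /left_right r'v0 r'v1 !r'S //; case/andP: ab => ? ?; apply/andP; split; nlia.
  have lrT : transitive (left_right r').
    move=> y x z /andP[? ?] /andP[? ?]; apply/andP; split; nlia.
  have vL2 x : x \in L2 -> left_right r' v x.
    by move=> xL; apply: lrT vb _; apply: lrS (pbL2 x xL) => //; apply: L2S.
  have L1v x : x \in L1 -> left_right r' x v.
    move=> xL; apply: lrT _ av; apply: lrS; rewrite ?aS ?L1S //.
    by apply: pw1 => //; rewrite mem_head.
  rewrite pairwise_cat /= !pwS // !andbT av vb /=; apply/and4P; split.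
  + apply/allrelP=> x y xL; rewrite !in_cons => /or4P[/eqP->|/eqP->|/eqP->|yL]; [|exact: L1v| |].
    * by apply: lrS; [apply: L1S | | apply: pw1; rewrite ?mem_head].
    * by apply: lrS; [apply: L1S | | apply: pw1; rewrite ?(mem_cat, in_cons) ?eqxx ?orbT].
    * by apply: lrS; [apply: L1S | apply: L2S | apply: pw1; rewrite ?(mem_cat, in_cons) ?yL ?orbT].
  + rewrite lrS //=; apply/allP=> x xL; apply: lrS (paL2 _ xL) => //; exact: L2S.
  + by apply/allP.
  + by apply/allP=> x xL; apply: lrS (pbL2 _ xL) => //; exact: L2S.
(* Up to [a] the old frontier is below [v] in the second order, and from [b] on it is below [v] in
   the first, so its edges stay visible. *)
- have rc (l : seq V) : {subset l <= S} -> {subset rcons l a <= S}.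
    by move=> lS x; rewrite mem_rcons in_cons => /orP[/eqP->|/lS].
  rewrite sorted_cat_cons /=; apply/and4P; split.
  + apply: (sub_in_sorted (P := mem [pred x in rcons L1 a])) sC1; last exact/allP.
    move=> x y xL yL /underP Cxy; have xS := rc _ L1S x xL; have yS := rc _ L1S y yL.
    have low u : u \in rcons L1 a -> r o1 u <= r o1 a.
      rewrite mem_rcons in_cons => /orP[/eqP->//|uL].
      by have /andP[_ /ltnW] := pw1 u a uL (mem_head _ _).
    apply/underP=> z; rewrite in_setU1; case: (eqVneq z v) => [-> _ _ _|zv /= zS zx zy].
      have := low x xL; have := low y yL => ? ?.
      by apply/orP; right; rewrite r'v1 (r'S _ _ xS) (r'S _ _ yS); nlia.
    by have := Cxy z zS zx zy; rewrite !r'S //; nlia.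
  + apply/underP=> z; rewrite in_setU1; case: (eqVneq z v) => [_ _ _ //|_ /= zS za _].
    have := newE a z (mem_head _ _) zS za; nlia.
  + apply/underP=> z; rewrite in_setU1; case: (eqVneq z v) => [_ _ //|_ /= zS _ zb].
    by apply: newE => //; rewrite in_cons mem_rcons mem_head orbT.
  + apply: (sub_in_path (P := mem [pred x in b :: L2])) sC2; last exact/allP.
    have bL x : x \in b :: L2 -> x \in S by rewrite in_cons => /orP[/eqP->|/L2S].
    move=> x y xL yL /underP Cxy; have xS := bL x xL; have yS := bL y yL.
    have low u : u \in b :: L2 -> r o0 u <= r o0 b.
      rewrite in_cons => /orP[/eqP->//|uL].
      by have /andP[/ltnW] := pbL2 u uL.
    apply/underP=> z; rewrite in_setU1; case: (eqVneq z v) => [-> _ _ _|zv /= zS zx zy].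
      have := low x xL; have := low y yL => ? ?.
      by apply/orP; left; rewrite r'v0 (r'S _ _ xS) (r'S _ _ yS); nlia.
    by have := Cxy z zS zx zy; rewrite !r'S //; nlia.
Qed.
(** The later vertices of a long ear see only their predecessor and [b] among what is placed, so
    each is placed over an empty interval. *)
Lemma frontier_chain s t S L1 a b L2 r p :
  s \in S -> t \in S ->
  frontier s t S (L1 ++ a :: b :: L2) r -> uniq p -> {in p, forall x, x \notin S} ->
  (forall p1 x p2, p = p1 ++ x :: p2 -> forall y, (y \in S) || (y \in p1) -> e x y ->
     (y == last a p1) || (y == b)) ->
  exists r', frontier s t ([set x in p] :|: S) (L1 ++ a :: p ++ b :: L2) r'.
Proof.
elim: p L1 a S r => [|x p IH] L1 a S r sS tS fr.
  move=> _ _ _; exists r; suff -> : [set x in [::]] :|: S = S by [].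
  by apply/setP=> z; rewrite !inE.
move=> /= /andP[xp up] pS H.
have [||r1 fr1] := @frontier_place s t S L1 a [::] b L2 r x sS tS fr.
- exact: pS (mem_head _ _).
- move=> y yS exy; rewrite !inE; apply: (H [::] x p erefl) exy.
  by rewrite yS.
have sS' : s \in x |: S by rewrite in_setU1 sS orbT.
have tS' : t \in x |: S by rewrite in_setU1 tS orbT.
rewrite -cat_rcons in fr1.
have [|p1 y p2 pE z zS eyz|r2 fr2] := IH _ _ _ _ sS' tS' fr1 up.
- move=> y yp; rewrite in_setU1 negb_or pS ?in_cons ?yp ?orbT // andbT.
  by apply: contraNneq xp => <-.
- apply: (H (x :: p1) y p2) eyz; first by rewrite pE.
  by move: zS; rewrite in_setU1 in_cons; case: (z == x); rewrite ?orbT.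
exists r2; move: fr2; rewrite cat_rcons.
suff -> : [set z in p] :|: (x |: S) = [set z in x :: p] :|: S by [].
by apply/setP=> z; rewrite !inE orbCA orbA.
Qed.

End Realizer.

(** * Branch sets *)

Section Models.
Variables (V : finType) (e : rel V).

Definition model (H : finType) (h : rel H) (B : H -> {set V}) :=
  [/\ forall i, conn e (B i), forall i j, i != j -> [disjoint B i & B j] &
      forall i j, h i j -> adj e (B i) (B j)].

Definition has_model (H : finType) (h : rel H) := exists B, model h B.

Definition kfree := ~ has_model (@complete_rel 5) /\ ~ has_model (@bipartite_rel 3 3).

Hypothesis esym : symmetric e.

Let nth_disj (l : seq {set V}) i j : pairwise (fun A B : {set V} => [disjoint A & B]) l ->
  i < size l -> j < size l -> i != j -> [disjoint nth set0 l i & nth set0 l j].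
Proof.
move=> /(pairwiseP set0) pw il jl; rewrite neq_ltn => /orP[ij|ji]; first exact: pw.
by rewrite disjoint_sym; apply: pw.
Qed.

Lemma K33_model (l1 l2 : seq {set V}) : size l1 = 3 -> size l2 = 3 ->
  all (conn e) (l1 ++ l2) -> pairwise (fun A B : {set V} => [disjoint A & B]) (l1 ++ l2) ->
  allrel (adj e) l1 l2 -> has_model (@bipartite_rel 3 3).
Proof.
move=> s1 s2 /all_nthP-/(_ set0) cl pw /allrelP al.
pose idx (x : 'I_3 + 'I_3) := match x with inl i => i : nat | inr i => 3 + i end.
have sz : size (l1 ++ l2) = 6 by rewrite size_cat s1 s2.
have idx_lt x : idx x < 6 by case: x => i /=; have := ltn_ord i; case: (val i) => [|[|[]]].
have idx_inj : injective idx.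
  move=> [i|i] [j|j] /= ij; try by congr (_ _); apply: val_inj => //=; apply/eqP; rewrite -(eqn_add2l 3) ij.
    by have := ltn_ord i; rewrite ij.
  by have := ltn_ord j; rewrite -ij.
exists (fun x => nth set0 (l1 ++ l2) (idx x)); split=> [x|x y xy|x y].
- by apply: cl; rewrite sz.
- by apply: nth_disj; rewrite ?sz // (inj_eq idx_inj).
- case: x y => [i|i] [j|j] //= _; rewrite !nth_cat s1 ltn_ord -[_ < 3]negbK -leqNgt leq_addr /= addKn.
    by apply: al; apply: mem_nth; rewrite ?s1 ?s2.
  by rewrite adjC //; apply: al; apply: mem_nth; rewrite ?s1 ?s2.
Qed.

Lemma K5_model (l : seq {set V}) : size l = 5 ->
  all (conn e) l -> pairwise (fun A B : {set V} => [disjoint A & B]) l ->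
  pairwise (adj e) l -> has_model (@complete_rel 5).
Proof.
move=> sz /all_nthP-/(_ set0) cl pw /(pairwiseP set0) pa.
exists (fun x : 'I_5 => nth set0 l x); split=> [x|x y xy|x y].
- by apply: cl; rewrite sz.
- by apply: nth_disj; rewrite ?sz.
- rewrite /complete_rel => /= xy.
  have : (x : nat) != y by [].
  rewrite neq_ltn => /orP[xy'|yx]; first by apply: pa; rewrite ?inE ?sz.
  by rewrite adjC //; apply: pa; rewrite ?inE ?sz.
Qed.

Lemma disjI (A B : {set V}) : (forall z, z \in A -> z \in B -> False) -> [disjoint A & B].
Proof.
move=> H; rewrite disjoint_subset; apply/subsetP=> z zA; rewrite inE.
by apply/negP=> /(H z zA).
Qed.

(** The sides of K33 are [a], [b], [W] and [X], [M], [O], where [O] is what remains of the cycle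
    formed by [L] and the edge between its ends; when [L1] and [L2] are both nonempty, that edge
    connects [O]. *)
Lemma bury_outer L1 a M b L2 (X W : {set V}) :
  let L := L1 ++ a :: M ++ b :: L2 in
  uniq L -> sorted e L -> e (head a L1) (last b L2) ->
  {in L, forall z, z \notin X} -> {in L, forall z, z \notin W} -> [disjoint X & W] ->
  conn e X -> conn e W -> adj e [set a] X -> adj e [set b] X -> adj e X W ->
  (exists2 m, m \in M & adj e [set m] W) ->
  (exists2 o, o \in L1 ++ L2 & adj e [set o] W) -> has_model (@bipartite_rel 3 3).
Proof.
move=> L uL sL est LX LW dXW cX cW aX bX XW [m mM mW] [o oO oW].
have LL z : z \in L1 ++ L2 -> z \in L.
  by rewrite !(mem_cat, in_cons) => /orP[]->; rewrite ?orbT.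
have ML z : z \in M -> z \in L by move=> zM; rewrite !(mem_cat, in_cons) zM ?orbT.
have aL : a \in L by rewrite !(mem_cat, in_cons) eqxx ?orbT.
have bL : b \in L by rewrite !(mem_cat, in_cons) eqxx ?orbT.
have s1 : sorted e L1 := sorted_catl sL.
have s2 : path e a (M ++ b :: L2) := sorted_catr sL.
have sb : path e b L2 by move: s2; rewrite cat_path /= => /and3P[].
have sM : path e a M by move: s2; rewrite cat_path /= => /andP[].
have eMb : e (last a M) b by move: s2; rewrite cat_path /= => /and3P[].
have aM : adj e [set a] [set z in M].
  case: (M) mM sM => // c M' _ /= /andP[eac _].
  by apply: (adjI _ _ eac); rewrite inE ?mem_head.
have bM : adj e [set b] [set z in M].
  rewrite adjC //; apply: (adjI _ _ eMb); rewrite ?inE //.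
  by case: (M) mM => //= c M' _; rewrite mem_last.
have L1a : L1 != [::] -> e (last a L1) a.
  move: (sL); rewrite /L; case: (L1) => // c L1' /=; rewrite cat_path => /andP[_ /=].
  by case/andP.
pose O := [set z in L1 ++ L2].
(* If [L1] is empty, then [a] is the head of [L] and reaches [O] through the closing edge. *)
have aO : adj e [set a] O.
  case: (altP (L1 =P [::])) => [L10|/[dup] L10 /L1a ela].
    move: est oO; rewrite /O L10 /=; case: (L2) => //= c L2' elc _.
    by apply: (adjI _ _ elc); rewrite inE // mem_last.
  rewrite adjC //; apply: (adjI _ _ ela); rewrite !inE // mem_cat.
  by case: (L1) L10 => //= c L1' _; rewrite mem_last.
have bO : adj e [set b] O.
  case: (altP (L2 =P [::])) => [L20|L20].
    move: est oO; rewrite /O L20 /= cats0; case: (L1) => //= c L1' ecb _.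
    by rewrite adjC //; apply: (adjI _ _ ecb); rewrite inE // mem_head.
  case L2E: L2 L20 => [//|c L2'] _; rewrite /O L2E.
  have ebc : e b c by move: sb; rewrite L2E => /andP[].
  by apply: (adjI _ _ ebc); rewrite inE // mem_cat mem_head orbT.
have cO : conn e O.
  case: (altP (L1 =P [::])) => [L10|L10].
    by rewrite /O L10 /=; apply: conn_seq (path_sorted sb) => //; case: (L2) oO; rewrite L10.
  case: (altP (L2 =P [::])) => [L20|L20].
    by rewrite /O L20 cats0; apply: conn_seq.
  rewrite /O (_ : [set _ in _] = [set z in L1] :|: [set z in L2]); last first.
    by apply/setP=> z; rewrite !inE mem_cat.
  apply: connU => //; [exact: conn_seq | exact: conn_seq (path_sorted sb) | right].
  apply: (adjI _ _ est); rewrite inE.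
    by case: (L1) L10 => //= c L1' _; rewrite mem_head.
  by case: (L2) L20 => //= c L2' _; rewrite mem_last.
have Wo : adj e W O.
  by rewrite adjC //; apply: adjS oW => //; rewrite sub1set inE.
have cM : conn e [set z in M].
  by apply: conn_seq (path_sorted sM) => //; case: (M) mM.
have WM : adj e W [set z in M].
  by rewrite adjC //; apply: adjS mW => //; rewrite sub1set inE.
move: uL; rewrite cat_uniq => /and3P[u1 /hasPn h1].
rewrite cons_uniq cat_uniq => /andP[na /and3P[uM /hasPn h2 /= /andP[nbL2 u2]]].
move: na; rewrite mem_cat in_cons !negb_or => /and3P[naM nab naL2].
have n1 z : z \in L1 -> [&& z != a, z \notin M, z != b & z \notin L2].
  move=> zL; have h x : x \in a :: M ++ b :: L2 -> x \in L1 -> False.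
    by move=> /h1/negP.
  apply/and4P; split; [|apply/negP=> zM|apply/negP=> /eqP zb|apply/negP=> zM].
  - by apply/eqP=> za; case: (h a); [rewrite mem_head | rewrite -za].
  - by case: (h z); rewrite // !(mem_cat, in_cons) zM orbT.
  - by case: (h z); rewrite // !(mem_cat, in_cons) zb eqxx !orbT.
  - by case: (h z); rewrite // !(mem_cat, in_cons) zM !orbT.
have n2 z : z \in M -> (z != b) && (z \notin L2).
  move=> zM; apply/andP; split.
    by apply/eqP=> zb; move: (h2 b (mem_head _ _)); rewrite /= -zb zM.
  by apply/negP=> zL; move: (h2 z); rewrite /= in_cons zL orbT zM => /(_ isT).
apply: (@K33_model [:: [set a]; [set b]; W] [:: X; [set z in M]; O]) => //=.
- by rewrite !conn1 ?cW ?cX ?cM ?cO.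
- rewrite !andbT; do ![apply/andP; split]; apply: disjI => z; rewrite ?inE.
  + by move=> /eqP-> ab; rewrite ab in nab.
  + by move=> /eqP-> aW; rewrite (negPf (LW _ aL)) in aW.
  + by move=> /eqP-> aW; rewrite (negPf (LX _ aL)) in aW.
  + by move=> /eqP-> aW; rewrite aW in naM.
  + by move=> /eqP->; rewrite mem_cat (negPf naL2) orbF => /n1; rewrite eqxx.
  + by move=> /eqP-> aW; rewrite (negPf (LW _ bL)) in aW.
  + by move=> /eqP-> aW; rewrite (negPf (LX _ bL)) in aW.
  + by move=> /eqP-> /n2; rewrite eqxx.
  + by move=> /eqP->; rewrite mem_cat (negPf nbL2) orbF => /n1; rewrite eqxx !andbF.
  + by move=> zW zX; rewrite (disjointFr dXW zX) in zW.
  + by move=> zW /ML/LW; rewrite zW.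
  + by move=> zW /LL/LW; rewrite zW.
  + by move=> zW /ML/LX; rewrite zW.
  + by move=> zW /LL/LX; rewrite zW.
  + move=> zM; rewrite mem_cat => /orP[/n1|]; rewrite ?zM ?andbF //.
    by case/andP: (n2 z zM) => _ /negPf->.
- by rewrite /allrel /= aX aM aO bX bM bO adjC // XW WM Wo.
Qed.

(** The empty set encodes a direct edge, so that [A :|: D] makes sense in both cases. *)
Definition linker (A B D : {set V}) :=
  D = set0 /\ adj e A B \/ [/\ conn e D, adj e A D & adj e D B].

(** Each pair of the three sets is linked away from the third. If two linkers meet, their union sees
    all three sets and forms K33 together with [s] and [t]; if the linkers are disjoint, each set
    absorbs one of them and K5 appears. *)
Lemma rooted_triangle (s t : V) (A1 A2 A3 : {set V}) :
  e s t -> s != t ->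
  let R := ~: [set s; t] in
  [/\ A1 \subset R, A2 \subset R & A3 \subset R] ->
  [/\ conn e A1, conn e A2 & conn e A3] ->
  [/\ [disjoint A1 & A2], [disjoint A1 & A3] & [disjoint A2 & A3]] ->
  (forall A, A \in [:: A1; A2; A3] -> adj e [set s] A && adj e [set t] A) ->
  (exists W, [/\ conn e W, W \subset R :\: A3, A1 \subset W & A2 \subset W]) ->
  (exists W, [/\ conn e W, W \subset R :\: A1, A2 \subset W & A3 \subset W]) ->
  (exists W, [/\ conn e W, W \subset R :\: A2, A1 \subset W & A3 \subset W]) ->
  has_model (@complete_rel 5) \/ has_model (@bipartite_rel 3 3).
Proof.
move=> est nst R [R1 R2 R3] [c1 c2 c3] [d12 d13 d23] st [W3 [cW3 RW3 s31 s32]]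
  [W1 [cW1 RW1 s12 s13]] [W2 [cW2 RW2 s21 s23]].
have link (A B C W : {set V}) : conn e A -> conn e B -> [disjoint A & B] -> conn e W ->
    W \subset R :\: C -> A \subset W -> B \subset W ->
    exists2 D, linker A B D & [/\ D \subset R, [disjoint D & A], [disjoint D & B] & [disjoint D & C]].
  move=> cA cB dAB cW RW AW BW.
  have [||| h|[D [cD DW AD DB]]] := @conn_link _ e esym W A B cW AW.
  - exact: conn_neq0 cA.
  - by have /set0Pn[b bB] := conn_neq0 cB; exists b => //; apply: (subsetP BW).
  - exact: dAB.
  - by exists set0; [left | rewrite sub0set -!setI_eq0 !set0I eqxx].
  exists D; first by right.
  have in_D z : z \in D -> [&& z \in R, z \notin A, z \notin B & z \notin C].
    move=> /(subsetP DW); rewrite in_setD in_setU negb_or => /andP[/andP[-> ->]].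
    by move=> /(subsetP RW); rewrite in_setD => /andP[-> ->].
  split; first by apply/subsetP=> z /in_D/and4P[].
  - by apply: disjI => z /in_D/and4P[_ /negP].
  - by apply: disjI => z /in_D/and4P[_ _ /negP].
  - by apply: disjI => z /in_D/and4P[_ _ _ /negP].
have [D12 l12 [R12 e12 e12' e12'']] := link _ _ _ _ c1 c2 d12 cW3 RW3 s31 s32.
have [D23 l23 [R23 e23 e23' e23'']] := link _ _ _ _ c2 c3 d23 cW1 RW1 s12 s13.
have [D13 l13 [R13 e13 e13' e13'']] := link _ _ _ _ c1 c3 d13 cW2 RW2 s21 s23.
have stR (A : {set V}) z : A \subset R -> z \in A -> (z != s) && (z != t).
  by move=> /subsetP AR /AR; rewrite !inE negb_or.
have ds (A : {set V}) : A \subset R -> [disjoint [set s] & A].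
  by move=> AR; apply: disjI => z /set1P-> /(stR _ _ AR); rewrite eqxx.
have dt (A : {set V}) : A \subset R -> [disjoint [set t] & A].
  by move=> AR; apply: disjI => z /set1P-> /(stR _ _ AR); rewrite eqxx andbF.
have dst : [disjoint [set s] & [set t]].
  by apply: disjI => z /set1P-> /set1P st'; rewrite st' eqxx in nst.
have ast : adj e [set s] [set t] by apply: (adjI _ _ est); rewrite inE.
have claw (Y : {set V}) : conn e Y -> Y \subset R ->
    [/\ [disjoint Y & A1], [disjoint Y & A2] & [disjoint Y & A3]] ->
    [/\ adj e Y A1, adj e Y A2 & adj e Y A3] -> has_model (@bipartite_rel 3 3).
  move=> cY YR [y1 y2 y3] [a1 a2 a3].
  have /andP[sA1 tA1] := st A1 (mem_head _ _).
  have /andP[sA2 tA2] : adj e [set s] A2 && adj e [set t] A2 by apply: st; rewrite !inE eqxx orbT.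
  have /andP[sA3 tA3] : adj e [set s] A3 && adj e [set t] A3 by apply: st; rewrite !inE eqxx !orbT.
  apply: (@K33_model [:: [set s]; [set t]; Y] [:: A1; A2; A3]) => //=.
  - by rewrite !conn1 cY c1 c2 c3.
  - by rewrite dst !ds ?dt // y1 y2 y3 d12 d13 d23.
  - by rewrite /allrel /= sA1 sA2 sA3 tA1 tA2 tA3 a1 a2 a3.
have lk (A B D : {set V}) z : linker A B D -> z \in D -> [/\ conn e D, adj e A D & adj e D B].
  by case=> [[-> _]|//]; rewrite inE.
have both (A B C D E E' : {set V}) z : linker A B D -> linker C E E' -> z \in D -> z \in E' ->
    [/\ conn e (D :|: E'), adj e (D :|: E') A, adj e (D :|: E') B, adj e (D :|: E') C
      & adj e (D :|: E') E].
  move=> l1 l2 zD zE; have [cD AD DB] := lk _ _ _ _ l1 zD.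
  have [cE CE EE] := lk _ _ _ _ l2 zE.
  split; first by apply: connU => //; left; exists z.
  - by rewrite adjC //; apply: adjS AD => //; apply: subsetUl.
  - by apply: adjS DB => //; apply: subsetUl.
  - by rewrite adjC //; apply: adjS CE => //; apply: subsetUr.
  - by apply: adjS EE => //; apply: subsetUr.
have dU (A B C : {set V}) : [disjoint A & C] -> [disjoint B & C] -> [disjoint A :|: B & C].
  by move=> h1 h2; rewrite -setI_eq0 setIUl setU_eq0 !setI_eq0 h1.
case: (boolP [disjoint D12 & D13]) => [n1|]; last first.
  rewrite -setI_eq0 => /set0Pn[z /setIP[z1 z2]]; right.
  have [cY Y1 Y2 _ Y3] := both _ _ _ _ _ _ _ l12 l13 z1 z2.
  by apply: (claw _ cY); rewrite ?subUset ?R12 //; split=> //; apply: dU.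
case: (boolP [disjoint D12 & D23]) => [n2|]; last first.
  rewrite -setI_eq0 => /set0Pn[z /setIP[z1 z2]]; right.
  have [cY Y1 Y2 _ Y3] := both _ _ _ _ _ _ _ l12 l23 z1 z2.
  by apply: (claw _ cY); rewrite ?subUset ?R12 //; split=> //; apply: dU.
case: (boolP [disjoint D13 & D23]) => [n3|]; last first.
  rewrite -setI_eq0 => /set0Pn[z /setIP[z1 z2]]; right.
  have [cY Y1 Y2 Y3 _] := both _ _ _ _ _ _ _ l13 l23 z1 z2.
  by apply: (claw _ cY); rewrite ?subUset ?R13 //; split=> //; apply: dU.
left.
have grow (A B D : {set V}) : conn e A -> linker A B D ->
    conn e (A :|: D) /\ adj e (A :|: D) B.
  move=> cA [[-> AB]|[cD AD DB]]; first by rewrite setU0.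
  by split; [apply: connU => //; right | apply: adjS DB => //; apply: subsetUr].
have [g1 a12] := grow _ _ _ c1 l12; have [g2 a23] := grow _ _ _ c2 l23.
have [g3 a31] : conn e (A3 :|: D13) /\ adj e (A3 :|: D13) A1.
  apply: grow => //; case: l13 => [[-> h]|[h1 h2 h3]]; [left|right].
    by split=> //; rewrite adjC.
  by split=> //; rewrite adjC.
have dUU (A B C D : {set V}) : [disjoint A & C] -> [disjoint A & D] -> [disjoint B & C] ->
    [disjoint B & D] -> [disjoint A :|: B & C :|: D].
  move=> h1 h2 h3 h4; rewrite -setI_eq0 setIUl !setIUr !setU_eq0 !setI_eq0.
  by rewrite h1 h2 h3 h4.
have sr (A D : {set V}) : adj e A D -> forall D', adj e A (D :|: D').
  by move=> h D'; apply: adjS h => //; apply: subsetUl.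
apply: (@K5_model [:: [set s]; [set t]; A1 :|: D12; A2 :|: D23; A3 :|: D13]) => //=.
- by rewrite !conn1 g1 g2 g3.
- rewrite dst !ds ?dt ?subUset ?R1 ?R2 ?R3 //= ?andbT.
  by apply/andP; split; [apply/andP; split|]; apply: dUU => //; rewrite disjoint_sym.
- have /andP[sA1 tA1] := st A1 (mem_head _ _).
  have /andP[sA2 tA2] : adj e [set s] A2 && adj e [set t] A2 by apply: st; rewrite !inE eqxx orbT.
  have /andP[sA3 tA3] : adj e [set s] A3 && adj e [set t] A3 by apply: st; rewrite !inE eqxx !orbT.
  rewrite ast (sr _ _ sA1) (sr _ _ sA2) (sr _ _ sA3) (sr _ _ tA1) (sr _ _ tA2) (sr _ _ tA3).
  by rewrite (sr _ _ a12) (sr _ _ a23) adjC // (sr _ _ a31).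
Qed.

End Models.

(** * Shelling *)

Lemma split_ends (T : eqType) (p : pred T) (l : seq T) x y :
  x \in l -> y \in l -> x != y -> p x -> p y ->
  exists L1 a M b L2, [/\ l = L1 ++ a :: M ++ b :: L2, p a, p b &
    forall z, z \in l -> p z -> z \in a :: rcons M b].
Proof.
move=> xl yl xy px py.
have /split_first[L1 [a [K [lE pa nL1]]]] : has p l by apply/hasP; exists x.
have inK z : z \in l -> p z -> z != a -> z \in K.
  move=> zl pz za; move: zl; rewrite lE mem_cat in_cons (negPf za) /=.
  by case/orP=> // zL; case/hasP: nL1; exists z.
have hK : has p (rev K).
  apply/hasP; case: (eqVneq x a) => [xa|xa].
    by exists y; rewrite // mem_rev inK // -xa eq_sym.
  by exists x; rewrite // mem_rev inK.
have [L2 [b [M [KE pb nL2]]]] := split_first hK.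
have {}KE : K = rev M ++ b :: rev L2.
  by rewrite -[K]revK KE rev_cat rev_cons cat_rcons.
exists L1, a, (rev M), b, (rev L2); split=> //; first by rewrite lE KE.
move=> z zl pz; rewrite in_cons mem_rcons in_cons; case: (eqVneq z a) => //= za.
have := inK z zl pz za; rewrite KE mem_cat in_cons !mem_rev.
by case/or3P=> [->|->|zL]; rewrite ?orbT //; case/hasP: nL2; exists z.
Qed.

Section Shelling.
Variables (V : finType) (e : rel V).
Hypotheses (esym : symmetric e) (eirr : irreflexive e).
Implicit Types (A X U S D : {set V}) (L : seq V).

(** Orients the ear along [L], so that its first vertex sees only the interval from [a] to [b] and
    the others see at most [b]. A one-vertex ear has its extreme neighbours as [a] and [b]; a long
    ear that runs backwards is reversed. *)
Lemma ear_normal L U P : uniq L -> {in L, forall z, z \notin U} -> [set z in P] \subset U ->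
  uniq P -> sorted e P -> ear_shape e [set z in L] P ->
  exists L1 a M b L2 x p, [/\ L = L1 ++ a :: M ++ b :: L2, [set z in P] = [set z in x :: p],
    uniq (x :: p), path e x p & [/\ e a x, e (last x p) b,
    forall l, l \in L -> e x l -> l \in a :: rcons M b,
    forall z l, z \in p -> l \in L -> e z l -> l = b &
    forall p1 z p2 y p3, x :: p = p1 ++ z :: p2 ++ y :: p3 -> e z y -> p2 = [::]]].
Proof.
move=> uL LU PU uP sP [[u Pu N]|[u [u' [q [w [w' [wL w'L ww PE [F ch]]]]]]]].
  have [l1 [l2 [l1N l2N l12]]] := card_gt1P N.
  have [_ /set1P-> [l1L _ ul1]] := NLP _ _ _ _ l1N.
  have [_ /set1P-> [l2L _ ul2]] := NLP _ _ _ _ l2N.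
  rewrite !inE in l1L l2L.
  have [L1 [a [M [b [L2 [LE ua ub H]]]]]] := split_ends l1L l2L l12 ul1 ul2.
  exists L1, a, M, b, L2, u, [::]; rewrite Pu; split=> //; split=> //; first by rewrite esym.
  by move=> p1 z p2 y p3 /(congr1 size); rewrite size_cat /= size_cat /= !addnS.
rewrite !inE in wL w'L.
have pw : [pred z | (z == w) || (z == w')] w by rewrite /= eqxx.
have pw' : [pred z | (z == w) || (z == w')] w' by rewrite /= eqxx orbT.
have [L1 [a [M [b [L2 [LE ua ub H]]]]]] := split_ends wL w'L ww pw pw'.
have ab : a != b.
  apply/eqP=> ab; move: uL; rewrite LE ab cat_uniq => /and3P[_ _] /=.
  by rewrite mem_cat in_cons eqxx orbT.
have uu : u != u'.
  by apply/eqP=> uu; move: uP; rewrite PE -uu /= mem_rcons mem_head.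
have uP' : u \in P by rewrite PE mem_head.
have u'P : u' \in P by rewrite PE in_cons mem_rcons mem_head orbT.
have inL x : x \in L -> x \in [set z in L] by rewrite inE.
have aL : a \in L by rewrite LE mem_cat mem_head orbT.
have bL : b \in L by rewrite LE !(mem_cat, in_cons) eqxx !orbT.
have [[aw bw]|[aw bw]] : (a = w /\ b = w') \/ (a = w' /\ b = w).
- by case/orP: ua => /eqP aE; case/orP: ub => /eqP bE; move: ab; rewrite aE bE ?eqxx; auto.
- exists L1, a, M, b, L2, u, (rcons q u'); rewrite -PE last_rcons; split=> //.
    by move: sP; rewrite PE.
  split=> //.
  + by rewrite esym F ?inL // aw !eqxx.
  + by rewrite F ?inL // bw !eqxx orbT.
  + move=> l lL; rewrite F ?inL // eqxx (negPf uu) /= orbF -aw => /eqP->.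
    exact: mem_head.
  + move=> z l zp lL; have zP : z \in P by rewrite PE in_cons zp orbT.
    rewrite F ?inL // => /orP[/andP[/eqP zu _]|/andP[_ /eqP->//]].
    by move: uP; rewrite PE /= -zu zp.
- have rE : rev P = u' :: rev (u :: q) by rewrite PE -rcons_cons rev_rcons.
  exists L1, a, M, b, L2, u', (rev (u :: q)); split=> //.
  + by rewrite -rE; apply/setP=> z; rewrite !inE mem_rev.
  + by rewrite -rE rev_uniq.
  + have : sorted e (rev P).
      by rewrite rev_sorted (eq_sorted (e' := e)) // => x y /=; exact: esym.
    by rewrite rE.
  + rewrite rev_cons last_rcons; split=> //.
    * by rewrite esym F ?inL // aw !eqxx orbT.
    * by rewrite F ?inL // bw !eqxx.
    * move=> l lL; rewrite F ?inL // eqxx [u' == u]eq_sym (negPf uu) /= -aw => /eqP->.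
      exact: mem_head.
    * move=> z l zp lL; have zP : z \in P.
        by rewrite PE -rcons_cons mem_rcons in_cons -mem_rev rev_cons zp orbT.
      rewrite F ?inL // => /orP[/andP[_ /eqP->//]|/andP[/eqP zu _]].
      by move: uP; rewrite PE -rcons_cons rcons_uniq -mem_rev rev_cons -zu zp.
    * move=> p1 z p2 y p3 pE ezy.
      have PE' : P = rev p3 ++ y :: rev p2 ++ z :: rev p1.
        rewrite -[P]revK rE rev_cons pE rev_cat rev_cons rev_cat rev_cons -!cats1 -!catA.
        by [].
      have := ch _ _ _ _ _ PE'; rewrite esym ezy => /(_ isT) /(congr1 rev).
      by rewrite revK.
Qed.

(* [U] is the part of [A] still to be placed, and [L] separates it from the placed part. *)
Definition state A s t L U :=
  [/\ uniq L, sorted e L, head t L = s & last s L = t] /\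
  [/\ conn e U, U \subset A, {in L, forall z, z \notin U},
      forall x y, x \in U -> e x y -> (y \in U) || (y \in L)
    & exists r, frontier e s t (A :\: U) L r].

(** The last hypothesis preserves the invariant: the interval [M] disappears from the frontier, so
    none of its vertices may still see the unplaced part. *)
Lemma shell_step A s t L U D : state A s t L U -> conn e D -> D \subset U ->
  (forall X, conn e X -> X \subset U :\: D -> 2 < #|nbrs e X|) ->
  (exists X, [/\ conn e X, X \subset U :\: D & 1 < #|NL e [set z in L] X|]) ->
  (forall X L1 a M b L2 m, conn e X -> X \subset U :\: D -> conn e (U :\: X) ->
     adj e X (U :\: X) -> L = L1 ++ a :: M ++ b :: L2 -> adj e [set a] X -> adj e [set b] X ->
     m \in M -> ~~ adj e [set m] (U :\: X)) ->
  exists L' U', [/\ state A s t L' U', D \subset U' & U' \proper U].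
Proof.
move=> [[uL sL hL lL] [cU UA LU pend [r fr]]] cD DU tight exX bury.
have dLU : [disjoint [set z in L] & U].
  by apply: disjI => z; rewrite inE => /LU/negP.
have pend' x y : x \in U -> e x y -> y \in U :|: [set z in L].
  by move=> xU exy; rewrite inE [y \in [set _ in _]]inE; apply: pend exy.
have [P [shP uP sP P0 [PU cUP aP]]] := ear_exists esym dLU cU cD DU pend' tight exX.
have PU' : [set z in P] \subset U by apply: subset_trans PU (subsetDl _ _).
have [L1 [a [M [b [L2 [x [p [LE PE up pp [eax elb Hx Hp ch]]]]]]]]] :=
  ear_normal uL LU PU' uP sP shP.
set X := [set z in P] in PU cUP aP PU' PE.
have cX : conn e X by exact: conn_seq.
have xX : x \in X by rewrite PE inE mem_head.
have inX z : (z \in X) = (z \in x :: p) by rewrite PE inE.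
have XU z : z \in x :: p -> z \in U by rewrite -inX => /(subsetP PU').
have aX : adj e [set a] X by apply: (adjI _ xX eax); rewrite inE.
have bX : adj e [set b] X.
  rewrite adjC //; apply: (adjI _ _ elb); last by rewrite inE.
  by rewrite inX mem_last.
have {}bury m := @bury X L1 a M b L2 m cX PU cUP aP LE aX bX.
have LS z : z \in L -> z \in A :\: U by case: fr => _ _ h _ _; apply: h.
have sS : s \in A :\: U.
  by apply: LS; rewrite -hL LE; case: (L1) => [|c l] /=; rewrite mem_head.
have tS : t \in A :\: U.
  by apply: LS; rewrite -lL LE last_cat /= last_cat /= mem_cat in_cons mem_cat mem_last !orbT.
have nU z : z \in A :\: U -> z \notin U by rewrite inE => /andP[].
have SL v z : v \in U -> z \in A :\: U -> e v z -> z \in L.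
  by move=> vU /nU zU evz; have := pend v z vU evz; rewrite (negPf zU).
rewrite LE in fr.
have xU : x \in U by apply: XU; rewrite mem_head.
have [||r1 fr1] := frontier_place esym eirr sS tS fr (v := x).
- by rewrite inE xU.
- by move=> z zS exz; apply: Hx (SL x z xU zS exz) exz.
have sS' : s \in x |: A :\: U by rewrite in_setU1 sS orbT.
have tS' : t \in x |: A :\: U by rewrite in_setU1 tS orbT.
rewrite -cat_rcons in fr1.
have [|||r2] := frontier_chain esym eirr sS' tS' fr1 (p := p).
- by case/andP: up.
- move=> z zp; rewrite in_setU1 inE XU ?in_cons ?zp ?orbT //= orbF.
  by apply: contraTneq zp => ->; case/andP: up.
- move=> p1 z p2 pE y yS ezy.
  have zp : z \in p by rewrite pE mem_cat mem_head orbT.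
  have zU : z \in U by apply: XU; rewrite in_cons zp orbT.
  move: yS; rewrite in_setU1 -orbA orbCA => /orP[yS|yp].
    by rewrite (Hp z y zp (SL z y zU yS ezy) ezy) eqxx orbT.
  (* The ear is induced, so an earlier ear vertex adjacent to [z] can only be its predecessor. *)
  have [q1 [q2 [qE yq]]] : exists q1 q2, x :: p1 = q1 ++ y :: q2 /\ last x p1 = last y q2.
    have : y \in x :: p1 by rewrite in_cons.
    move=> /(nthP x)[i ip yi]; exists (take i (x :: p1)), (drop i.+1 (x :: p1)).
    rewrite -yi -drop_nth // cat_take_drop; split=> //.
    by rewrite -[last x p1]/(last x (x :: p1)) -{1}[x :: p1](cat_take_drop i) (drop_nth x) // last_cat_cons.
  rewrite yq (ch q1 y q2 z p2) ?eqxx //; last by rewrite esym.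
  by rewrite pE -cat_cons qE -catA.
rewrite cat_rcons.
have -> : [set z in p] :|: (x |: A :\: U) = A :\: (U :\: X).
  apply/setP=> z; rewrite in_setU inE in_setU1 !in_setD inX in_cons.
  case: (z =P x) => [->|_] /=; first by rewrite orbT (subsetP UA).
  case zp: (z \in p) => //=.
  by rewrite (subsetP UA) // XU // in_cons zp orbT.
move=> fr2.
exists (L1 ++ a :: x :: p ++ b :: L2), (U :\: X).
have uL' : uniq (L1 ++ a :: (x :: p) ++ b :: L2).
  case: fr2 => _ _ _ /pairwise_sorted pw _; apply: (sorted_uniq _ _ pw).
    by move=> z1 z2 z3 /andP[? ?] /andP[? ?]; apply/andP; split; nlia.
  by move=> z; rewrite /left_right ltnn.
have sub1 : D \subset U :\: X.
  apply/subsetP=> z zD; rewrite inE (subsetP DU) // andbT.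
  by apply/negP=> /(subsetP PU); rewrite inE zD.
have sub2 : U :\: X \proper U.
  by apply/properP; split; [exact: subsetDl | exists x => //; rewrite inE xX].
split=> //; split; split=> //.
- move: sL; rewrite LE !sorted_cat_cons => /andP[-> /=]; rewrite !cat_path /= eax pp elb /=.
  by case/and3P.
- by rewrite -hL LE; case: (L1).
- by rewrite -lL LE !last_cat /= !last_cat.
- by apply: subset_trans UA; apply: subsetDl.
- move=> z zL; rewrite in_setD negb_and negbK; apply/orP.
  case: (boolP (z \in X)) => [_|]; [by left | rewrite inX => zp; right; apply: LU].
  move: zL; rewrite -cat_cons mem_cat in_cons mem_cat (negPf zp) in_cons /= => H.
  by rewrite LE !(mem_cat, in_cons); case/or4P: H => ->; rewrite ?orbT.
- move=> y z; rewrite in_setD inX => /andP[yX yU] eyz; rewrite in_setD inX.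
  have := pend y z yU eyz; case: (boolP (z \in x :: p)) => [zp _|zp /=].
    by move: zp; rewrite !(mem_cat, in_cons) => /orP[]->; rewrite ?orbT.
  case/orP=> [->//|zL]; apply/orP; right.
  have : z \notin M.
    apply/negP=> /bury/negP; case; rewrite adjC //.
    by apply: (adjI _ _ eyz); rewrite ?in_set1 // in_setD inX yX.
  by move: zL; rewrite LE !(mem_cat, in_cons) => /or4P[->|->|->|/orP[->|->]]; rewrite ?orbT.
- by exists r2.
Qed.

End Shelling.

(** * Shelling when no small set can be cut off *)

Section Tight.
Variables (V : finType) (e : rel V).
Hypotheses (esym : symmetric e) (eirr : irreflexive e).
Variables (A : {set V}) (s t : V).
Hypotheses (eA : forall x y, e x y -> x \in A) (sA : s \in A) (tA : t \in A).
Hypotheses (st : s != t) (est : e s t) (kf : kfree e).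
Implicit Types (X U S D : {set V}) (L : seq V).

(** Exempt are the sets that contain all other neighbours of [s] and [t], such as [A :\:
    [set s; t]], which has no neighbours besides [s] and [t]. *)
Hypothesis tight : forall X z, conn e X -> X \subset A :\: [set s; t] ->
  z \notin X -> z != s -> z != t -> e s z || e t z -> 2 < #|nbrs e X|.

Definition normal_realizer := exists r, realizer e A r /\ normalized s t A r.

Lemma state_ends L U : state e A s t L U -> s \in L /\ t \in L.
Proof.
move=> [[uL sL hL lL] _]; have L0 : L != [::].
  by apply: contraNneq st => L0; rewrite -hL -lL L0.
by rewrite -{1}hL -{2}lL; case: (L) L0 => //= c l _; rewrite mem_head mem_last.
Qed.

Lemma state_finish L z1 : state e A s t L [set z1] -> normal_realizer.
Proof.
move=> stL; have [sL tL] := state_ends stL.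
move: stL => [[uL soL hL lL] [_ UA LU pend [r fr]]].
have LE : exists M, L = s :: rcons M t.
  move: hL lL; case: (L) sL => // c l _ /= -> ; case/lastP: l => [/= ts|l d].
    by move: st; rewrite ts eqxx.
  by rewrite last_rcons => ->; exists l.
case: LE => M LE.
have LS z : z \in L -> z \in A :\: [set z1] by case: fr => _ _ h _ _; apply: h.
have zA : z1 \in A by apply: (subsetP UA); rewrite inE.
have fr' : frontier e s t (A :\: [set z1]) ([::] ++ s :: M ++ t :: [::]) r.
  by rewrite /= cats1 -LE.
have [||r' [rl nm _ _ _]] := frontier_place esym eirr (LS _ sL) (LS _ tL) fr' (v := z1).
- by rewrite !inE eqxx.
- move=> x; rewrite inE => /andP[xz xA] ezx; rewrite -LE.
  by have := pend z1 x (set11 _) ezx; rewrite (negPf xz).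
by exists r'; move: rl nm; rewrite setD1K.
Qed.

Lemma comp_exit L U D x : state e A s t L U -> D \subset U -> x \in U :\: D ->
  nbrs e (comp e (U :\: D) x) \subset D :|: NL e [set z in L] (comp e (U :\: D) x).
Proof.
move=> [_ [_ UA LU pend _]] DU xU; apply/subsetP=> y yN; have := yN.
case/nbrsP=> yC [z zC ezy]; rewrite inE.
have /setDP[zU _] := subsetP (comp_sub _ _ _) z zC.
case yD: (y \in D) => //=; case/orP: (pend z y zU ezy) => [yU|yL].
  by case/negP: yC; apply: comp_closed zC _ ezy; rewrite inE yD yU.
by rewrite inE inE yL yN.
Qed.

Lemma state_sub L U : state e A s t L U -> U \subset A :\: [set s; t].
Proof.
move=> stL; have [sL tL] := state_ends stL; move: stL => [_ [_ UA LU _ _]].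
apply/subsetP=> z zU; rewrite !inE (subsetP UA) // andbT negb_or.
by apply/andP; split; apply: contraTneq zU => ->; apply: LU.
Qed.

(** Keeping [z1] unplaced, [t] always sees the unplaced part. It lies beyond the right end of every
    ear, as an ear attached to [t] would contain [z1]; so it is the outer witness that [bury_outer]
    asks for. *)
Lemma shelling_to_pendant n L U z1 : #|U| <= n -> state e A s t L U -> z1 \in U -> e t z1 ->
  (forall z, z \in U -> e t z -> z = z1) -> normal_realizer.
Proof.
elim: n L U => [|n IH] L U.
  by rewrite leqn0 cards_eq0 => /eqP-> _; rewrite inE.
move=> Un stL zU etz tz; have [sL tL] := state_ends stL.
have Ust := state_sub stL.
have zst : (z1 != s) && (z1 != t).
  by have := subsetP Ust _ zU; rewrite !inE negb_or => /andP[].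
case/andP: zst => zs zt.
case: (eqVneq U [set z1]) => [U1|U1]; first by apply: (@state_finish L z1); rewrite -U1.
have DU : [set z1] \subset U by rewrite sub1set.
have tgt X : conn e X -> X \subset U :\: [set z1] -> 2 < #|nbrs e X|.
  move=> cX XU; apply: (tight cX (z := z1)) => //.
  - by apply: subset_trans Ust; apply: subset_trans XU (subsetDl _ _).
  - by apply/negP=> /(subsetP XU); rewrite !inE eqxx.
  - by rewrite etz orbT.
have [||L' [U' [stL' zU' UU]]] := shell_step esym eirr stL (conn1 e z1) DU tgt.
- have : U :\ z1 != set0.
    apply: contraNneq U1 => U0; rewrite eqEsubset sub1set zU andbT.
    by rewrite -setD_eq0 U0.
  case/set0Pn=> x xU; exists (comp e (U :\ z1) x); split.
  + exact: conn_comp.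
  + exact: comp_sub.
  (* Of at least three neighbours only [z1] can be off [L]. *)
  + rewrite -ltnS; apply: leq_trans (tgt _ (conn_comp esym xU) (comp_sub _ _ _)) _.
    apply: leq_trans (subset_leq_card (comp_exit stL DU xU)) _.
    by apply: leq_trans (leq_card_setU _ _) _; rewrite cards1.
- move=> X L1 a M b L2 m cX XU cW XW LE aX bX mM; apply/negP=> mW.
  move: (stL) => [[uL soL hL lL] [_ UA LU pend _]].
  have hE : head a L1 = s by rewrite -hL LE; case: (L1).
  have lE : last b L2 = t by rewrite -lL LE last_cat /= last_cat.
  have XU' z : z \in X -> z \in U by move=> /(subsetP XU); rewrite inE => /andP[].
  have zX : z1 \notin X by apply/negP=> /(subsetP XU); rewrite !inE eqxx.
  case: kf => _; apply; apply: (@bury_outer V e esym L1 a M b L2 X (U :\: X)) => //.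
  + by rewrite -LE.
  + by rewrite -LE.
  + by rewrite hE lE.
  + by rewrite -LE => z zL; apply: contra (LU z zL) => /XU'.
  + by rewrite -LE => z zL; apply: contra (LU z zL); rewrite inE => /andP[].
  + by apply: disjI => z zX'; rewrite inE zX'.
  + by exists m.
  + exists t; last by apply: (adjI (y := z1)) etz; rewrite !inE ?zX.
    move: lE bX; case: (L2) => [/= bt|c l /= <- _]; last by rewrite mem_cat mem_last orbT.
    rewrite bt => /adjP[x [y [/set1P-> yX ety]]].
    by case/negP: zX; rewrite -(tz y (XU' y yX) ety).
apply: (IH L' U') => //.
- by rewrite -ltnS; apply: leq_trans (proper_card UU) Un.
- by rewrite -sub1set.
- by move=> z zU2; apply: tz; apply: (subsetP (proper_sub UU)).
Qed.

(** * Shelling around a core that sees both ends *)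

Section Core.
Variables (Z : {set V}) (zs zt : V).
Hypotheses (cZ : conn e Z) (zsZ : zs \in Z) (ztZ : zt \in Z) (ezs : e s zs) (ezt : e t zt).
Hypotheses (Zs : forall z, z \in Z -> e s z -> z = zs) (Zt : forall z, z \in Z -> e t z -> z = zt).
Hypothesis cK : conn e (A :\: [set s; t] :\: Z).

(** Ears that avoid [Z] are placed first; [s] and [t] see [Z], so either one is a witness for
    [bury_outer] unless the ear is attached to both. When no ear avoids [Z], [zt] is the only
    unplaced neighbour of [t], and [shelling_to_pendant] finishes. *)
Lemma shelling_around_core n L U : #|U| <= n -> state e A s t L U -> Z \subset U -> normal_realizer.
Proof.
elim: n L U => [|n IH] L U.
  by rewrite leqn0 cards_eq0 => /eqP-> _ /subsetP/(_ _ zsZ); rewrite inE.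
move=> Un stL ZU; have [sL tL] := state_ends stL.
have Ust := state_sub stL.
have inUst z : z \in U -> (z != s) && (z != t).
  by move=> /(subsetP Ust); rewrite !inE negb_or => /andP[].
have tgt X : conn e X -> X \subset U :\: Z -> 2 < #|nbrs e X|.
  move=> cX XU; have /andP[zts ztt] := inUst _ (subsetP ZU _ ztZ).
  apply: (tight cX (z := zt)) => //.
  - by apply: subset_trans Ust; apply: subset_trans XU (subsetDl _ _).
  - by apply/negP=> /(subsetP XU); rewrite !inE ztZ.
  - by rewrite ezt orbT.
case: (boolP [exists X : {set V}, [&& conn e X, X \subset U :\: Z & 1 < #|NL e [set z in L] X|]]).
  case/existsP=> X0 /and3P[cX0 X0U NX0].
  have [||L' [U' [stL' zU' UU]]] := shell_step esym eirr stL cZ ZU tgt.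
  - by exists X0.
  - move=> X L1 a M b L2 m cX XU cW XW LE aX bX mM; apply/negP=> mW.
    move: (stL) => [[uL soL hL lL] [cU UA LU pend _]].
    have hE : head a L1 = s by rewrite -hL LE; case: (L1).
    have lE : last b L2 = t by rewrite -lL LE last_cat /= last_cat.
    have XU' z : z \in X -> z \in U by move=> /(subsetP XU); rewrite inE => /andP[].
    have ZX z : z \in Z -> z \notin X by move=> zZ; apply/negP=> /(subsetP XU); rewrite !inE zZ.
    have sW : adj e [set s] (U :\: X).
      by apply: (adjI (y := zs)) ezs; rewrite !inE ?ZX // (subsetP ZU).
    have tW : adj e [set t] (U :\: X).
      by apply: (adjI (y := zt)) ezt; rewrite !inE ?ZX // (subsetP ZU).
    case: (altP (L1 ++ L2 =P [::])) => [LL0|LL0]; last first.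
      case: kf => _; apply; apply: (@bury_outer V e esym L1 a M b L2 X (U :\: X)) => //.
      + by rewrite -LE.
      + by rewrite -LE.
      + by rewrite hE lE.
      + by rewrite -LE => z zL; apply: contra (LU z zL) => /XU'.
      + by rewrite -LE => z zL; apply: contra (LU z zL); rewrite inE => /andP[].
      + by apply: disjI => z zX'; rewrite inE zX'.
      + by exists m.
      + case: (altP (L2 =P [::])) => [L20|L20].
          exists s => //; move: LL0 hE; rewrite L20 cats0; case: (L1) => //= c l _ ->.
          exact: mem_head.
        exists t => //; move: lE; case: (L2) L20 => //= c l _ <-.
        by rewrite mem_cat mem_last orbT.
    have [L10 L20] : L1 = [::] /\ L2 = [::] by case: (L1) (L2) LL0 => [|? ?] [|? ?].
    move: hE lE; rewrite L10 L20 /= => aE bE; rewrite L10 L20 /= aE bE in LE aX bX.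
    have sM : path e s M by move: soL; rewrite LE /= cat_path => /andP[].
    have elM : e (last s M) t by move: soL; rewrite LE /= cat_path /= => /and3P[].
    have M0 : M != [::] by case: (M) mM.
    have ML z : z \in M -> z \in L by move=> zM; rewrite LE !(in_cons, mem_cat) zM orbT.
    have MU z : z \in M -> z \notin U by move=> /ML/LU.
    have Mst z : z \in M -> (z != s) && (z != t).
      move=> zM; move: uL; rewrite LE /= cat_uniq mem_cat negb_or => /andP[/andP[sM' _]].
      case/and3P=> _ /hasPn h _; apply/andP; split; first by apply: contraNneq sM' => <-.
      by apply: contraTneq zM => ->; apply: h; rewrite mem_head.
    have cM : conn e [set z in M] by apply: conn_seq (path_sorted sM).
    have sub z : z \in U -> z \in ~: [set s; t].
      by move=> /inUst; rewrite !inE negb_or.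
    case: kf => k5 k33.
    suff : has_model e (@complete_rel 5) \/ has_model e (@bipartite_rel 3 3) by case.
    (* The ear spans the whole frontier. [X], the inner frontier [M] and [Z] all see [s] and [t]; by
       [cK] the part outside [Z] links [X] to [M], the unplaced rest links [M] to [Z], and [U] links
       [X] to [Z]. *)
    apply: (@rooted_triangle V e esym s t X [set z in M] Z est st) => //.
    - split; apply/subsetP=> z; first by move=> /XU'/sub.
        by rewrite inE => /Mst; rewrite !inE negb_or.
      by move=> /(subsetP ZU)/sub.
    - split; apply: disjI => z.
      + by move=> /XU' zU; rewrite inE => /MU; rewrite zU.
      + by move=> zX /ZX; rewrite zX.
      + by rewrite inE => /MU zU /(subsetP ZU); rewrite (negPf zU).
    - move=> B; rewrite !inE => /or3P[/eqP->|/eqP->|/eqP->].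
      + by rewrite aX.
      + apply/andP; split.
          case: (M) M0 sM => //= c M' _ /andP[esc _].
          by apply: (adjI _ _ esc); rewrite inE ?mem_head.
        rewrite adjC //; apply: (adjI _ _ elM); rewrite ?inE //.
        by case: (M) M0 => //= c M' _; rewrite mem_last.
      + apply/andP; split; first by apply: (adjI _ zsZ ezs); rewrite inE.
        by apply: (adjI _ ztZ ezt); rewrite inE.
    - exists (A :\: [set s; t] :\: Z); split=> //.
      + by apply: setSD; apply/subsetP=> z; rewrite !inE => /andP[].
      + apply/subsetP=> z zX; have zU := XU' z zX.
        rewrite inE (subsetP Ust) // andbT; apply/negP=> /ZX; by rewrite zX.
      + apply/subsetP=> z; rewrite inE => zM.
        have zU := MU z zM; rewrite !inE negb_or Mst //=.
        rewrite (contra (subsetP ZU z)) //=.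
        have [_ [_ _ _ _ [r [_ _ LS _ _]]]] := stL.
        by have := LS z (ML z zM); rewrite inE => /andP[].
    - exists ([set z in M] :|: (U :\: X)); split.
      + apply: connU => //; right; apply: adjS mW => //.
        by rewrite sub1set inE.
      + apply/subsetP=> z; rewrite in_setU inE => /orP[zM|].
          rewrite inE (contra (@XU' z)) ?MU //= .
          by have := Mst z zM; rewrite !inE negb_or.
        by rewrite inE => /andP[zX zU]; rewrite inE zX sub.
      + exact: subsetUl.
      + by apply/subsetP=> z zZ; rewrite !inE ZX // (subsetP ZU) // orbT.
    - exists U; split=> //.
      + by apply/subsetP=> z zU; rewrite inE sub // andbT inE; apply/negP=> /MU; rewrite zU.
      + by apply/subsetP=> z /XU'.
  apply: (IH L' U') => //.
  by rewrite -ltnS; apply: leq_trans (proper_card UU) Un.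
rewrite negb_exists => /forallP noX.
apply: (@shelling_to_pendant n.+1 L U zt) => //; first exact: (subsetP ZU).
move=> x xU etx; apply/eqP/negPn/negP=> xzt.
have xZ : x \notin Z by apply/negP=> xZ; case/eqP: xzt; apply: Zt.
have xUZ : x \in U :\: Z by rewrite inE xZ.
(* On [L] this component sees only [t], so by [cK] it contains everything outside [Z]. Then [s] sees
   nothing but [t] and [zs], and the component of [x] after removal of [zs] has its neighbours in
   [[set t; zs]], against [tight]. *)
set X := comp e (U :\: Z) x.
have cX : conn e X by exact: conn_comp.
have XU : X \subset U :\: Z by exact: comp_sub.
have := noX X; rewrite cX XU /= -leqNgt => NX.
move: (stL) => [_ [_ UA LU pend _]].
have dLU : [disjoint [set z in L] & U] by apply: disjI => z; rewrite inE => /LU/negP.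
have inN y l : y \in X -> l \in L -> e y l -> l \in NL e [set z in L] X.
  move=> yX lL eyl; apply: (NLI dLU _ yX) => //; last by rewrite inE.
  by apply: subset_trans XU (subsetDl _ _).
have tN : t \in NL e [set z in L] X by apply: (inN x); rewrite ?mem_comp // esym.
have onlyt y l : y \in X -> l \in L -> e y l -> l = t.
  move=> yX lL eyl; apply/eqP/negPn/negP=> lt; move: NX; rewrite leqNgt => /negP; apply.
  by apply/card_gt1P; exists l, t; split=> //; apply: inN eyl.
have KX : A :\: [set s; t] :\: Z \subset X.
  apply: conn_meet cK _ _.
    move=> y w yX _ wK eyw; have /setDP[yU _] := subsetP XU _ yX.
    have /and3P[wZ /andP[ws wt] wA] : [&& w \notin Z, (w != s) && (w != t) & w \in A].
      by move: wK; rewrite !inE negb_or.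
    case/orP: (pend y w yU eyw) => [wU|wL].
      by apply: comp_closed yX _ eyw; rewrite inE wZ.
    by rewrite (onlyt y w) ?eqxx in wt.
  exists x; last exact: mem_comp.
  by rewrite inE xZ (subsetP Ust).
have xzs : x != zs by apply: contraNneq xZ => ->.
have zsst := inUst zs (subsetP ZU _ zsZ).
set B := A :\: [set s; t] :\ zs.
have xB : x \in B by rewrite in_setD1 xzs (subsetP Ust).
have cY : conn e (comp e B x) by exact: conn_comp.
case/andP: zsst => zss zst.
have YB : comp e B x \subset A :\: [set s; t].
  by apply: subset_trans (comp_sub _ _ _) (subsetDl _ _).
have zsY : zs \notin comp e B x.
  by apply/negP=> /(subsetP (comp_sub _ _ _)); rewrite !inE eqxx.
have := tight cY YB zsY zss zst; rewrite ezs => /(_ isT).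
rewrite ltnNge => /negP; apply; apply: (@leq_trans #|[set t; zs]|); last first.
  by rewrite cards2; case: (_ != _).
apply: subset_leq_card; apply/subsetP=> y /nbrsP[yY [z zY ezy]].
rewrite !inE; apply/negPn/negP; rewrite negb_or => /andP[yt yzs].
have yA : y \in A by apply: (eA (y := z)); rewrite esym.
have := subsetP (comp_sub _ _ _) _ zY; rewrite !inE negb_or => /and3P[zzs /andP[zs' zt'] zA].
case: (eqVneq y s) => [ys|ys]; last first.
  by case/negP: yY; apply: comp_closed zY _ ezy; rewrite !inE yzs negb_or ys yt.
case zZ: (z \in Z).
  by rewrite (Zs zZ) ?eqxx // -ys esym in zzs.
have zX : z \in X by apply: (subsetP KX); rewrite !inE zZ negb_or zs' zt'.
by case/eqP: yt; apply: (onlyt z); rewrite // ys.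
Qed.
End Core.

Lemma frontier_base : exists r, frontier e s t [set s; t] [:: s; t] r.
Proof.
have ts : t != s by rewrite eq_sym.
pose r (i : 'I_3) x : nat := (i == o0) && (x == s) || (i == o1) && (x == t).
have rs0 : r o0 s = 1 by rewrite /r /= eqxx.
have rt0 : r o0 t = 0 by rewrite /r /= (negPf ts).
have rs1 : r o1 s = 0 by rewrite /r /= (negPf st).
have rt1 : r o1 t = 1 by rewrite /r /= eqxx.
exists r; split.
- split=> [x y z|x z].
    rewrite !inE => /orP[]/eqP-> /orP[]/eqP-> /orP[]/eqP->; rewrite ?eqxx //.
    + by rewrite eirr.
    + by rewrite eirr.
  rewrite !inE => /orP[]/eqP-> /orP[]/eqP->; rewrite ?eqxx // => _.
  + by exists o1; rewrite rs1 rt1.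
  + by exists o0; rewrite rs0 rt0.
- split; rewrite ?rs0 ?rt0 ?rs1 ?rt1 // => z; rewrite !inE => /orP[]/eqP->.
    by rewrite eqxx.
  by rewrite eqxx.
- by move=> z; rewrite !inE.
- by rewrite /= /left_right rs0 rt0 rs1 rt1.
- rewrite /= andbT; apply/underP=> z; rewrite !inE => /orP[]/eqP->; by rewrite eqxx.
Qed.

(** Supplies the unique contacts [zs] and [zt] of the core: with only two vertices on the frontier,
    an ear must attach to both. *)
Lemma ear_two P w : ear_shape e [set s; t] P -> w \in [set s; t] ->
  exists z, [/\ z \in P, e w z & forall y, y \in P -> e w y -> y = z].
Proof.
have two (a b : V) : a \in [set s; t] -> b \in [set s; t] -> a != b ->
    forall c, c \in [set s; t] -> c = a \/ c = b.
  move=> + + + c; rewrite !inE => /orP[]/eqP-> /orP[]/eqP-> + /orP[]/eqP->;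
  rewrite ?eqxx //; auto.
case=> [[u -> N]|[u [u' [q [w1 [w2 [w1L w2L ww PE [F _]]]]]]]] wL.
  have [l1 [l2 [l1N l2N l12]]] := card_gt1P N.
  have [_ /set1P-> [l1L _ ul1]] := NLP _ _ _ _ l1N.
  have [_ /set1P-> [l2L _ ul2]] := NLP _ _ _ _ l2N.
  exists u; split; first by rewrite mem_head.
    by rewrite esym; case: (two _ _ l1L l2L l12 w wL) => ->.
  by move=> y; rewrite inE => /eqP.
have uP : u \in P by rewrite PE mem_head.
have uP' : u' \in P by rewrite PE in_cons mem_rcons mem_head orbT.
case: (two _ _ w1L w2L ww w wL) => ->.
  exists u; split=> //; first by rewrite esym F // !eqxx.
  by move=> y yP; rewrite esym F // => /orP[/andP[/eqP]//|/andP[_]]; rewrite (negPf ww).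
exists u'; split=> //; first by rewrite esym F // !eqxx orbT.
by move=> y yP; rewrite esym F // => /orP[/andP[_]|/andP[/eqP]//]; rewrite eq_sym (negPf ww).
Qed.

(** The first ear over the bare edge is not placed but becomes the core [Z]; [ear_exists] also makes
    the rest connected, as [shelling_around_core] requires. *)
Lemma tight_realizer : conn e A -> normal_realizer.
Proof.
move=> cA; set U := A :\: [set s; t].
have UA : U \subset A by exact: subsetDl.
have stA : [set s; t] \subset A by rewrite subUset !sub1set sA.
have AU : A :\: U = [set s; t] by rewrite /U setDDr setDv set0U; apply/setIidPr.
have [r fr] := frontier_base.
case: (eqVneq U set0) => [U0|U0].
  have AE : A = [set s; t] by rewrite -AU U0 setD0.
  by exists r; rewrite AE; case: fr.
have inU z : (z \in U) = [&& z != s, z != t & z \in A].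
  by rewrite !inE negb_or andbA.
have [z0 z0U ez0] : exists2 z0, z0 \in U & e s z0 || e t z0.
  case: (boolP [exists z0 in U, e s z0 || e t z0]) => [/exists_inP[z0]|nz].
    by exists z0.
  case/negP: U0; rewrite /U setD_eq0; apply: conn_meet cA _ _; last first.
    by exists s => //; rewrite !inE eqxx.
  move=> x y; rewrite [x \in _]in_set2 [y \in [set _; _]]in_set2 => xst xA yA exy.
  apply/negPn/negP; rewrite negb_or => /andP[ys yt]; case/negP: nz.
  apply/exists_inP; exists y; first by rewrite inU ys yt.
  by case/orP: xst => /eqP xE; rewrite -xE exy ?orbT.
have z0P : [&& z0 != s, z0 != t & z0 \in A] by rewrite -inU.
case/and3P: z0P => z0s z0t z0A.
have small (X : {set V}) : conn e X -> X \subset U -> z0 \notin X -> nbrs e X \subset [set s; t] -> False.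
  move=> cX XU zX NX; have := tight cX XU zX z0s z0t ez0.
  rewrite ltnNge => /negP; apply; apply: leq_trans (subset_leq_card NX) _.
  by rewrite cards2; case: (_ != _).
(* A component of [U] missing [z0] would have no neighbours besides [s] and [t]. *)
have cU : conn e U.
  have all0 x : x \in U -> z0 \in comp e U x.
    move=> xU; apply/negPn/negP=> nz; apply: (small (comp e U x)) => //.
    - exact: conn_comp.
    - exact: comp_sub.
    apply/subsetP=> y /nbrsP[yC [z zC ezy]]; apply/negPn/negP=> yst.
    have yA : y \in A by apply: (eA (y := z)); rewrite esym.
    have yU : y \in U by rewrite inU yA andbT; move: yst; rewrite !inE negb_or.
    by case/negP: yC; apply: comp_closed zC yU ezy.
  suff <- : comp e U z0 = U by exact: conn_comp.
  apply/eqP; rewrite eqEsubset comp_sub; apply/subsetP=> x xU.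
  have := all0 x xU; rewrite !inE => /andP[_ c]; rewrite restr_csym // c andbT.
  by have := xU; rewrite !inE.
have st0 : state e A s t [:: s; t] U.
  split; first by split; rewrite //= ?inE ?andbT // est.
  split=> //.
  - by move=> z; rewrite !inE => /orP[]/eqP->; rewrite eqxx ?orbT.
  - move=> x y xU exy; rewrite -[y \in [:: s; t]]/(y \in [:: s; t]) inU !inE.
    by rewrite (eA (y := x)) 1?esym // andbT; case: (y == s); case: (y == t).
  - by exists r; rewrite AU.
case: (eqVneq U [set z0]) => [U1|U1]; first by apply: (@state_finish [:: s; t] z0); rewrite -U1.
have D0 : [set z0] \subset U by rewrite sub1set.
have tgt X : conn e X -> X \subset U :\: [set z0] -> 2 < #|nbrs e X|.
  move=> cX XU; apply: (tight cX (z := z0)) => //.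
  - by apply: subset_trans XU (subsetDl _ _).
  - by apply/negP=> /(subsetP XU); rewrite !inE eqxx.
have Lst : [set z in [:: s; t]] = [set s; t] by apply/setP=> z; rewrite !inE.
have dLU : [disjoint [set s; t] & U] by apply: disjI => z; rewrite /U in_setD => ->.
have pend x y : x \in U -> e x y -> y \in U :|: [set s; t].
  move=> xU exy; rewrite in_setU /U in_setD (eA (y := x)) 1?esym // andbT.
  by rewrite orbC orbN.
have [|P [shP uP sP P0 [PU cUP _]]] := ear_exists esym dLU cU (conn1 e z0) D0 pend tgt.
  have : U :\ z0 != set0.
    apply: contraNneq U1 => U0'; rewrite eqEsubset sub1set z0U andbT.
    by rewrite -setD_eq0 U0'.
  case/set0Pn=> x xU; exists (comp e (U :\ z0) x); split.
  - exact: conn_comp.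
  - exact: comp_sub.
  - rewrite -ltnS; apply: leq_trans (tgt _ (conn_comp esym xU) (comp_sub _ _ _)) _.
    apply: leq_trans (subset_leq_card (comp_exit st0 D0 xU)) _.
    by apply: leq_trans (leq_card_setU _ _) _; rewrite cards1 Lst.
have [zs [zsP ezs Zs]] : exists z, [/\ z \in P, e s z & forall y, y \in P -> e s y -> y = z].
  by apply: ear_two => //; rewrite !inE eqxx.
have [zt [ztP ezt Zt]] : exists z, [/\ z \in P, e t z & forall y, y \in P -> e t y -> y = z].
  by apply: ear_two => //; rewrite !inE eqxx orbT.
apply: (@shelling_around_core [set z in P] zs zt _ _ _ ezs ezt _ _ cUP #|U| [:: s; t] U) => //.
- exact: conn_seq.
- by rewrite inE.
- by rewrite inE.
- by move=> z; rewrite inE; apply: Zs.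
- by move=> z; rewrite inE; apply: Zt.
- by apply: subset_trans PU (subsetDl _ _).
Qed.

End Tight.

(** * Cuts of size at most two *)

Lemma ord3P (k : 'I_3) : [\/ k = o0, k = o1 | k = o2].
Proof.
case: k => [[|[|[|//]]] h]; [apply: Or31 | apply: Or32 | apply: Or33]; exact: val_inj.
Qed.

(** * Gluing two realizers at a virtual edge *)

Section Glue.
Variables (V : finType) (e : rel V) (A X : {set V}) (a b s t : V).
Hypothesis eirr : irreflexive e.

Definition virtual : rel V :=
  fun x y => [|| e x y, (x == a) && (y == b) | (x == b) && (y == a)].

Hypothesis esym : symmetric e.
Hypotheses (ab : a != b) (st : s != t).
Hypotheses (aA : a \in A :\: X) (bA : b \in A :\: X) (sA : s \in A :\: X) (tA : t \in A :\: X).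
Hypothesis Xout : forall x y, x \in X -> y \in A -> e x y -> y \in X :|: [set a; b].

(** [X] is inserted as a block: just below [a] in an order where [b] is below [a], just below [b] in
    an order where [a] is below [b], and just above both in the third. An outer vertex above both
    [a] and [b] is then above the block, and one below [a] or [b] is below it. *)
Lemma realizer_glue r q :
  realizer virtual (A :\: X) r -> normalized s t (A :\: X) r ->
  realizer virtual (X :|: [set a; b]) q -> normalized a b (X :|: [set a; b]) q ->
  exists r', realizer e A r' /\ normalized s t A r'.
Proof.
move=> [rE rD] [ts0 st1 rN] [qE qD] [qba qab qN].
have norm0 z : z \in A :\: X -> z != t -> r o0 t < r o0 z.
  move=> zA zt; case: (eqVneq z s) => [->//|zs].
  by case: (rN z zA zs zt) => /andP[].
have norm0' z : z \in A :\: X -> z != s -> r o0 z < r o0 s.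
  move=> zA zs; case: (eqVneq z t) => [->//|zt].
  by case: (rN z zA zs zt) => /andP[].
have norm1 z : z \in A :\: X -> z != s -> r o1 s < r o1 z.
  move=> zA zt; case: (eqVneq z t) => [->//|zs].
  by case: (rN z zA zt zs) => _ /andP[].
have norm1' z : z \in A :\: X -> z != t -> r o1 z < r o1 t.
  move=> zA zs; case: (eqVneq z s) => [->//|zt].
  by case: (rN z zA zt zs) => _ /andP[].
(* If [a] is a corner, its order is forced to be the one where this corner is on top; a block just
   below it then respects [normalized]. The same holds for [b] and [j0]. *)
have [i0 [i0ba i0s i0t]] : exists i, [/\ r i b < r i a, a = s -> i = o0 & a = t -> i = o1].
  case: (eqVneq a s) => [as_|as_].
    by exists o0; rewrite as_; split=> //; [apply: norm0' => //; rewrite -as_ eq_sym | move/eqP: st].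
  case: (eqVneq a t) => [at_|at_].
    by exists o1; rewrite at_; split=> //; [apply: norm1' => //; rewrite -at_ eq_sym | move=> ts; case/eqP: st].
  have [|i h] := rD b a bA aA; first by rewrite eq_sym.
  by exists i; split=> // h'; [rewrite h' eqxx in as_ | rewrite h' eqxx in at_].
have [j0 [j0ab j0s j0t]] : exists i, [/\ r i a < r i b, b = s -> i = o0 & b = t -> i = o1].
  case: (eqVneq b s) => [bs|bs].
    by exists o0; rewrite bs; split=> //; [apply: norm0' => //; rewrite -bs | move/eqP: st].
  case: (eqVneq b t) => [bt|bt].
    by exists o1; rewrite bt; split=> //; [apply: norm1' => //; rewrite -bt | move=> ts; case/eqP: st].
  have [i h] := rD a b aA bA ab.
  by exists i; split=> // h'; [rewrite h' eqxx in bs | rewrite h' eqxx in bt].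
have ij : i0 != j0 by apply: contraTneq j0ab => <-; rewrite -leqNgt ltnW.
(* Scaling the old values by [B] leaves gaps wide enough for all values of [q] shifted by one; the
   shift keeps the block strictly above the lower end of its gap. *)
pose B := (\sum_k \sum_x q k x).+2.
have BP k x : (q k x).+1 < B by rewrite !ltnS (bigD1 k) //= (bigD1 x) //= -addnA leq_addr.
pose m i := maxn (r i a) (r i b).
pose r' i x := if x \in X then
    (if i == i0 then B * (m i).-1 + (q o0 x).+1
     else if i == j0 then B * (m i).-1 + (q o1 x).+1 else B * m i + (q o2 x).+1)
  else B * r i x.
have r'out i x : x \in A :\: X -> r' i x = B * r i x.
  by rewrite inE => /andP[/negPf xX _]; rewrite /r' xX.
have r'i0 x : x \in X -> r' i0 x = B * (r i0 a).-1 + (q o0 x).+1.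
  by move=> xX; rewrite /r' xX eqxx /m (maxn_idPl _) // ltnW.
have r'j0 x : x \in X -> r' j0 x = B * (r j0 b).-1 + (q o1 x).+1.
  by move=> xX; rewrite /r' xX eqxx [j0 == i0]eq_sym (negPf ij) /m (maxn_idPr _) // ltnW.
have r'k0 k x : k != i0 -> k != j0 -> x \in X -> r' k x = B * m k + (q o2 x).+1.
  by move=> /negPf ki /negPf kj xX; rewrite /r' xX ki kj.
have mulB u v : u < v -> B * u + B <= B * v by rewrite -mulnSr leq_mul2l => ->; rewrite orbT.
have below i x z : x \in X -> z \in A :\: X -> r i a < r i z -> r i b < r i z -> r' i x < r' i z.
  move=> xX zA az bz; rewrite (r'out i z zA).
  have mz : m i < r i z by rewrite gtn_max az.
  have h1 := mulB _ _ mz.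
  have h2 : B * (m i).-1 <= B * m i by rewrite leq_mul2l leq_pred orbT.
  have b0 := BP o0 x; have b1 := BP o1 x; have b2 := BP o2 x.
  by rewrite /r' xX; case: (i == i0); case: (i == j0); nlia.
have above i x z : x \in X -> z \in A :\: X -> (r i z < r i a) || (r i z < r i b) -> r' i z < r' i x.
  move=> xX zA azb; rewrite (r'out i z zA).
  have mz : r i z < m i by rewrite leq_max.
  have h1 : B * r i z <= B * (m i).-1 by rewrite leq_mul2l; apply/orP; right; move: mz; clear; lia.
  have h2 : B * (m i).-1 <= B * m i by rewrite leq_mul2l leq_pred orbT.
  by rewrite /r' xX; case: (i == i0); case: (i == j0); nlia.
have pB u v : u < v -> B * u <= B * v.-1 /\ B * v = B * v.-1 + B.
  move=> uv; split; last by rewrite -mulnSr (ltn_predK uv).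
  by rewrite leq_mul2l; apply/orP; right; move: uv; clear; lia.
have i0b x : x \in X -> r' i0 b < r' i0 x.
  move=> xX; rewrite (r'out i0 b bA) r'i0 //; have [h1 h2] := pB _ _ i0ba; nlia.
have i0a x : x \in X -> r' i0 x < r' i0 a.
  move=> xX; rewrite (r'out i0 a aA) r'i0 //; have [h1 h2] := pB _ _ i0ba.
  have h := BP o0 x; nlia.
have j0a x : x \in X -> r' j0 a < r' j0 x.
  move=> xX; rewrite (r'out j0 a aA) r'j0 //; have [h1 h2] := pB _ _ j0ab; nlia.
have j0b x : x \in X -> r' j0 x < r' j0 b.
  move=> xX; rewrite (r'out j0 b bA) r'j0 //; have [h1 h2] := pB _ _ j0ab.
  have h := BP o1 x; nlia.
have kab k x c : k != i0 -> k != j0 -> x \in X -> c \in [set a; b] -> r' k c < r' k x.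
  move=> ki kj xX cab; rewrite (r'k0 _ _ ki kj xX).
  have cA : c \in A :\: X by move: cab; rewrite in_set2 => /orP[]/eqP->.
  rewrite r'out //; have h : B * r k c <= B * m k.
    rewrite leq_mul2l; apply/orP; right; move: cab; rewrite in_set2 => /orP[]/eqP->.
      exact: leq_maxl.
    exact: leq_maxr.
  nlia.
have [k0 k0i k0j] : exists2 k : 'I_3, k != i0 & k != j0.
  have : 0 < #|~: [set i0; j0]|.
    by have := cardsC [set i0; j0]; rewrite card_ord cards2 ij; clear; lia.
  by case/card_gt0P=> k; rewrite !inE negb_or => /andP[? ?]; exists k.
have aX : a \notin X by move: aA; rewrite inE => /andP[].
have bX : b \notin X by move: bA; rewrite inE => /andP[].
(* In the first order of [q] the corner [a] is on top, in the second [b], which matches [i0] and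
   [j0]. *)
pose role (k : 'I_3) := if k == o0 then i0 else if k == o1 then j0 else k0.
have r0 : role o0 = i0 by [].
have r1 : role o1 = j0 by [].
have r2 : role o2 = k0 by [].
clearbody role r' B.
have inUab z : (z \in X :|: [set a; b]) = [|| z \in X, z == a | z == b] by rewrite !inE.
have qX z : z \in X -> [/\ q o0 b < q o0 z, q o0 z < q o0 a, q o1 a < q o1 z, q o1 z < q o1 b &
    q o2 a < q o2 z /\ q o2 b < q o2 z].
  move=> zX; case: (qN z); rewrite ?inUab ?zX //.
  - by apply: contraTneq zX => ->.
  - by apply: contraTneq zX => ->.
  by move=> /andP[? ?] /andP[? ?] ? ?; split.
have roleP k x z : x \in X :|: [set a; b] -> z \in X :|: [set a; b] ->
    (x \in X) || (z \in X) -> q k x < q k z -> r' (role k) x < r' (role k) z.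
  rewrite !inUab; case xX: (x \in X); case zX: (z \in X) => //= xab zab _ qxz.
  - case: (ord3P k) qxz => -> qxz; rewrite ?r0 ?r1 ?r2.
    + by rewrite !r'i0 //; nlia.
    + by rewrite !r'j0 //; nlia.
    + by rewrite !r'k0 //; nlia.
  - have [h1 h2 h3 h4 [h5 h6]] := qX x xX.
    move: zab => /orP[]/eqP zE; rewrite zE in qxz *.
    + case: (ord3P k) qxz => -> qxz; rewrite ?r0 ?r1 ?r2; [exact: i0a | nlia | nlia].
    + case: (ord3P k) qxz => -> qxz; rewrite ?r0 ?r1 ?r2; [nlia | exact: j0b | nlia].
  - have [h1 h2 h3 h4 [h5 h6]] := qX z zX.
    move: (xab) => /orP[]/eqP xE.
    + case: (ord3P k) qxz => -> qxz; rewrite ?r0 ?r1 ?r2; rewrite xE in qxz *; first nlia.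
        exact: j0a.
      by apply: kab; rewrite // in_set2 eqxx.
    + case: (ord3P k) qxz => -> qxz; rewrite ?r0 ?r1 ?r2; rewrite xE in qxz *; last first.
      * by apply: kab; rewrite // in_set2 eqxx orbT.
      * nlia.
      exact: i0b.
have aU : a \in X :|: [set a; b] by rewrite !inE eqxx !orbT.
have bU : b \in X :|: [set a; b] by rewrite !inE eqxx !orbT.
have UA z : z \in A -> (z \in X :|: [set a; b]) || (z \in A :\: X).
  by move=> zA; rewrite inUab in_setD zA andbT; case: (z \in X); rewrite ?orbT.
have scale i x z : x \in A :\: X -> z \in A :\: X -> r i x < r i z -> r' i x < r' i z.
  by move=> xA zA h; rewrite !r'out //; have := mulB _ _ h; have := BP o0 x; nlia.
have abz z : z \in A :\: X -> z != a -> z != b -> exists i, r i a < r i z /\ r i b < r i z.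
  by move=> zA za zb; apply: (rE a b z) => //; rewrite /virtual !eqxx orbT.
have inner i x z : x \in X :|: [set a; b] -> z \in A :\: X -> r i a < r i z -> r i b < r i z ->
    r' i x < r' i z.
  rewrite inUab => /orP[xX|]; first exact: below.
  by case/orP=> /eqP-> zA az bz; apply: scale.
(* If [a] or [b] is not a corner, it is above [s] and [t] in the third order and lifts the block
   with it; if both are corners, the third order is neither [i0] nor [j0], and the block lies above
   both. *)
have up2 z : z \in X -> forall c, c = s \/ c = t -> r' o2 c < r' o2 z.
  move=> zX c cst.
  have r2c d : d \in A :\: X -> d != s -> d != t -> r o2 c < r o2 d.
    by move=> dA ds dt; have [_ _ ? ?] := rN d dA ds dt; case: cst => ->.
  have cA : c \in A :\: X by case: cst => ->.
  case: (boolP ((a == s) || (a == t))) => [ast|]; last first.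
    by rewrite negb_or => /andP[ds dt]; apply: above; rewrite // r2c.
  case: (boolP ((b == s) || (b == t))) => [bst|]; last first.
    by rewrite negb_or => /andP[ds dt]; apply: above; rewrite // [r o2 c < r o2 b]r2c ?orbT.
  have n2i : o2 != i0 by case/orP: ast => /eqP aE; rewrite ?(i0s aE) ?(i0t aE).
  have n2j : o2 != j0 by case/orP: bst => /eqP aE; rewrite ?(j0s aE) ?(j0t aE).
  apply: kab => //; rewrite in_set2.
  case/orP: ast ab => /eqP-> ; case/orP: bst => /eqP->; rewrite ?eqxx // => _;
  by case: cst => ->; rewrite eqxx ?orbT.
exists r'; split; first split.
- move=> x y z xA yA zA exy zx zy.
  have xy : x != y by apply: contraTneq exy => ->; rewrite eirr.
  case: (boolP ((x \in X :|: [set a; b]) && (y \in X :|: [set a; b]))) => [/andP[xU yU]|nxy].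
    case: (boolP (z \in X :|: [set a; b])) => [zU|zU].
      have vxy : virtual x y by rewrite /virtual exy.
      have [k [kx ky]] := qE x y z xU yU zU vxy zx zy.
      case: (boolP (z \in X)) => zX.
        by exists (role k); split; apply: roleP; rewrite ?zX ?orbT.
      exists (role k); split.
        case: (boolP (x \in X)) => xX; first by apply: roleP; rewrite ?xX.
        have yX : y \in X.
          move: xU yU zU; rewrite !inUab (negPf xX) (negPf zX) /=.
          case/orP=> /eqP xE /orP[//|] /orP[]/eqP yE /orP[]/eqP zE;
          by move: xy zx zy; rewrite xE yE zE eqxx.
        have [h1 h2 h3 h4 [h5 h6]] := qX y yX.
        move: xU zU; rewrite !inUab (negPf xX) (negPf zX) /=.
        move=> /orP[]/eqP xE /orP[]/eqP zE; rewrite xE zE ?eqxx // in zx zy kx ky *.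
          case: (ord3P k) kx ky => -> kx ky; rewrite ?r0 ?r1 ?r2; try nlia.
          exact: scale.
        case: (ord3P k) kx ky => -> kx ky; rewrite ?r0 ?r1 ?r2; try nlia.
        exact: scale.
      case: (boolP (y \in X)) => yX; first by apply: roleP; rewrite ?yX.
      have xX : x \in X.
        move: xU yU zU; rewrite !inUab (negPf yX) (negPf zX) /=.
        case/orP=> [//|] /orP[]/eqP xE /orP[]/eqP yE /orP[]/eqP zE;
        by move: xy zx zy; rewrite xE yE zE eqxx.
      have [h1 h2 h3 h4 [h5 h6]] := qX x xX.
      move: yU zU; rewrite !inUab (negPf yX) (negPf zX) /=.
      move=> /orP[]/eqP yE /orP[]/eqP zE; rewrite yE zE ?eqxx // in zx zy kx ky *.
        case: (ord3P k) kx ky => -> kx ky; rewrite ?r0 ?r1 ?r2; try nlia.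
        exact: scale.
      case: (ord3P k) kx ky => -> kx ky; rewrite ?r0 ?r1 ?r2; try nlia.
      exact: scale.
    have zAX : z \in A :\: X by move: (UA z zA); rewrite (negPf zU).
    move: zU; rewrite inUab !negb_or => /and3P[_ za zb].
    have [i [ai bi]] := abz z zAX za zb.
    by exists i; split; apply: inner.
  have xAX : x \in A :\: X.
    rewrite inE xA andbT; apply: contra nxy => xX.
    by rewrite inUab xX (Xout xX yA exy).
  have yAX : y \in A :\: X.
    rewrite inE yA andbT; apply: contra nxy => yX.
    by rewrite (Xout yX xA) 1?esym // inUab yX.
  have vxy : virtual x y by rewrite /virtual exy.
  case: (boolP (z \in X)) => zX; last first.
    have zAX : z \in A :\: X by rewrite inE zX.
    have [i [xi yi]] := rE x y z xAX yAX zAX vxy zx zy.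
    by exists i; split; apply: scale.
  (* One of [a], [b] is not an end of this edge; an order that puts it above [x] and [y] puts the
     block above them too. *)
  have [c [cab cx cy]] : exists c, [/\ c \in [set a; b], c != x & c != y].
    case: (boolP ((a != x) && (a != y))) => [/andP[ax ay]|nax].
      by exists a; rewrite in_set2 eqxx.
    have {}nax : (a == x) || (a == y) by move: nax; rewrite negb_and !negbK.
    exists b; split; first by rewrite in_set2 eqxx orbT.
      apply: contra nxy => /eqP bx; rewrite -bx bU /=.
      by case/orP: nax => /eqP aE; [case/eqP: ab; rewrite aE bx | rewrite -aE aU].
    apply: contra nxy => /eqP by_; rewrite -by_ bU andbT.
    by case/orP: nax => /eqP aE; [rewrite -aE aU | case/eqP: ab; rewrite aE by_].
  have cA : c \in A :\: X by move: cab; rewrite in_set2 => /orP[]/eqP->.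
  have [i [xi yi]] := rE x y c xAX yAX cA vxy cx cy.
  exists i; split; apply: above => //; move: cab; rewrite in_set2 => /orP[]/eqP cE;
  by rewrite -cE ?xi ?yi ?orbT.
- move=> x z xA zA xz.
  case: (boolP (x \in X)) => xX; case: (boolP (z \in X)) => zX.
  + have xU : x \in X :|: [set a; b] by rewrite inUab xX.
    have zU : z \in X :|: [set a; b] by rewrite inUab zX.
    have [k h] := qD x z xU zU xz; exists (role k); apply: roleP => //.
    by rewrite xX.
  + have zAX : z \in A :\: X by rewrite inE zX.
    case: (eqVneq z a) => [->|za]; first by exists i0; apply: i0a.
    case: (eqVneq z b) => [->|zb]; first by exists j0; apply: j0b.
    have [i [ai bi]] := abz z zAX za zb.
    by exists i; apply: below.
  + have xAX : x \in A :\: X by rewrite inE xX.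
    case: (eqVneq x a) => [->|za]; first by exists j0; apply: j0a.
    have [i h] := rD x a xAX aA za.
    by exists i; apply: above; rewrite // h.
  + have xAX : x \in A :\: X by rewrite inE xX.
    have zAX : z \in A :\: X by rewrite inE zX.
    by have [i h] := rD x z xAX zAX xz; exists i; apply: scale.
- split; try exact: scale.
  move=> z zA zs zt; case: (boolP (z \in X)) => zX; last first.
    have zAX : z \in A :\: X by rewrite inE zX.
    have [/andP[? ?] /andP[? ?] ? ?] := rN z zAX zs zt.
    by split; rewrite ?scale.
  split.
  + apply/andP; split.
      apply: above => //; case: (eqVneq a t) => [at_|at_]; last by rewrite norm0.
      by apply/orP; right; apply: norm0 => //; rewrite -at_ eq_sym.
    case: (eqVneq a s) => [as_|as_]; first by rewrite -as_ -(i0s as_); apply: i0a.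
    case: (eqVneq b s) => [bs|bs]; first by rewrite -bs -(j0s bs); apply: j0b.
    by apply: below => //; apply: norm0'.
  + apply/andP; split.
      apply: above => //; case: (eqVneq a s) => [at_|at_]; last by rewrite norm1.
      by apply/orP; right; apply: norm1 => //; rewrite -at_ eq_sym.
    case: (eqVneq a t) => [as_|as_]; first by rewrite -as_ -(i0t as_); apply: i0a.
    case: (eqVneq b t) => [bs|bs]; first by rewrite -bs -(j0t bs); apply: j0b.
    by apply: below => //; apply: norm1'.
  + exact: (up2 z zX s (or_introl erefl)).
  + exact: (up2 z zX t (or_intror erefl)).
Qed.
End Glue.

(** * Minor models across a virtual edge *)

Section Transfer.
Variables (V : finType).
Implicit Types (e : rel V) (X Y : {set V}).

Lemma conn_in e e' X : {in X &, forall x y, e x y -> e' x y} -> conn e X -> conn e' X.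
Proof.
move=> ee cX; apply: connI => [|Y /set0Pn[y yY] YX cl]; first exact: conn_neq0 cX.
apply: conn_meet cX _ _; last by exists y => //; apply: (subsetP YX).
by move=> a b aY aX bX eab; exact: cl aY bX (ee _ _ aX bX eab).
Qed.

(** [Y] stands in for the virtual edge: added to the branch set that contains [a], it makes this set
    reach [b]. No branch set meets [Y], because the vertices of [Y] are isolated in [e'] and every
    vertex of [H] has a neighbour. *)
Lemma model_virtual (H : finType) (h : rel H) e e' (a b : V) Y :
  symmetric e -> (forall i, exists j, h i j) ->
  conn e Y -> adj e [set a] Y -> adj e [set b] Y -> a \notin Y -> b \notin Y ->
  (forall x y, e' x y -> virtual e a b x y) -> (forall x y, e' x y -> x \notin Y) ->
  has_model e' h -> has_model e h.
Proof.
move=> esym hj cY aY bY naY nbY ev eY [B [cB dB aB]].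
have YB i x : x \in B i -> x \notin Y.
  move=> xB; apply/negP=> xY.
  have Bx : [set x] = B i.
    apply: conn_closed (cB i) _ _ _.
    - by apply/set0Pn; exists x; rewrite inE.
    - by rewrite sub1set.
    by move=> u v /set1P-> _ /eY; rewrite xY.
  have [j /aB/adjP[u [v [+ _ /eY]]]] := hj i.
  by rewrite -Bx => /set1P->; rewrite xY.
have meetY (Z : {set V}) c : (c == a) || (c == b) -> c \in Z ->
    (forall x y, x \in Z -> y \in Y -> e x y -> y \in Z) -> Y \subset Z.
  move=> cab cZ cl.
  have /adjP[u [y [/set1P-> yY ecy]]] : adj e [set c] Y by case/orP: cab => /eqP->.
  apply: conn_meet cY _ _; last by exists y => //; apply: cl ecy.
  by move=> u' v uZ _ vY; apply: cl.
pose B' i := if a \in B i then B i :|: Y else B i.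
exists B'; split=> [i|i j ij|i j hij].
- rewrite /B'; case: ifP => [aBi|aBi]; last first.
    apply: conn_in (cB i) => x y xB yB /ev/or3P[//||] /andP[/eqP xa /eqP yb].
      by rewrite xa aBi in xB.
    by rewrite yb aBi in yB.
  apply: connI => [|Z /set0Pn[z zZ] ZB cl].
    by apply/set0Pn; exists a; rewrite inE aBi.
  have clY x y : x \in Z -> y \in Y -> e x y -> y \in Z.
    by move=> xZ yY exy; apply: cl exy => //; rewrite inE yY orbT.
  have BZ : (exists2 x, x \in B i & x \in Z) -> B i \subset Z.
    move=> hx; apply: conn_meet (cB i) _ hx => x y xZ xB yB /ev/or3P[exy||].
    - by apply: cl exy => //; rewrite inE yB.
    - case/andP=> /eqP xa /eqP yb.
      have YZ : Y \subset Z by apply: (meetY _ x); rewrite ?xa ?eqxx // -xa.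
      have /adjP[u [w [/set1P-> wY ebw]]] := bY.
      by apply: (cl w); rewrite ?(subsetP YZ) // ?inE ?yB // yb esym.
    - case/andP=> /eqP xb /eqP ya.
      have YZ : Y \subset Z by apply: (meetY _ x); rewrite ?xb ?eqxx ?orbT // -xb.
      have /adjP[u [w [/set1P-> wY eaw]]] := aY.
      by apply: (cl w); rewrite ?(subsetP YZ) // ?inE ?yB // ya esym.
  suff BiZ : B i \subset Z.
    rewrite subUset BiZ /=; apply: (meetY _ a); rewrite ?eqxx //.
    exact: (subsetP BiZ).
  apply: BZ; have := subsetP ZB z zZ; rewrite inE => /orP[zB|zY]; first by exists z.
  have YZ : Y \subset Z.
    by apply: conn_meet cY _ _; [move=> u v uZ _ vY; apply: clY | exists z].
  exists a => //; have /adjP[u [w [/set1P-> wY eaw]]] := aY.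
  by apply: (cl w); rewrite ?(subsetP YZ) // ?inE ?aBi // esym.
- have dd k l : k != l -> a \in B k -> [disjoint B k :|: Y & B l].
    move=> kl aBk; apply: disjI => z; rewrite inE => /orP[zk|zY] zl.
      by have := disjointFr (dB _ _ kl) zk; rewrite zl.
    by have := YB _ _ zl; rewrite zY.
  rewrite /B'; case: ifP => aBi; case: ifP => aBj.
  + by have := disjointFr (dB _ _ ij) aBi; rewrite aBj.
  + exact: dd.
  + by rewrite disjoint_sym dd // eq_sym.
  + exact: dB.
- have BB' k x : x \in B k -> x \in B' k by rewrite /B'; case: ifP; rewrite ?inE => // _ ->.
  have YB' k : a \in B k -> Y \subset B' k by rewrite /B' => ->; apply: subsetUr.
  case/adjP: (aB _ _ hij) => x [y [xB yB /ev/or3P[exy||]]].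
  + by apply: (adjI _ _ exy); apply: BB'.
  + case/andP=> /eqP xa /eqP yb; have /adjP[u [w [/set1P-> wY ebw]]] := bY.
    rewrite esym in ebw; apply: (adjI _ _ ebw); last by rewrite -yb BB'.
    by apply: (subsetP (YB' i _)); rewrite // -xa.
  + case/andP=> /eqP xb /eqP ya; have /adjP[u [w [/set1P-> wY ebw]]] := bY.
    apply: (adjI _ _ ebw); first by rewrite -xb BB'.
    by apply: (subsetP (YB' j _)); rewrite // -ya.
Qed.

Lemma model_sub (H : finType) (h : rel H) e e' : (forall x y, e' x y -> e x y) ->
  has_model e' h -> has_model e h.
Proof.
move=> ee [B [cB dB aB]]; exists B; split=> // [i|i j /aB/adjP[x [y [xB yB /ee exy]]]].
  by apply: conn_in (cB i) => x y _ _; apply: ee.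
exact: adjI exy.
Qed.

Lemma complete_neighbor (i : 'I_5) : exists j, @complete_rel 5 i j.
Proof.
exists (if i == ord0 then ord_max else ord0); rewrite /complete_rel.
by case: ifP => [/eqP->|->].
Qed.

Lemma bipartite_neighbor (i : 'I_3 + 'I_3) : exists j, @bipartite_rel 3 3 i j.
Proof. by case: i => i; [exists (inr ord0) | exists (inl ord0)]. Qed.

Lemma kfree_virtual e e' (a b : V) Y : symmetric e ->
  conn e Y -> adj e [set a] Y -> adj e [set b] Y -> a \notin Y -> b \notin Y ->
  (forall x y, e' x y -> virtual e a b x y) -> (forall x y, e' x y -> x \notin Y) ->
  kfree e -> kfree e'.
Proof.
move=> esym cY aY bY naY nbY ev eY [k5 k33]; split=> M.
  by apply: k5; apply: model_virtual ev eY M => //; apply: complete_neighbor.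
by apply: k33; apply: model_virtual ev eY M => //; apply: bipartite_neighbor.
Qed.

Lemma kfree_sub e e' : (forall x y, e' x y -> e x y) -> kfree e -> kfree e'.
Proof. by move=> ee [k5 k33]; split=> /(model_sub ee). Qed.

End Transfer.

(** * Induction over small cuts and components *)

Section Main.
Variable V : finType.
Implicit Types (e : rel V) (A X Y : {set V}).

Section Step.
Variables (e : rel V) (A : {set V}) (s t : V).
Hypotheses (esym : symmetric e) (eirr : irreflexive e).
Hypotheses (eA : forall x y, e x y -> x \in A) (kf : kfree e) (cA : conn e A).
Hypotheses (st : s != t) (est : e s t).
Hypothesis IH : forall e' A' s' t', #|A'| < #|A| -> symmetric e' -> irreflexive e' ->
  (forall x y, e' x y -> x \in A') -> kfree e' -> conn e' A' -> s' != t' -> e' s' t' ->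
  normal_realizer e' A' s' t'.

Let sA : s \in A. Proof. exact: eA est. Qed.
Let tA : t \in A. Proof. by apply: (eA (y := s)); rewrite esym. Qed.

Section Cut.
Variables (X : {set V}) (z : V).
Hypotheses (cX : conn e X) (XA : X \subset A) (sX : s \notin X) (tX : t \notin X).
Hypotheses (zA : z \in A) (zX : z \notin X) (zs : z != s) (zt : z != t).

(** Each half is completed by the virtual edge and stays free of the two minors because the other
    half provides a connection, unless [ab] is an edge already. The vertex [z] makes [X :|:
    [set a; b]] smaller than [A] even when the cut is [[set s; t]]. *)
Lemma two_cut (a b : V) : a != b -> a \in A -> b \in A -> a \notin X -> b \notin X ->
  nbrs e X \subset [set a; b] ->
  e a b \/ adj e [set a] X /\ adj e [set b] X ->
  e a b \/ (exists Y, [/\ conn e Y, Y \subset A :\: X :\: [set a; b], adj e [set a] Y & adj e [set b] Y]) ->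
  normal_realizer e A s t.
Proof.
move=> ab aA bA aX bX NX H1 H2.
have vsym : symmetric (virtual e a b).
  by move=> x y; rewrite /virtual esym; case: (x == a) (y == b) (x == b) (y == a) => [] [] [] [].
have virr : irreflexive (virtual e a b).
  move=> x; rewrite /virtual eirr /= [(x == a) && _]andbC orbb; apply/negP.
  by case/andP=> /eqP xb /eqP xa; case/eqP: ab; rewrite -xa.
have NX' x y : x \in X -> e x y -> y \in X :|: [set a; b].
  move=> xX exy; rewrite in_setU; case yX: (y \in X) => //=.
  by apply: (subsetP NX); apply/nbrsP; rewrite yX; split=> //; exists x.
pose r1 := restr (virtual e a b) (A :\: X).
pose r2 := restr (virtual e a b) (X :|: [set a; b]).
have vab : virtual e a b a b by rewrite /virtual !eqxx orbT.
have aAX : a \in A :\: X by rewrite inE aX.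
have bAX : b \in A :\: X by rewrite inE bX.
have sAX : s \in A :\: X by rewrite inE sX.
have tAX : t \in A :\: X by rewrite inE tX.
have zAX : z \in A :\: X by rewrite inE zX.
have aU : a \in X :|: [set a; b] by rewrite !inE eqxx orbT.
have bU : b \in X :|: [set a; b] by rewrite !inE eqxx !orbT.
have rv B x y : restr (virtual e a b) B x y -> virtual e a b x y by case/restrP.
have ev x y : e x y -> virtual e a b x y by rewrite /virtual => ->.
have ve : e a b -> forall x y, virtual e a b x y -> e x y.
  by move=> eab x y /or3P[//||] /andP[/eqP-> /eqP->]; rewrite // esym.
have kf1 : kfree r1.
  case: H1 => [eab|[aX' bX']]; first by apply: kfree_sub kf => x y /rv/ve; apply.
  apply: (kfree_virtual esym cX aX' bX' aX bX _ _ kf) => x y; first exact: rv.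
  by case/restrP; rewrite inE => /andP[].
have kf2 : kfree r2.
  case: H2 => [eab|[Y [cY YA aY bY]]]; first by apply: kfree_sub kf => x y /rv/ve; apply.
  have Yn x : x \in Y -> x \notin X :|: [set a; b].
    by move=> /(subsetP YA); rewrite !inE !negb_or => /and3P[-> -> _].
  apply: (kfree_virtual esym cY aY bY _ _ _ _ kf); first last.
  - by move=> x y /restrP[xU _ _]; apply/negP=> /Yn; rewrite xU.
  - by move=> x y; exact: rv.
  - by apply/negP=> /Yn; rewrite bU.
  - by apply/negP=> /Yn; rewrite aU.
have c1 : conn r1 (A :\: X).
  apply: connI => [|Z /set0Pn[w wZ] ZA cl]; first by apply/set0Pn; exists s.
  have r1I x y : x \in A :\: X -> y \in A :\: X -> virtual e a b x y -> r1 x y.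
    by move=> xA yA vxy; apply/restrP.
  have abZ : a \in Z <-> b \in Z.
    by split=> cZ; apply: cl cZ _ _ => //; apply: r1I; rewrite // vsym.
  (* A closed part contains [a] exactly when it contains [b]; adding [X] in that case makes it
     closed in [A]. *)
  have /subsetP AW : A \subset (if a \in Z then Z :|: X else Z).
    have inW x : x \in Z -> x \in (if a \in Z then Z :|: X else Z).
      by case: ifP => // _; rewrite inE => ->.
    apply: conn_meet cA _ _; last by exists w; [have /setDP[] := subsetP ZA w wZ | apply: inW].
    move=> x y xW _ yA exy; case yX: (y \in X); last first.
      have yAX : y \in A :\: X by rewrite inE yX.
      case xZ: (x \in Z); first by apply: inW; exact: (cl _ _ xZ yAX (r1I _ _ (subsetP ZA _ xZ) yAX (ev _ _ exy))).
      move: xW; case: ifP => aZ; last by rewrite xZ.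
      rewrite inE xZ /= => xX; have := NX' x y xX exy; rewrite !inE yX /= => yab.
      by have bZ := abZ.1 aZ; case/orP: yab => /eqP->; rewrite ?aZ ?bZ.
    suff -> : a \in Z by rewrite inE yX orbT.
    move: xW; case: ifP => // aZ xZ.
    have := NX' y x yX; rewrite esym => /(_ exy); rewrite !inE.
    have /setDP[_ /negPf-> /=] := subsetP ZA x xZ.
    by case/orP=> /eqP xE; rewrite xE in xZ; [rewrite aZ in xZ | have := abZ.2 xZ; rewrite aZ].
  apply/subsetP=> x; rewrite inE => /andP[xX /AW]; case: ifP => // _.
  by rewrite inE (negPf xX) orbF.
have c2 : conn r2 (X :|: [set a; b]).
  have vsym2 : symmetric r2 := restr_sym vsym (X :|: [set a; b]).
  have [c cab cX'] : exists2 c, c \in [set a; b] & adj e X [set c].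
    have [y yX ynX] : exists2 y, y \in nbrs e X & y \notin X.
      case: (boolP [exists y, y \in nbrs e X]) => [/existsP[y yN]|nN].
        by exists y => //; have [] := nbrsP _ _ _ yN.
      have : A \subset X.
        have /set0Pn[x xX] := conn_neq0 cX.
        apply: conn_meet cA _ _; last by exists x; rewrite ?(subsetP XA).
        move=> u v uX _ vA euv; apply/negPn/negP=> vX; case/negP: nN; apply/existsP; exists v.
        by apply/nbrsP; split=> //; exists u.
      by move=> /subsetP/(_ s sA); rewrite (negPf sX).
    exists y; first exact: (subsetP NX).
    by have [_ [x xX exy]] := nbrsP _ _ _ yX; apply: (adjI xX _ exy); rewrite inE.
  apply: (connU vsym2).
  - by apply: conn_in cX => x y xX yX exy; apply/restrP; rewrite !in_setU xX yX ev.
  - apply: (connU vsym2 (conn1 _ _) (conn1 _ _)); right.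
    by apply: (adjI (x := a) (y := b)); rewrite ?inE //; apply/restrP.
  - right; case/adjP: cX' => x [y [xX /set1P-> exc]]; apply: (adjI xX cab).
    by apply/restrP; split; [rewrite in_setU xX | rewrite in_setU cab orbT | apply: ev].
have rsym B : symmetric (restr (virtual e a b) B) by exact: restr_sym.
have rirr B : irreflexive (restr (virtual e a b) B).
  by move=> x; rewrite /restr /= virr !andbF.
have rA B x y : restr (virtual e a b) B x y -> x \in B by case/restrP.
have [] := @IH r1 (A :\: X) s t _ (rsym _) (rirr _) (rA _) kf1 c1 st _.
- apply: proper_card; apply/properP; split; first exact: subsetDl.
  have /set0Pn[x xX] := conn_neq0 cX; exists x; first exact: (subsetP XA).
  by rewrite inE xX.
- by apply/restrP; split=> //; apply: ev.
move=> r [[rE rD] rN].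
have [] := @IH r2 (X :|: [set a; b]) a b _ (rsym _) (rirr _) (rA _) kf2 c2 ab _.
- apply: proper_card; apply/properP; split; first by rewrite !subUset XA !sub1set aA.
  have [w wA [wX wa wb]] : exists2 w, w \in A & [/\ w \notin X, w != a & w != b].
    case: (eqVneq s a) => [sa|sa]; last case: (eqVneq s b) => [sb|sb]; last by exists s.
      case: (eqVneq t b) => [tb|tb]; first by exists z; rewrite // -sa -tb.
      by exists t; rewrite // -sa eq_sym.
    case: (eqVneq t a) => [ta|ta]; first by exists z; rewrite // -ta -sb.
    by exists t; rewrite // -sb [t == s]eq_sym.
  by exists w; rewrite // !inE !negb_or wX wa wb.
- by apply/restrP.
move=> q [[qE qD] qN].
have Xo x y : x \in X -> y \in A -> e x y -> y \in X :|: [set a; b].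
  by move=> xX _; apply: NX'.
have Rr : realizer (virtual e a b) (A :\: X) r.
  by split=> // x y w xA yA wA vxy; apply: rE => //; exact/restrP.
have Rq : realizer (virtual e a b) (X :|: [set a; b]) q.
  by split=> // x y w xA yA wA vxy; apply: qE => //; exact/restrP.
exact: (realizer_glue eirr esym ab st aAX bAX sAX tAX Xo Rr rN Rq qN).
Qed.

(** The second cut vertex is an outer neighbour of [a], so the added edge is a real one. Without
    such a neighbour [A] would be contained in [X :|: [set a]], forcing [s] and [t] to coincide. *)
Lemma one_cut (a : V) : nbrs e X \subset [set a] -> a \in A -> a \notin X ->
  normal_realizer e A s t.
Proof.
move=> NX aA aX.
have [c [cA' cX' ca eac]] : exists c, [/\ c \in A, c \notin X, c != a & e a c].
  case: (boolP [exists c, [&& c \in A, c \notin X, c != a & e a c]]) => [/existsP[c /and4P[]]|nc].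
    by exists c.
  have : A \subset X :|: [set a].
    apply: conn_meet cA _ _; last by exists a; rewrite // !inE eqxx orbT.
    move=> x y xXa _ yA exy; apply/negPn/negP; rewrite !inE negb_or => /andP[yX ya].
    move: xXa; rewrite !inE => /orP[xX|/eqP xa].
      have : y \in nbrs e X by apply/nbrsP; split=> //; exists x.
      by move/(subsetP NX); rewrite inE (negPf ya).
    by case/negP: nc; apply/existsP; exists y; rewrite yA yX ya -xa.
  move=> /subsetP AX; exfalso; case/eqP: st.
  have sa := AX s sA; have ta := AX t tA.
  move: sa ta; rewrite !inE (negPf sX) (negPf tX) /= => /eqP-> /eqP->; by [].
apply: (@two_cut a c) => //; first by rewrite eq_sym.
- by apply: subset_trans NX _; rewrite sub1set !inE eqxx.
- by left.
- by left.
Qed.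

End Cut.

(** Only nonadjacent [a], [b] without an outer connection resist [two_cut]. Then the component of
    [s] outside [X] contains exactly one of them, and [X] enlarged by the component of the other has
    a single neighbour. *)
Lemma small_cut X z : conn e X -> X \subset A :\: [set s; t] -> z \notin X -> z != s -> z != t ->
  e s z || e t z -> #|nbrs e X| <= 2 -> normal_realizer e A s t.
Proof.
move=> cX XA sX' zs zt ez N2.
have inX x : x \in X -> [&& x \in A, x != s & x != t].
  by move=> /(subsetP XA); rewrite !inE negb_or => /andP[-> ->].
have XA' : X \subset A by apply/subsetP=> x /inX/and3P[].
have sX : s \notin X by apply/negP=> /inX/and3P[_]; rewrite eqxx.
have tX : t \notin X by apply/negP=> /inX/and3P[_ _]; rewrite eqxx.
have zA : z \in A by case/orP: ez => ez; [apply: (eA (y := s)) | apply: (eA (y := t))]; rewrite esym.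
have Nout y : y \in nbrs e X -> y \in A /\ y \notin X.
  by move=> /nbrsP[yX [x xX exy]]; split=> //; apply: (eA (y := x)); rewrite esym.
have one := one_cut cX XA' sX tX zA sX' zs zt.
have [/eqP N1|/set0Pn[a aN]] := boolP (nbrs e X == set0).
  by apply: (one s); rewrite ?N1 ?sub0set.
have [aA aX] := Nout a aN.
have [N1|/set0Pn[b]] := boolP (nbrs e X :\ a == set0).
  by apply: (one a) => //; rewrite -setD_eq0.
rewrite in_setD1 => /andP[ba bN]; have [bA bX] := Nout b bN.
have NX : nbrs e X = [set a; b].
  apply/eqP; rewrite eq_sym eqEcard subUset !sub1set aN bN cards2 eq_sym ba /=.
  exact: N2.
have adjN c : c \in nbrs e X -> adj e [set c] X.
  by case/nbrsP=> _ [x xX exc]; rewrite adjC //; apply: (adjI xX _ exc); rewrite inE.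
have two : e a b \/ (exists Y, [/\ conn e Y, Y \subset A :\: X :\: [set a; b],
    adj e [set a] Y & adj e [set b] Y]) -> normal_realizer e A s t.
  apply: (two_cut cX XA' sX tX zA sX' zs zt) => //; rewrite ?NX //; first by rewrite eq_sym.
  by right; rewrite !adjN.
case eab: (e a b); first by apply: two; left.
case: (boolP [exists Y : {set V}, [&& conn e Y, Y \subset A :\: X :\: [set a; b],
    adj e [set a] Y & adj e [set b] Y]]) => [/existsP[Y /and4P[? ? ? ?]]|nY].
  by apply: two; right; exists Y.
pose C x := comp e (A :\: X) x.
have CI x y w : y \in C x -> w \in A -> w \notin X -> e y w -> w \in C x.
  by move=> yC wA wX eyw; apply: comp_closed yC _ eyw; rewrite inE wX.
have sAX : s \in A :\: X by rewrite inE sX.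
have tC : t \in C s by apply: (CI s s t) => //; apply: mem_comp.
have zC : z \in C s.
  by case/orP: ez => ez; [apply: (CI s s z) | apply: (CI s t z)]; rewrite ?mem_comp.
have notboth : a \in C s -> b \in C s -> False.
  move=> aC bC; have [||||||[D [cD DW aD Db]]] := @conn_link _ e esym (C s) [set a] [set b].
  - exact: conn_comp.
  - by rewrite sub1set.
  - by apply/set0Pn; exists a; rewrite inE.
  - by exists b => //; rewrite inE.
  - by apply: disjI => u /set1P-> /set1P ab; rewrite ab eqxx in ba.
  - by case/adjP=> u [v [/set1P-> /set1P->]]; rewrite eab.
  case/negP: nY; apply/existsP; exists D; rewrite cD aD [adj e [set b] _]adjC // Db !andbT.
  by apply: subset_trans DW _; apply: setSD; apply: comp_sub.
have some : (a \in C s) || (b \in C s).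
  apply/negPn/negP; rewrite negb_or => /andP[naC nbC].
  have : A \subset C s.
    apply: conn_meet cA _ _; last by exists s => //; apply: mem_comp.
    move=> x y xC _ yA exy; apply: (CI s x y) => //; apply/negP=> yX.
    have : x \in nbrs e X.
      apply/nbrsP; split; last by exists y; rewrite // esym.
      by have := subsetP (comp_sub _ _ _) _ xC; rewrite inE => /andP[].
    by rewrite NX in_set2 => /orP[]/eqP xE; [case/negP: naC | case/negP: nbC]; rewrite -xE.
  by move=> /subsetP/(_ a aA); rewrite (negPf naC).
have finish c d : c \in [set a; b] -> d \in [set a; b] -> (forall u, u \in [set a; b] -> u = c \/ u = d) ->
    c \in C s -> d \notin C s -> normal_realizer e A s t.
  move=> cab dab cd cC dC.
  have dN : d \in nbrs e X by rewrite NX.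
  have cN : c \in nbrs e X by rewrite NX.
  have [dA dX] := Nout d dN; have [cA' cX'] := Nout c cN.
  have dAX : d \in A :\: X by rewrite inE dX.
  have dis u : u \in C s -> u \notin C d.
    rewrite /C !inE => /andP[uAX su]; apply/negP=> /andP[_ du].
    case/negP: dC; rewrite /C !inE dX dA /=; apply: connect_trans su _.
    by rewrite restr_csym.
  have XC : conn e (X :|: C d).
    apply: connU => //; first exact: conn_comp.
    by right; rewrite adjC //; apply: adjS (adjN d dN) => //; rewrite sub1set mem_comp.
  have nXC u : u \notin X -> u \in C s -> u \notin X :|: C d.
    by move=> uX uC; rewrite inE negb_or uX dis.
  have XCA : X :|: C d \subset A.
    by rewrite subUset XA' /=; apply: subset_trans (comp_sub _ _ _) (subsetDl _ _).
  have sC : s \in C s by apply: mem_comp.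
  apply: (one_cut XC XCA (nXC s sX sC) (nXC t tX tC) zA (nXC z sX' zC) zs zt (a := c)) => //.
    apply/subsetP=> y /nbrsP[+ [x xXC exy]]; rewrite in_setU negb_or => /andP[yX yC].
    have yA : y \in A by apply: (eA (y := x)); rewrite esym.
    move: xXC; rewrite in_setU => /orP[xX|xC]; last by case/negP: yC; apply: CI xC yA yX exy.
    have : y \in nbrs e X by apply/nbrsP; split=> //; exists x.
    rewrite NX => /cd[->|yd]; first by rewrite inE.
    by case/negP: yC; rewrite yd mem_comp.
  exact: nXC.
have aab : a \in [set a; b] by rewrite !inE eqxx.
have bab : b \in [set a; b] by rewrite !inE eqxx orbT.
case/orP: some => h.
  apply: (finish a b) => //; first by move=> u; rewrite in_set2 => /orP[]/eqP; auto.
  by apply/negP=> /(notboth h).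
apply: (finish b a) => //; first by move=> u; rewrite in_set2 => /orP[]/eqP; auto.
by apply/negP=> /notboth /(_ h).
Qed.

End Step.

(** A violation of [tight] is a set to which [small_cut] applies; without one the shelling
    succeeds. *)
Theorem kfree_normal_realizer e A s t : symmetric e -> irreflexive e ->
  (forall x y, e x y -> x \in A) -> kfree e -> conn e A -> s != t -> e s t ->
  normal_realizer e A s t.
Proof.
have [n] := ubnP #|A|; elim: n e A s t => // n IHn e A s t An esym eirr eA kf cA st est.
have IH e' A' s' t' : #|A'| < #|A| -> symmetric e' -> irreflexive e' ->
    (forall x y, e' x y -> x \in A') -> kfree e' -> conn e' A' -> s' != t' -> e' s' t' ->
    normal_realizer e' A' s' t'.
  by move=> lt; apply: IHn; apply: leq_trans lt _.
have sA : s \in A by exact: eA est.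
have tA : t \in A by apply: (eA _ s); rewrite esym.
pose bad (X : {set V}) z := [&& conn e X, X \subset A :\: [set s; t], z \notin X, z != s, z != t,
  e s z || e t z & #|nbrs e X| <= 2].
case: (boolP [exists X : {set V}, [exists z, bad X z]]) => [/existsP[X /existsP[z]]|nobad].
  case/and5P=> cX XA zX zs /and3P[zt ez N2].
  exact: (small_cut esym eirr eA kf cA st est IH cX XA zX zs zt ez N2).
apply: (tight_realizer esym eirr eA sA tA st est kf) => // X z cX XA zX zs zt ez.
rewrite ltnNge; apply/negP=> N2; case/negP: nobad; apply/existsP; exists X.
by apply/existsP; exists z; rewrite /bad cX XA zX zs zt ez.
Qed.

(* Two realizers on parts without edges between them are stacked: first part below in two
   orders, above in the third. *)
Lemma realizer_disjoint e A X : X \subset A -> (forall x y, x \in X -> y \in A :\: X -> ~~ e x y) ->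
  symmetric e -> (exists r, realizer e X r) -> (exists r, realizer e (A :\: X) r) ->
  exists r, realizer e A r.
Proof.
move=> XA nXY esym [r [rE rD]] [q [qE qD]].
pose B := (\sum_k \sum_x (r k x + q k x)).+1.
have sB k x : r k x + q k x < B by rewrite ltnS (bigD1 k) //= (bigD1 x) //= -addnA leq_addr.
have rB k x : r k x < B by apply: leq_ltn_trans (sB k x); apply: leq_addr.
have qB k x : q k x < B by apply: leq_ltn_trans (sB k x); apply: leq_addl.
pose f i x := if x \in X then (if i == o1 then r i x + B else r i x)
  else (if i == o1 then q i x else q i x + B).
have fX i x z : x \in X -> z \in X -> r i x < r i z -> f i x < f i z.
  by move=> xX zX h; rewrite /f xX zX; case: ifP; rewrite ?ltn_add2r.
have fY i x z : x \notin X -> z \notin X -> q i x < q i z -> f i x < f i z.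
  by move=> /negPf xX /negPf zX h; rewrite /f xX zX; case: ifP; rewrite ?ltn_add2r.
have fXY x z : x \in X -> z \notin X -> f o0 x < f o0 z.
  move=> xX /negPf zX; rewrite /f xX zX /=; exact: leq_trans (rB _ _) (leq_addl _ _).
have fYX x z : x \notin X -> z \in X -> f o1 x < f o1 z.
  move=> /negPf xX zX; rewrite /f xX zX /=; exact: leq_trans (qB _ _) (leq_addl _ _).
have inY x : x \in A -> x \notin X -> x \in A :\: X by rewrite inE => -> ->.
exists f; split=> [x y z xA yA zA exy zx zy|x z xA zA xz].
  case: (boolP (x \in X)) => xX.
    have yX : y \in X by apply/negPn/negP=> yX; have := nXY x y xX (inY y yA yX); rewrite exy.
    case: (boolP (z \in X)) => zX; last by exists o0; rewrite !fXY.
    by have [i [h1 h2]] := rE x y z xX yX zX exy zx zy; exists i; rewrite !fX.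
  have yX : y \notin X.
    by apply/negP=> yX; have := nXY y x yX (inY x xA xX); rewrite esym exy.
  case: (boolP (z \in X)) => zX; first by exists o1; rewrite !fYX.
  have [i [h1 h2]] := qE x y z (inY x xA xX) (inY y yA yX) (inY z zA zX) exy zx zy.
  by exists i; rewrite !fY.
case: (boolP (x \in X)) => xX; case: (boolP (z \in X)) => zX.
- by have [i h] := rD x z xX zX xz; exists i; apply: fX.
- by exists o0; apply: fXY.
- by exists o1; apply: fYX.
- by have [i h] := qD x z (inY x xA xX) (inY z zA zX) xz; exists i; apply: fY.
Qed.

Lemma realizer_sub e e' A r : (forall x y, x \in A -> y \in A -> e' x y -> e x y) -> realizer e A r ->
  realizer e' A r.
Proof.
by move=> ee [rE rD]; split=> // x y z xA yA zA /(ee _ _ xA yA) exy; apply: rE.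
Qed.

(** Components are stacked, and inside a component any edge can serve as the base [st]. *)
Theorem kfree_realizer e : symmetric e -> irreflexive e -> kfree e ->
  exists r, realizer e setT r.
Proof.
move=> esym eirr kf.
suff H A : exists r, realizer e A r by exact: H.
have [n] := ubnP #|A|; elim: n A => // n IHn A An.
case: (set_0Vmem A) => [->|[x xA]].
  by exists (fun _ _ => 0); split=> [x y z|x z]; rewrite inE.
set C := comp e A x.
have CA : C \subset A by exact: comp_sub.
case: (eqVneq C A) => [CAE|CnA]; last first.
  have CpA : C \proper A by rewrite properEneq CnA.
  apply: (@realizer_disjoint e A C) => //.
  - move=> u v uC; rewrite inE => /andP[vC vA]; apply/negP=> euv; case/negP: vC.
    exact: comp_closed uC vA euv.
  - by apply: IHn; apply: leq_trans (proper_card CpA) _.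
  - apply: IHn; apply: leq_trans (proper_card (B := A) _) _ => //.
    apply/properP; split; first exact: subsetDl.
    by exists x => //; rewrite inE mem_comp.
have cA : conn e A by rewrite -CAE; apply: conn_comp.
case: (eqVneq A [set x]) => [Ax|Ax].
  exists (fun _ _ => 0); rewrite Ax; split=> [u v w|u w]; rewrite !inE.
    by move=> /eqP-> /eqP-> /eqP->; rewrite eirr.
  by move=> /eqP-> /eqP->; rewrite eqxx.
have [y [yA exy]] : exists y, y \in A /\ e x y.
  case: (boolP [exists y in A, e x y]) => [/exists_inP[y yA exy]|ny]; first by exists y.
  case/eqP: Ax; symmetry; apply: conn_closed cA _ _ _.
  - by apply/set0Pn; exists x; rewrite inE.
  - by rewrite sub1set.
  by move=> u v /set1P-> vA exv; case/negP: ny; apply/exists_inP; exists v.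
have irr : irreflexive (restr e A) by move=> u; rewrite /restr /= eirr !andbF.
have kfA : kfree (restr e A) by apply: kfree_sub kf => u v /restrP[].
have cA' : conn (restr e A) A by apply: conn_in cA => u v uA vA euv; apply/restrP.
have rA u v : restr e A u v -> u \in A by case/restrP.
have xy : x != y by apply: contraTneq exy => ->; rewrite eirr.
have exy' : restr e A x y by apply/restrP.
have [r [rl _]] := kfree_normal_realizer (restr_sym esym A) irr rA kfA cA' xy exy'.
by exists r; apply: realizer_sub rl => u v uA vA euv; apply/restrP.
Qed.
End Main.

(** * Minors *)

(** Ordered pairs: every edge is counted twice. *)
Definition edge_set (G : sgraph) := [set p : G * G | edge p.1 p.2].

Section Sizes.
Variable G : sgraph.
Implicit Types u v : G.

Lemma card_del_vertex v : #|del_vertex v| = #|G|.-1.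
Proof. by rewrite card_sig -(cardC1 v); apply: eq_card. Qed.

Lemma card_contract u v : #|contract_edge u v| = #|G|.-1.
Proof. by rewrite card_sig -(cardC1 v); apply: eq_card. Qed.

Lemma edges_del_vertex v : #|edge_set (del_vertex v)| <= #|edge_set G|.
Proof.
pose f (p : del_vertex v * del_vertex v) := (val p.1, val p.2).
have f_inj : injective f by move=> [x y] [x' y'] [/val_inj-> /val_inj->].
rewrite -(card_imset _ f_inj); apply/subset_leq_card/subsetP=> _ /imsetP[p pE ->].
by move: pE; rewrite !inE.
Qed.

(** A contracted edge is sent to an original edge that causes it, if possible one avoiding [v].
    Since [v] is no vertex of the contraction, its position in the image reveals which case
    applied. *)
Lemma edges_contract u v : #|edge_set (contract_edge u v)| <= #|edge_set G|.
Proof.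
pose f (p : contract_edge u v * contract_edge u v) :=
  if edge (val p.1) (val p.2) then (val p.1, val p.2)
  else if (val p.1 == u) && edge v (val p.2) then (v, val p.2) else (val p.1, v).
have f_inj : {in edge_set (contract_edge u v) &, injective f}.
{ move=> [x y] [x' y']; rewrite !inE /edge /= /contract_rel /f /= => /andP[_ E] /andP[_ E'].
  have nv (z : contract_edge u v) : (val z == v) = false by apply/negbTE/(valP z).
  have nv1 (z : contract_edge u v) : v = sval z -> False.
    by move=> /eqP; rewrite eq_sym nv.
  have nv2 (z : contract_edge u v) : sval z = v -> False by move/eqP; rewrite nv.
  case e1: (edge (sval x) (sval y)) E => /= E; case e2: (edge (sval x') (sval y')) E' => /= E';
  try (case g1: ((sval x == u) && edge v (sval y)) E => /= E);
  try (case g2: ((sval x' == u) && edge v (sval y')) E' => /= E').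
  all: move=> h; have /= h1 := congr1 fst h; have /= h2 := congr1 snd h.
  all: try by [case: (nv1 _ h1) | case: (nv1 _ h2) | case: (nv2 _ h1) | case: (nv2 _ h2)].
  all: try by congr (_, _); apply: val_inj.
  - case/andP: g1 => /eqP xu _; case/andP: g2 => /eqP xu' _.
    by congr (_, _); apply: val_inj; rewrite /= ?xu ?xu'.
  - case/andP: E => /eqP yu _; case/andP: E' => /eqP yu' _.
    by congr (_, _); apply: val_inj; rewrite /= ?yu ?yu'. }
rewrite -(card_in_imset f_inj); apply/subset_leq_card/subsetP=> _ /imsetP[[x y] pE ->].
have /andP[_ E] : @contract_rel G u v x y by move: pE; rewrite inE.
rewrite inE /f /=; case e1: (edge (sval x) (sval y)) E => //=.
case g1: ((sval x == u) && edge v (sval y)) => /=; first by case/andP: g1.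
by case/andP=> _; rewrite edge_sym.
Qed.

Lemma edges_del_edge u v : edge u v -> #|edge_set (del_edge u v)| < #|edge_set G|.
Proof.
move=> uv; apply/proper_card/properP; split.
  by apply/subsetP=> p; rewrite !inE => /andP[].
exists (u, v); first by rewrite inE.
by rewrite inE; apply/negP=> /andP[_]; rewrite eqxx.
Qed.

End Sizes.

(** Every operation strictly lowers the number of vertices or of edges, so equality of both numbers
    leaves only the isomorphism. *)
Lemma minor_measure (H G : sgraph) : minor H G ->
  [/\ #|H| <= #|G|, #|edge_set H| <= #|edge_set G| &
      #|H| = #|G| -> #|edge_set H| = #|edge_set G| -> isomorphic H G].
Proof.
have pos (K : sgraph) (v : K) : 0 < #|K| by apply/card_gt0P; exists v.
elim=> {G} [G iso|G v _ [h1 h2 _]|G u v uv _ [h1 h2 _]|G u v uv _ [h1 h2 _]].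
- have [f [g fK gK] fE] := iso.
  have f_inj := can_inj fK.
  split=> //; first exact: leq_card f_inj.
  pose F (p : H * H) := (f p.1, f p.2).
  have F_inj : injective F by move=> [x y] [x' y'] [/f_inj-> /f_inj->].
  rewrite -(card_imset _ F_inj); apply/subset_leq_card/subsetP=> _ /imsetP[p pE ->].
  by move: pE; rewrite !inE /= fE.
- rewrite card_del_vertex in h1; have := pos _ v => G0; split.
  + exact: leq_trans h1 (leq_pred _).
  + exact: leq_trans h2 (edges_del_vertex v).
  + by move=> HG; move: h1; rewrite HG -ltnS prednK // ltnn.
- have lt := leq_ltn_trans h2 (edges_del_edge uv); split=> //; first exact: ltnW.
  by move=> _ HG; rewrite HG ltnn in lt.
- rewrite card_contract in h1; have := pos _ v => G0; split.
  + exact: leq_trans h1 (leq_pred _).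
  + exact: leq_trans h2 (edges_contract u v).
  + by move=> HG; move: h1; rewrite HG -ltnS prednK // ltnn.
Qed.

(** Delete a vertex outside all branch sets, contract an edge inside a branch set that is not a
    singleton, or else delete an edge that has no counterpart in [H]; if none of these applies, the
    singletons define an isomorphism. *)
Lemma model_minor (H G : sgraph) : has_model (@edge G) (@edge H) -> minor H G.
Proof.
have [n] := ubnP (#|G| + #|edge_set G|); elim: n G => // n IHn G Gn [B [cB dB aB]].
have Hirr i j : edge i j -> i != j :> H by apply: contraTneq => ->; rewrite edge_irrefl.
have pos (v : G) : 0 < #|G| by apply/card_gt0P; exists v.
have ltn_v (K : sgraph) (v : G) : #|K| = #|G|.-1 -> #|edge_set K| <= #|edge_set G| ->
    #|K| + #|edge_set K| < n.
  move=> vK eK; apply: (@leq_trans (#|G| + #|edge_set G|)); last by [].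
  rewrite vK -addSn prednK ?(pos v) //; by rewrite leq_add2l.
case: (boolP [exists v, [forall i, v \notin B i]]) => [/existsP[v /forallP vB]|cover].
  apply: (@minor_del_vertex H G v); apply: IHn.
    by apply: (ltn_v _ v); [apply: card_del_vertex | apply: edges_del_vertex].
  have ne i a : a \in B i -> a != v by apply: contraTneq => ->; apply: vB.
  exists (fun i => [set x : del_vertex v | val x \in B i]); split=> [i|i j ij|i j ij].
  - apply: connI => [|Y /set0Pn[y yY] /subsetP YB cl].
      have /set0Pn[a aBi] := conn_neq0 (cB i).
      by apply/set0Pn; exists (Sub a (ne i a aBi)); rewrite inE SubK.
    have sub : B i \subset [set val x | x in Y].
      apply: conn_meet (cB i) _ _; last first.
        by exists (val y); [have := YB y yY; rewrite inE | apply: imset_f].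
      move=> _ b /imsetP[x xY ->] _ bB exb; apply/imsetP.
      exists (Sub b (ne i b bB)); last by rewrite SubK.
      by apply: (cl x); rewrite ?inE ?SubK.
    apply/subsetP=> x; rewrite inE => /(subsetP sub)/imsetP[x' x'Y /val_inj->]; exact: x'Y.
  - apply: disjI => x; rewrite !inE => xi xj.
    by have := disjointFr (dB _ _ ij) xi; rewrite xj.
  - have /adjP[a [b [aBi bBj eab]]] := aB _ _ ij.
    apply: (@adjI _ _ (Sub a (ne i a aBi)) (Sub b (ne j b bBj))); rewrite ?inE ?SubK //.
case: (boolP [exists i, 1 < #|B i|]) => [/existsP[i /card_gt1P[u0 [v0 [u0B v0B uv0]]]]|small].
  have [u [v [uB vB euv]]] : exists u v, [/\ u \in B i, v \in B i & edge u v].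
    case: (boolP [exists u in B i, [exists v in B i, edge u v]]) => [|ne].
      by case/exists_inP=> u uB /exists_inP[v vB euv]; exists u, v.
    exfalso; have : [set u0] = B i.
      apply: conn_closed (cB i) _ _ _; [by apply/set0Pn; exists u0; rewrite inE | by rewrite sub1set |].
      move=> x y /set1P-> yB exy; case/negP: ne; apply/exists_inP; exists u0 => //.
      by apply/exists_inP; exists y.
    by move=> BE; move: v0B uv0; rewrite -BE inE eq_sym => ->.
  have uv : u != v by apply: contraTneq euv => ->; rewrite edge_irrefl.
  apply: (minor_contract euv); apply: IHn.
    by apply: (ltn_v _ v); [apply: card_contract | apply: edges_contract].
  have same j : v \in B j -> j = i.
    move=> vj; apply/eqP/negPn/negP=> ji.
    by have := disjointFr (dB _ _ ji) vj; rewrite vB.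
  pose U : contract_edge u v := Sub u uv.
  exists (fun j => [set x : contract_edge u v | val x \in B j]); split=> [j|j k jk|j k jk].
  - have UB : v \in B j -> u \in B j by move=> /same->.
    apply: connI => [|Y /set0Pn[y yY] /subsetP YB cl].
      have /set0Pn[a aBi] := conn_neq0 (cB j); apply/set0Pn.
      case: (eqVneq a v) => [av|av]; last by exists (Sub a av); rewrite inE SubK.
      by exists U; rewrite inE SubK UB // -av.
    (* The preimage of [Y] under the contraction: [v] belongs to it as soon as [u] is in [Y]. *)
    pose Y' := [set a : G | [exists x in Y, (val x == a) || (val x == u) && (a == v)]].
    have sub : B j \subset Y'.
      apply: conn_meet (cB j) _ _; last first.
        exists (val y); first by have := YB y yY; rewrite inE.
        by rewrite inE; apply/exists_inP; exists y; rewrite ?eqxx.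
      move=> a b; rewrite !inE => /exists_inP[x xY xa] aBj bBj eab; apply/exists_inP.
      have goto (w : contract_edge u v) : val w \in B j -> @contract_rel G u v x w || (x == w) -> w \in Y.
        by move=> wB /orP[xw|/eqP<-//]; apply: (cl x); rewrite ?inE.
      case: (eqVneq b v) => [bv|bv]; last first.
        exists (Sub b bv); last by rewrite SubK eqxx.
        apply: goto; rewrite ?SubK // orbC; case: eqVneq => //= xw.
        rewrite /contract_rel xw /=; case/orP: xa => [/eqP->|/andP[-> /eqP av]]; rewrite ?eab //=.
        by rewrite av in eab; rewrite eab orbT.
      exists U; last by rewrite SubK bv !eqxx orbT.
      apply: goto; first by rewrite SubK UB // -bv.
      rewrite orbC; case: eqVneq => //= xw; rewrite /contract_rel xw /=.
      case/orP: xa => [/eqP xa|/andP[/eqP xu _]]; last first.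
        by case/eqP: xw; apply: val_inj; rewrite xu.
      by rewrite eqxx /= [X in [|| _, _ | X]](_ : _ = true) ?orbT // edge_sym xa; rewrite bv in eab.
    apply/subsetP=> x; rewrite inE => /(subsetP sub); rewrite inE.
    case/exists_inP=> x' x'Y /orP[/eqP/val_inj<-//|/andP[_ xv]].
    by have := valP x; rewrite /= xv.
  - apply: disjI => x; rewrite !inE => xi xj.
    by have := disjointFr (dB _ _ jk) xi; rewrite xj.
  - have /adjP[a [b [aBj bBk eab]]] := aB _ _ jk.
    have njk := Hirr _ _ jk.
    have ne (x y : contract_edge u v) : val x \in B j -> val y \in B k -> x != y.
      move=> xj yk; apply: contraTneq yk => <-.
      by rewrite (disjointFr (dB _ _ njk) xj).
    case: (eqVneq a v) => [av|av]; case: (eqVneq b v) => [bv|bv].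
    + by move: eab; rewrite av bv edge_irrefl.
    + have Uj : val U \in B j by rewrite SubK (same j) // -av.
      apply: (@adjI _ _ U (Sub b bv)); rewrite ?inE ?SubK //.
      apply/andP; split; first by apply: ne; rewrite ?SubK.
      by rewrite av in eab; rewrite !SubK eqxx eab orbT.
    + have Uk : val U \in B k by rewrite SubK (same k) // -bv.
      apply: (@adjI _ _ (Sub a av) U); rewrite ?inE ?SubK //.
      apply/andP; split; first by apply: ne; rewrite ?SubK.
      by rewrite bv edge_sym in eab; rewrite !SubK eqxx eab !orbT.
    + apply: (@adjI _ _ (Sub a av) (Sub b bv)); rewrite ?inE ?SubK //.
      apply/andP; split; first by apply: ne; rewrite ?SubK.
      by rewrite !SubK eab.
have exf i : exists x, x \in B i by apply/set0Pn/conn_neq0.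
have exg v : exists i, v \in B i.
  apply/existsP; apply: contraNT cover; rewrite negb_exists => nv.
  by apply/existsP; exists v.
pose f i := xchoose (exf i); pose g v := xchoose (exg v).
have fB i : f i \in B i := xchooseP (exf i).
have gB v : v \in B (g v) := xchooseP (exg v).
have Bf i : B i = [set f i].
  apply/eqP; rewrite eq_sym eqEcard sub1set fB cards1 leqNgt.
  by apply: contraNN small => h; apply/existsP; exists i.
have fK : cancel f g.
  move=> i; apply/eqP/negPn/negP=> gi.
  by have := disjointFr (dB _ _ gi) (gB (f i)); rewrite fB.
have gK : cancel g f by move=> v; have := gB v; rewrite Bf => /set1P.
have fE i j : edge i j -> edge (f i) (f j).
  by move=> /aB; rewrite !Bf => /adjP[a [b [/set1P-> /set1P->]]].
case: (boolP [exists u, [exists v, edge u v && ~~ edge (g u) (g v)]]) => [|noext].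
  case/existsP=> u /existsP[v /andP[euv nuv]].
  apply: (minor_del_edge euv); apply: IHn.
    rewrite -ltnS; apply: leq_trans Gn; rewrite ltnS -addnS leq_add2l.
    exact: edges_del_edge.
  exists B; split=> // [i|i j ij]; first by rewrite Bf; apply: conn1.
  apply: (@adjI _ _ (f i) (f j)) => //; apply/andP; split; first exact: fE.
  apply/eqP=> /setP E; move/negP: nuv; apply.
  have := E (f i); rewrite !inE eqxx /= => /esym /orP[]/eqP fu.
    have := E (f j); rewrite !inE eqxx orbT => /esym /orP[]/eqP fv.
      by have := Hirr _ _ ij; rewrite -(fK i) -(fK j) fu fv eqxx.
    by rewrite -fu -fv !fK.
  have := E (f j); rewrite !inE eqxx orbT => /esym /orP[]/eqP fv.
    by rewrite edge_sym -fu -fv !fK.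
  by have := Hirr _ _ ij; rewrite -(fK i) -(fK j) fu fv eqxx.
apply: minor_iso; exists f; first by exists g.
move=> i j; apply/idP/idP; last exact: fE.
move=> eij; move: noext; rewrite negb_exists => /forallP/(_ (f i)).
by rewrite negb_exists => /forallP/(_ (f j)); rewrite eij !fK negbK.
Qed.

Lemma card_edge_set (G : sgraph) : #|edge_set G| = \sum_(x : G) \sum_(y : G) edge x y.
Proof.
by rewrite /edge_set cardsE -sum1_card big_mkcond pair_bigA; apply: eq_bigr => p _; rewrite unfold_in; case: edge.
Qed.

Lemma card_edges_K5 : #|edge_set (complete_graph 5)| = 20.
Proof. by rewrite card_edge_set !big_ord_recl !big_ord0. Qed.

Lemma card_edges_K33 : #|edge_set (complete_bipartite 3 3)| = 18.
Proof. by rewrite card_edge_set !(big_sumType, big_ord_recl, big_ord0). Qed.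

From mathcomp Require Import all_boot all_order all_algebra.
From mathcomp Require Import ring lra.
Import Order.TTheory GRing.Theory Num.Theory.
Local Open Scope ring_scope.

(** * Crossing parity *)

Section Winding.
Variable R : realFieldType.
Implicit Types (p q : R * R) (u : nat -> R * R) (w : nat -> nat -> R * R).

(** A half-open half-plane: it contains exactly one of [p] and [- p] for every nonzero [p]. *)
Definition upper p := (0 < p.2) || (p.2 == 0) && (0 < p.1).

(* Parity of the crossings of the segment from [p] to [q] with the positive axis; meaningful
   when [p] and [q] have a coordinate of the same strict sign. *)
Definition crosses p q := (upper p (+) upper q) && (0 < p.1).

(** Four open half-planes, [k.1] selecting the coordinate and [k.2] its sign; together they cover
    everything but the origin. *)
Definition quarter (k : bool * bool) p :=
  if k.1 then (if k.2 then 0 < p.1 else p.1 < 0) else (if k.2 then 0 < p.2 else p.2 < 0).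

Fixpoint winding u n := if n is m.+1 then winding u m (+) crosses (u m) (u m.+1) else false.

Lemma upperN p : p != 0 -> upper (- p) = ~~ upper p.
Proof.
case: p => a b; rewrite /upper -pair_eqE /= => ab0; rewrite !oppr_gt0 oppr_eq0.
by case: (ltgtP b 0) => //= b0; case: (ltgtP a 0) => //= a0; rewrite a0 b0 eqxx in ab0.
Qed.

Lemma quarter_upper k p : ~~ k.1 -> quarter k p -> upper p = k.2.
Proof.
case: k => [[] []] //= _; rewrite /quarter /upper /=; first by move->.
by move=> p0; rewrite ltNge (ltW p0) /= lt_eqF.
Qed.

(** Inside one of the four half-planes there are either no crossings, or every sign change counts
    and the two routes telescope to the same value. *)
Lemma crosses_cell k p q r s : quarter k p -> quarter k q -> quarter k r -> quarter k s ->
  (crosses p q (+) crosses q s) (+) (crosses p r (+) crosses r s) = false.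
Proof.
move=> kp kq kr ks; rewrite /crosses; case k1: k.1; last first.
  by rewrite !(quarter_upper (negbT k1) kp, quarter_upper (negbT k1) kq,
    quarter_upper (negbT k1) kr, quarter_upper (negbT k1) ks) addbb.
move: kp kq kr ks; rewrite /quarter k1; case: k.2 => p0 q0 r0 s0.
  rewrite p0 q0 r0 !andbT; by case: (upper p) (upper q) (upper r) (upper s) => [] [] [] [].
by rewrite !ltNge !(ltW p0, ltW q0, ltW r0) !andbF.
Qed.

Lemma quarter_neq0 k p : quarter k p -> p != 0.
Proof.
by apply: contraTneq => ->; rewrite /quarter /=; case: k.1 k.2 => [] []; rewrite ltxx.
Qed.

Lemma quarterN k p : quarter (k.1, ~~ k.2) (- p) = quarter k p.
Proof. by rewrite /quarter /=; case: k.1 k.2 => [] []; rewrite ?oppr_gt0 ?oppr_lt0. Qed.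

Lemma crossesN k p q : quarter k p -> quarter k q ->
  crosses p q (+) crosses (- p) (- q) = upper p (+) upper q.
Proof.
move=> kp kq; rewrite /crosses !upperN ?(quarter_neq0 kp) ?(quarter_neq0 kq) //=.
case k1: k.1; last first.
  by rewrite (quarter_upper (negbT k1) kp) (quarter_upper (negbT k1) kq) !addbb.
move: kp kq; rewrite /quarter k1 oppr_gt0; case: k.2 => p0 _.
  by rewrite p0 [_ < 0]ltNge (ltW p0) andbT andbF addbF.
by rewrite p0 ltNge (ltW p0) andbF andbT; case: (upper p) (upper q) => [] [].
Qed.

(** Crossings of [- u] with the positive half-axis are crossings of [u] with the negative one;
    together they count all changes of half-plane. *)
Lemma windingN u n : (forall i, (i < n)%N -> exists k, quarter k (u i) && quarter k (u i.+1)) ->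
  winding u n (+) winding (fun i => - u i) n = upper (u 0%N) (+) upper (u n).
Proof.
elim: n => [|n IH] H /=; first by rewrite addbb.
have [k /andP[k1 k2]] := H n (ltnSn n).
have {}IH := IH (fun i h => H i (ltnW h)).
rewrite addbACA IH (crossesN k1 k2).
by case: (upper (u 0%N)) (upper (u n)) (upper (u n.+1)) => [] [] [].
Qed.

Lemma winding_ext u u' n : u =1 u' -> winding u n = winding u' n.
Proof. by move=> E; elim: n => //= n ->; rewrite !E. Qed.

Definition quartered w n := forall i j, (i < n)%N -> (j < n)%N -> exists k,
  [&& quarter k (w i j), quarter k (w i.+1 j), quarter k (w i j.+1) & quarter k (w i.+1 j.+1)].

(** Each cell contributes zero by [crosses_cell]; summing along a row of cells and then over the
    rows cancels the inner sides. *)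
Lemma winding_grid w n : quartered w n ->
  winding (w^~ 0%N) n (+) winding (w^~ n) n = winding (w 0%N) n (+) winding (w n) n.
Proof.
move=> H.
have row m j : (m <= n)%N -> (j < n)%N -> winding (w^~ j) m (+) winding (w^~ j.+1) m =
    crosses (w 0%N j) (w 0%N j.+1) (+) crosses (w m j) (w m j.+1).
  elim: m => [|m IH] mn jn /=; first by rewrite addbb.
  have [k /and4P[k1 k2 k3 k4]] := H m j mn jn.
  rewrite addbACA (IH (ltnW mn) jn); have := crosses_cell k1 k2 k3 k4.
  move: (crosses (w 0%N j) _) (crosses (w m j) (w m.+1 j)) (crosses (w m.+1 j) _)
    (crosses (w m j) (w m j.+1)) (crosses (w m j.+1) _).
  by do 5![case].
have col m : (m <= n)%N -> winding (w^~ 0%N) n (+) winding (w^~ m) n =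
    winding (w 0%N) m (+) winding (w n) m.
  elim: m => [|m IH] mn /=; first by rewrite addbb.
  have := row n m (leqnn n) mn; have := IH (ltnW mn).
  move: (winding (w^~ 0%N) n) (winding (w^~ m) n) (winding (w 0%N) m) (winding (w n) m)
    (winding (w^~ m.+1) n) (crosses (w 0%N m) _) (crosses (w n m) _).
  by do 7![case].
exact: col.
Qed.

End Winding.

From mathcomp Require Import all_classical all_reals all_analysis.
Import numFieldNormedType.Exports.
Local Open Scope classical_set_scope.

(** * Straight-line drawings *)

Section Drawing.
Variables (R : realType) (V : finType) (e : rel V) (r : 'I_3 -> V -> nat).
Hypotheses (e_sym : symmetric e) (eirr : irreflexive e) (rl : realizer e [set: V]%SET r).

(** Any base above 2 would do: with base 2 the inequalities behind [no_crossing] would only force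
    equality. *)
Let f i v : R := 3 ^+ r i v.

Let f_gt0 i v : 0 < f i v. Proof. by rewrite exprn_gt0. Qed.

Let f_lt i x z : (r i x < r i z)%N -> 3 * f i x <= f i z.
Proof. by move=> xz; rewrite /f -exprS ler_eXn2l // ltr1n. Qed.

(** The left side of the equation is at most [(a + b) * U / 3], the right side at least [c * U]. *)
Lemma dominate (X Y U W a b c d : R) : 0 < U -> 3 * X <= U -> 3 * Y <= U -> 0 <= W ->
  0 <= a -> 0 <= b -> 0 <= d -> a * X + b * Y = c * U + d * W -> 3 * c <= a + b.
Proof.
move=> U0 XU YU W0 a0 b0 d0 E; rewrite -(ler_pM2r U0).
have h1 := ler_wpM2l a0 XU; have h2 := ler_wpM2l b0 YU; have h3 := mulr_ge0 d0 W0.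
lra.
Qed.

(* Each of the four endpoints is above the other edge in some order; with base 3 this gives
   [3 (c + d) <= 2 (a + b)] and [3 (a + b) <= 2 (c + d)]. *)
Lemma no_crossing x y u v (a b c d : R) : e x y -> e u v ->
  u != x -> u != y -> v != x -> v != y ->
  0 <= a -> 0 <= b -> 0 <= c -> 0 <= d ->
  (forall i, a * f i x + b * f i y = c * f i u + d * f i v) -> a + b <= 0.
Proof.
move=> exy euv ux uy vx vy a0 b0 c0 d0 E; have [rE _] := rl.
have [i [ix iy]] := rE x y u (finset.in_setT _) (finset.in_setT _) (finset.in_setT _) exy ux uy.
have [j [jx jy]] := rE x y v (finset.in_setT _) (finset.in_setT _) (finset.in_setT _) exy vx vy.
have [|| k [kx ky]] := rE u v x (finset.in_setT _) (finset.in_setT _) (finset.in_setT _) euv.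
- by rewrite eq_sym.
- by rewrite eq_sym.
have [|| l [lx ly]] := rE u v y (finset.in_setT _) (finset.in_setT _) (finset.in_setT _) euv.
- by rewrite eq_sym.
- by rewrite eq_sym.
have h1 := dominate (f_gt0 i u) (f_lt ix) (f_lt iy) (ltW (f_gt0 i v)) a0 b0 d0 (E i).
have h2 : 3 * d <= a + b.
  apply: (dominate (f_gt0 j v) (f_lt jx) (f_lt jy) (ltW (f_gt0 j u)) a0 b0 c0).
  by rewrite E addrC.
have h3 := dominate (f_gt0 k x) (f_lt kx) (f_lt ky) (ltW (f_gt0 k y)) c0 d0 b0 (esym (E k)).
have h4 : 3 * b <= c + d.
  apply: (dominate (f_gt0 l y) (f_lt lx) (f_lt ly) (ltW (f_gt0 l x)) c0 d0 a0).
  by rewrite -E addrC.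
lra.
Qed.

(** Orders with [z] below [x] and with [z] below [y] bound each of [a] and [b] by [c / 3], while the
    edge condition bounds [c] by [(a + b) / 3]. *)
Lemma not_between x y z (a b c : R) : e x y -> z != x -> z != y ->
  0 <= a -> 0 <= b -> 0 <= c ->
  (forall i, a * f i x + b * f i y = c * f i z) -> c <= 0.
Proof.
move=> exy zx zy a0 b0 c0 E; have [rE rD] := rl.
have [i [ix iy]] := rE x y z (finset.in_setT _) (finset.in_setT _) (finset.in_setT _) exy zx zy.
have [k kz] := rD z x (finset.in_setT _) (finset.in_setT _) zx.
have [l lz] := rD z y (finset.in_setT _) (finset.in_setT _) zy.
have h1 : 3 * c <= a + b.
  apply: (dominate (f_gt0 i z) (f_lt ix) (f_lt iy) (ltW (f_gt0 i z)) a0 b0 (lexx 0)).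
  by rewrite E mul0r addr0.
have h2 : 3 * a <= c + 0.
  apply: (dominate (f_gt0 k x) (f_lt kz) (f_lt kz) (ltW (f_gt0 k y)) c0 (lexx 0) b0).
  by rewrite E mul0r addr0.
have h3 : 3 * b <= c + 0.
  apply: (dominate (f_gt0 l y) (f_lt lz) (f_lt lz) (ltW (f_gt0 l x)) c0 (lexx 0) a0).
  by rewrite -E mul0r addr0 addrC.
lra.
Qed.

Lemma not_parallel x z (a c : R) : x != z -> 0 <= a -> 0 <= c ->
  (forall i, a * f i x = c * f i z) -> c <= 0.
Proof.
move=> xz a0 c0 E; have [_ rD] := rl.
have [i ix] := rD x z (finset.in_setT _) (finset.in_setT _) xz.
have [k kz] : exists k, (r k z < r k x)%N by apply: rD; rewrite ?finset.in_setT // eq_sym.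
have h1 : 3 * c <= a + 0.
  apply: (dominate (f_gt0 i z) (f_lt ix) (f_lt ix) (ltW (f_gt0 i z)) a0 (lexx 0) (lexx 0)).
  by rewrite E !mul0r !addr0.
have h2 : 3 * a <= c + 0.
  apply: (dominate (f_gt0 k x) (f_lt kz) (f_lt kz) (ltW (f_gt0 k x)) c0 (lexx 0) (lexx 0)).
  by rewrite E !mul0r !addr0.
lra.
Qed.

Let total v : R := f o0 v + f o1 v + f o2 v.

Let total_gt0 v : 0 < total v. Proof. by rewrite /total !addr_gt0. Qed.

(** Central projection onto the plane of coordinate sum 1; the third coordinate is dropped. *)
Definition place v : R * R := (f o0 v / total v, f o1 v / total v).

Definition segment (p q : R * R) (t : R) : R * R :=
  (p.1 + t * (q.1 - p.1), p.2 + t * (q.2 - p.2)).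

Lemma place_coord v : (place v).1 = (total v)^-1 * f o0 v /\ (place v).2 = (total v)^-1 * f o1 v.
Proof. by rewrite /place /= ![_^-1 * _]mulrC. Qed.

(* A point of a segment is the projection of a nonnegative combination of the two lifts. *)
Lemma segment_coord x y t : 0 <= t <= 1 -> let w := segment (place x) (place y) t in
  exists a b, [/\ 0 <= a, 0 <= b, a * total x + b * total y = 1,
    [/\ w.1 = a * f o0 x + b * f o0 y, w.2 = a * f o1 x + b * f o1 y &
        1 - w.1 - w.2 = a * f o2 x + b * f o2 y] &
    (b = 0 -> w = place x) /\ (a = 0 -> w = place y)].
Proof.
move=> /andP[t0 t1] w; have Sx := total_gt0 x; have Sy := total_gt0 y.
exists ((1 - t) / total x), (t / total y).
have a0 : 0 <= (1 - t) / total x by rewrite divr_ge0 ?subr_ge0 // ltW.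
have b0 : 0 <= t / total y by rewrite divr_ge0 // ltW.
have [x1 x2] := place_coord x; have [y1 y2] := place_coord y.
have E1 : w.1 = (1 - t) / total x * f o0 x + t / total y * f o0 y.
  by rewrite -[LHS]/((place x).1 + t * ((place y).1 - (place x).1)) x1 y1; ring.
have E2 : w.2 = (1 - t) / total x * f o1 x + t / total y * f o1 y.
  by rewrite -[LHS]/((place x).2 + t * ((place y).2 - (place x).2)) x2 y2; ring.
have S1 : (1 - t) / total x * total x + t / total y * total y = 1.
  by rewrite !divfK ?gt_eqF // subrK.
split=> //; first split=> //.
  move: S1 E1 E2; set A := (1 - t) / total x; set B := t / total y => S1 -> ->.
  by rewrite -S1 /total; ring.
have pairE (p q : R * R) : p.1 = q.1 -> p.2 = q.2 -> p = q.
  by case: p q => [? ?] [? ?] /= -> ->.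
split=> /eqP; rewrite mulf_eq0 invr_eq0 (gt_eqF Sx, gt_eqF Sy) orbF.
  by move=> /eqP t00; apply: pairE; rewrite /w /segment t00 /= mul0r addr0.
by rewrite subr_eq0 => /eqP t11; apply: pairE; rewrite /w /segment -t11 /= mul1r addrC subrK.
Qed.

(** Turns every incidence into an equality of nonnegative combinations of lifts; a vertex is treated
    as a degenerate segment. *)
Lemma segment_meet x y u v t t' : 0 <= t <= 1 -> 0 <= t' <= 1 ->
  segment (place x) (place y) t = segment (place u) (place v) t' ->
  let w := segment (place x) (place y) t in
  exists a b c d, [/\ 0 <= a, 0 <= b & 0 <= c] /\ [/\ 0 <= d, 0 < a + b, 0 < c + d,
    forall i, a * f i x + b * f i y = c * f i u + d * f i v &
    [/\ b = 0 -> w = place x, a = 0 -> w = place y, d = 0 -> w = place u & c = 0 -> w = place v]].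
Proof.
move=> ht ht' E w.
have [a [b [a0 b0 ab [E1 E2 E3] [bx ay]]]] := segment_coord x y ht.
have [c [d [c0 d0 cd [E1' E2' E3'] [du cv]]]] := segment_coord u v ht'.
have pos p q z z' : 0 <= p -> 0 <= q -> p * total z + q * total z' = 1 -> 0 < p + q.
  move=> p0 q0 pq; rewrite lt_def addr_ge0 // andbT; apply/eqP=> /eqP.
  rewrite paddr_eq0 // => /andP[/eqP pE /eqP qE].
  by move: pq; rewrite pE qE !mul0r addr0 => /eqP; rewrite eq_sym oner_eq0.
exists a, b, c, d; split=> //; split=> //.
- exact: pos ab.
- exact: pos cd.
- move=> i; rewrite -E in E1' E2' E3'; case: (ord3P i) => ->.
  + by rewrite -E1 E1'.
  + by rewrite -E2 E2'.
  + by rewrite -E3 E3'.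
- by split=> //; rewrite /w E.
Qed.

Lemma place_segment x y : place x = segment (place x) (place y) 0.
Proof. by rewrite /segment !mul0r !addr0; case: (place x). Qed.

Lemma segmentC p q t : segment p q t = segment q p (1 - t).
Proof. by congr (_, _); ring. Qed.

Lemma place_inj : injective place.
Proof.
move=> x y E; apply/eqP/negPn/negP=> xy.
have h0 : (0 : R) <= (0 : R) <= (1 : R) by rewrite lexx ler01.
have E' : segment (place x) (place x) 0 = segment (place y) (place y) 0.
  by rewrite -!place_segment.
have [a [b [c [d [[a0 b0 c0] [d0 ab cd F _]]]]]] := segment_meet h0 h0 E'.
have G i : (a + b) * f i x = (c + d) * f i y by rewrite !mulrDl F.
by have := not_parallel xy (addr_ge0 a0 b0) (addr_ge0 c0 d0) G; rewrite leNgt cd.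
Qed.

Lemma vertex_off x y z t : e x y -> z != x -> z != y -> 0 <= t <= 1 ->
  segment (place x) (place y) t <> place z.
Proof.
move=> exy zx zy ht E; have h0 : (0 : R) <= (0 : R) <= (1 : R) by rewrite lexx ler01.
rewrite [place z](place_segment z z) in E.
have [a [b [c [d [[a0 b0 c0] [d0 ab cd F _]]]]]] := segment_meet ht h0 E.
have G i : a * f i x + b * f i y = (c + d) * f i z by rewrite F mulrDl.
by have := not_between exy zx zy a0 b0 (addr_ge0 c0 d0) G; rewrite leNgt cd.
Qed.

(** Cancelling the common multiple of [x] puts one far end into the cone of the other edge, which
    [not_between] allows only with coefficient zero. *)
Lemma shared_end x y v (a b c d : R) : e x y -> e x v -> y != v ->
  0 <= a -> 0 <= b -> 0 <= c -> 0 <= d ->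
  (forall i, a * f i x + b * f i y = c * f i x + d * f i v) -> b = 0.
Proof.
move=> exy exv yv a0 b0 c0 d0 E.
have yx : y != x by apply: contraTneq exy => ->; rewrite eirr.
have vx : v != x by apply: contraTneq exv => ->; rewrite eirr.
apply/eqP; rewrite eq_le b0 andbT; have [ca|ac] := leP c a; last first.
  have G i : (c - a) * f i x + d * f i v = b * f i y.
    by rewrite mulrBl addrAC -E addrAC subrr add0r.
  have ca0 : 0 <= c - a by rewrite subr_ge0 ltW.
  by have := not_between exv yx yv ca0 d0 b0 G.
have G i : (a - c) * f i x + b * f i y = d * f i v.
  by rewrite mulrBl addrAC E addrAC subrr add0r.
have ca0 : 0 <= a - c by rewrite subr_ge0.
have d00 : d <= 0 by apply: (not_between exy vx _ ca0 b0 d0 G); rewrite eq_sym.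
have dE : d = 0 by apply/eqP; rewrite eq_le d00.
have := G o0; rewrite dE mul0r => /eqP.
rewrite paddr_eq0 ?mulr_ge0 ?(ltW (f_gt0 _ _)) // => /andP[_].
by rewrite mulf_eq0 (gt_eqF (f_gt0 _ _)) orbF => /eqP->.
Qed.

Lemma edges_off x y u v t t' : e x y -> e u v -> [set x; y]%SET != [set u; v]%SET ->
  0 <= t <= 1 -> 0 <= t' <= 1 ->
  segment (place x) (place y) t = segment (place u) (place v) t' ->
  segment (place x) (place y) t = place x \/ segment (place x) (place y) t = place y.
Proof.
move=> exy euv xyuv ht ht' E.
have [a [b [c [d [[a0 b0 c0] [d0 ab cd F [bx ay _ _]]]]]]] := segment_meet ht ht' E.
have eyx : e y x by rewrite e_sym.
have F' i : b * f i y + a * f i x = c * f i u + d * f i v by rewrite addrC F.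
have F2 i : a * f i x + b * f i y = d * f i v + c * f i u by rewrite F addrC.
have F3 i : b * f i y + a * f i x = d * f i v + c * f i u by rewrite F' addrC.
case: (eqVneq u x) => [ux|ux].
  left; apply: bx; apply: (@shared_end x y v a b c d) => //; rewrite -?ux //.
    by apply: contraNneq xyuv => ->; rewrite ux.
  by move=> i; rewrite ux F ux.
case: (eqVneq u y) => [uy|uy].
  right; apply: ay; apply: (@shared_end y x v b a c d) => //; rewrite -?uy //.
    by apply: contraNneq xyuv => ->; rewrite uy finset.setUC.
  by move=> i; rewrite uy F' uy.
case: (eqVneq v x) => [vx|vx].
  left; apply: bx; apply: (@shared_end x y u a b d c) => //; rewrite -?vx 1?e_sym //.
    by apply: contraNneq xyuv => ->; rewrite vx finset.setUC.
  by move=> i; rewrite vx F2 vx.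
case: (eqVneq v y) => [vy|vy].
  right; apply: ay; apply: (@shared_end y x u b a d c) => //; rewrite -?vy 1?e_sym //.
    by apply: contraNneq xyuv => ->; rewrite vy.
  by move=> i; rewrite vy F3 vy.
by have := no_crossing exy euv ux uy vx vy a0 b0 c0 d0 F; rewrite leNgt ab.
Qed.

End Drawing.

Lemma segment_arc (R : realType) (p q : R * R) : p <> q ->
  is_arc p q [set w | exists2 t, 0 <= t <= 1 & segment p q t = w].
Proof.
move=> pq; exists (segment p q); split.
- apply: continuous_subspaceT => t.
  have -> : segment p q = fun t => p + t *: (q - p).
    by apply/funext=> x; rewrite /segment; case: p q {pq} => [? ?] [? ?].
  by apply: cvgD; [exact: cvg_cst | apply: cvgZr_tmp; exact: cvg_id].
- move=> t t' _ _ [E1 E2]; apply/eqP/negPn/negP=> tt; apply: pq.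
  case: p q E1 E2 => [p1 p2] [q1 q2] /= E1 E2.
  have key (a b : R) : a + t * (b - a) = a + t' * (b - a) -> a = b.
    move=> /addrI/eqP; rewrite -subr_eq0 -mulrBl mulf_eq0 !subr_eq0 (negPf tt) /=.
    by move/eqP->.
  by rewrite (key _ _ E1) (key _ _ E2).
- by rewrite /segment !mul0r !addr0; case: (p).
- by rewrite /segment !mul1r; case: (p) (q) => [? ?] [? ?] /=; congr (_, _); rewrite addrC subrK.
- apply/seteqP; split=> w /=.
    by case=> t ht <-; exists t => //=; rewrite in_itv.
  by case=> t; rewrite /= in_itv /= => ht <-; exists t.
Qed.

Theorem realizer_planar (R : realType) (G : sgraph) (r : 'I_3 -> G -> nat) :
  realizer (@edge G) [set: G]%SET r -> planar R G.
Proof.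
move=> rl; pose pos := @place R G r.
pose seg (x y : G) : set (R * R) := [set w | exists2 t, 0 <= t <= 1 & segment (pos x) (pos y) t = w].
(* Arcs are indexed by unordered pairs, so the orientation is existential; by [segC] it does not
   matter. *)
pose arc (S : {set G}) : set (R * R) := [set w | exists x y, [/\ edge x y, S = [set x; y]%SET & seg x y w]].
have segC x y w : seg x y w -> seg y x w.
  case=> t /andP[t0 t1] <-; exists (1 - t); last by rewrite [RHS]segmentC.
  by rewrite subr_ge0 t1 lerBlDr lerDl.
have irr := @edge_irrefl G; have sym := @edge_sym G.
have arcE x y : edge x y -> arc [set x; y]%SET = seg x y.
  move=> exy; apply/seteqP; split=> w; last by exists x, y.
  have xy : x != y by apply: contraTneq exy => ->; rewrite irr.
  case=> x' [y' [exy' /setP S h]].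
  have := S x; have := S y; rewrite !finset.inE !eqxx orbT /= => /esym/orP[]/eqP yE /esym/orP[]/eqP xE.
  - by rewrite xE yE eqxx in xy.
  - by rewrite xE yE; apply: segC.
  - by rewrite xE yE.
  - by rewrite xE yE eqxx in xy.
exists pos, arc; split.
- exact: place_inj rl.
- move=> x y exy; rewrite arcE //; apply: segment_arc => /(place_inj rl) xy.
  by move: exy; rewrite xy irr.
- move=> x y z exy; rewrite arcE // => -[[t ht E] nxy].
  apply: (vertex_off rl exy _ _ ht E); apply/eqP=> zE; apply: nxy; rewrite zE /=; [by left|by right].
- move=> x y u v exy euv xyuv; rewrite !arcE //; apply/seteqP; split=> w //.
  case=> [[[t ht <-] nxy] [t' ht' E]]; case: nxy.
  by have [->|->] := edges_off sym irr rl exy euv xyuv ht ht' (esym E); [left|right].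
Qed.

(** * Nonplanarity *)

Definition independent (e f : nat * nat) :=
  [&& e.1 != f.1, e.1 != f.2, e.2 != f.1 & e.2 != f.2].

Fixpoint independent_pairs (E : seq (nat * nat)) :=
  if E is e :: E' then [seq (e, f) | f <- E' & independent e f] ++ independent_pairs E' else [::].

(** The windings met on the boundary of the grid of two edges: each edge around both ends of the
    other. *)
Definition edge_vertex (ef : (nat * nat) * (nat * nat)) :=
  [:: (ef.1, ef.2.1); (ef.1, ef.2.2); (ef.2, ef.1.1); (ef.2, ef.1.2)].

(** The pairs of ends whose differences [windingN] brings in, in the order in which [above]
    subtracts them. *)
Definition vertex_vertex (ef : (nat * nat) * (nat * nat)) :=
  [:: (ef.2.1, ef.1.1); (ef.2.2, ef.1.1); (ef.2.1, ef.1.2); (ef.2.2, ef.1.2)].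

Definition sort_pair (uv : nat * nat) := if (uv.1 < uv.2)%N then uv else (uv.2, uv.1).

Definition all_even (T : eqType) (s : seq T) := all (fun x => ~~ odd (count_mem x s)) s.

(* The van Kampen obstruction modulo 2 does not vanish for this edge list, each edge being given
   an orientation. *)
Definition van_kampen E :=
  let P := independent_pairs E in let vv := flatten [seq vertex_vertex ef | ef <- P] in
  [&& all_even (flatten [seq edge_vertex ef | ef <- P]), all_even [seq sort_pair uv | uv <- vv] &
      odd (count (fun uv : nat * nat => uv.2 < uv.1)%N vv)].

Lemma iterop_addb m b : iterop m addb b false = odd m && b.
Proof.
case: m => [//|m]; have -> : iterop m.+1 addb b false = iter m (addb b) b.
  exact: iteropS.
by elim: m => [|m IH] /=; [case: b | rewrite IH /=; clear; case: (odd m) b => [] []].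
Qed.

Lemma xor_even (T : eqType) (s : seq T) (F : T -> bool) : all_even s ->
  \big[addb/false]_(x <- s) F x = false.
Proof.
move=> /allP ev; rewrite -big_undup_iterop_count big_seq big1 // => x.
rewrite mem_undup => /ev; rewrite -[count_mem x s]odd_double_half => /=.
rewrite oddD odd_double addbF oddb => /negPf->; rewrite add0n.
by rewrite iterop_addb odd_double.
Qed.

Lemma xor_count (T : eqType) (s : seq T) (F : T -> bool) :
  \big[addb/false]_(x <- s) F x = odd (count F s).
Proof. by elim: s => [|x s IH]; rewrite ?big_nil // big_cons IH /= oddD oddb. Qed.

(** * Parity of sampled drawings *)

Section Discrete.
Variables (R : realType) (p : nat -> R * R) (W : nat * nat -> nat -> R * R) (n : nat).
Variable E : seq (nat * nat).
Hypothesis W0 : forall e, e \in E -> W e 0%N = p e.1.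
Hypothesis Wn : forall e, e \in E -> W e n = p e.2.
Hypothesis n0 : (0 < n)%N.
Hypothesis grid : forall ef, ef \in independent_pairs E ->
  quartered (fun i j => W ef.1 i - W ef.2 j) n.

Let around (ev : (nat * nat) * nat) := winding (fun i => W ev.1 i - p ev.2) n.
Let above (uv : nat * nat) := upper (p uv.1 - p uv.2).

Lemma independent_pairs_mem ef : ef \in independent_pairs E ->
  [/\ ef.1 \in E, ef.2 \in E & independent ef.1 ef.2].
Proof.
elim: (E) => //= e E' IH; rewrite mem_cat => /orP[/mapP[f]|/IH[h1 h2 h3]].
  by rewrite mem_filter => /andP[ief fE] ->; rewrite !inE eqxx fE orbT.
by rewrite !inE h1 h2 !orbT.
Qed.

(** On two sides of the grid of differences [W e i - W f j] lie windings of [e] around the ends of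
    [f]; on the other two the difference is a negated path, and [windingN] turns it into a winding
    of [f] at the cost of the [above] terms. *)
Lemma pair_parity ef : ef \in independent_pairs E ->
  \big[addb/false]_(x <- edge_vertex ef) around x = \big[addb/false]_(y <- vertex_vertex ef) above y.
Proof.
move=> efP; have [eE fE _] := independent_pairs_mem efP; case: ef efP eE fE => e f efP /= eE fE.
have g := grid efP; have := winding_grid g; rewrite /edge_vertex /vertex_vertex !big_cons !big_nil /=.
have -> : winding (fun i => W e i - W f 0%N) n = around (e, f.1) by rewrite W0.
have -> : winding (fun i => W e i - W f n) n = around (e, f.2) by rewrite Wn.
have half i c : (i <= n)%N -> W e i = p c ->
    winding (fun j => W e i - W f j) n = around (f, c) (+) (above (f.1, c) (+) above (f.2, c)).
  move=> ilen Wi; rewrite (@winding_ext _ _ (fun j => - (W f j - p c))); last first.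
    by move=> j; rewrite opprB Wi.
  have := @windingN R (fun j => W f j - p c) n _; rewrite /around /above /= W0 // Wn //= => <-.
    by rewrite addbA addbb.
  move=> j jn; rewrite -Wi.
  case: i ilen {Wi} => [_|i ilt].
    have [k /and4P[k1 _ k2 _]] := g 0%N j n0 jn.
    by exists (k.1, ~~ k.2); rewrite -![W f _ - _]opprB !quarterN k1.
  have [k /and4P[_ k1 _ k2]] := g i j ilt jn.
  by exists (k.1, ~~ k.2); rewrite -![W f _ - _]opprB !quarterN k1.
rewrite (half 0%N e.1) ?W0 // (half n e.2) ?Wn //.
rewrite !addbF.
by move: (around _) (around _) (around _) (around _) (above _) (above _) (above _) (above _); do 8![case].
Qed.

(** Swapping two vertices negates their difference, which exchanges the half-planes. *)
Lemma above_sort u v : p u != p v -> u != v ->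
  above (u, v) = above (sort_pair (u, v)) (+) (v < u)%N.
Proof.
move=> puv uv; rewrite /sort_pair /=; case: ltngtP uv => // _ _; first by rewrite addbF.
by rewrite /above /= -opprB upperN ?addbT // subr_eq0 eq_sym.
Qed.

Lemma van_kampen_vanishes : ~~ van_kampen E.
Proof.
apply/negP=> /and3P[ev1 ev2 odd3].
set P := independent_pairs E in ev1 ev2 odd3; set vv := flatten _ in ev2 odd3.
have key : \big[addb/false]_(x <- flatten [seq edge_vertex ef | ef <- P]) around x =
    \big[addb/false]_(y <- vv) above y.
  rewrite !big_flatten /= !big_map !big_seq; apply: eq_bigr => ef; exact: pair_parity.
(* The corners of each grid lie in one of the half-planes, hence are nonzero: ends of independent
   edges are distinct points. *)
have dist y : y \in vv -> (p y.1 != p y.2) && (y.1 != y.2).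
  case/flattenP=> s /mapP[ef efP ->].
  have [eE fE ind] := independent_pairs_mem efP; have g := grid efP.
  have n1 : (n.-1 < n)%N by rewrite prednK.
  have nn : n.-1.+1 = n by rewrite prednK.
  have [k00 /and4P[/quarter_neq0 h00 _ _ _]] := g _ _ n0 n0.
  have [k10 /and4P[_ /quarter_neq0 h10 _ _]] := g _ _ n1 n0.
  have [k01 /and4P[_ _ /quarter_neq0 h01 _]] := g _ _ n0 n1.
  have [k11 /and4P[_ _ _ /quarter_neq0 h11]] := g _ _ n1 n1.
  rewrite !nn ?W0 ?Wn // !subr_eq0 in h00 h10 h01 h11.
  case/and4P: ind => i1 i2 i3 i4.
  by rewrite !inE => /or4P[]/eqP-> /=; rewrite 1?eq_sym ?h00 ?h01 ?h10 ?h11 /= eq_sym.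
have : \big[addb/false]_(y <- vv) above y = true.
  have -> : \big[addb/false]_(y <- vv) above y =
      \big[addb/false]_(y <- vv) (above (sort_pair y) (+) (y.2 < y.1)%N).
    rewrite !big_seq; apply: eq_bigr => -[u v] /dist /andP[puv uv].
    exact: above_sort.
  rewrite big_split /= -(big_map sort_pair xpredT above) (xor_even _ ev2) xor_count.
  exact: odd3.
by rewrite -key (xor_even _ ev1).
Qed.

End Discrete.

Lemma quarter_exists (R : realFieldType) (p : R * R) : p != 0 -> exists k, quarter k p.
Proof.
case: p => a b; rewrite -pair_eqE /= negb_and => /orP[] /lt_total/orP[] h.
- by exists (true, false).
- by exists (true, true).
- by exists (false, false).
- by exists (false, true).
Qed.

Lemma quarter_near (R : realFieldType) k (p : R * R) : quarter k p ->
  exists2 e, 0 < e & forall q, `|q.1 - p.1| < e -> `|q.2 - p.2| < e -> quarter k q.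
Proof.
rewrite /quarter; case: k => [[] []] /= h.
- by exists p.1 => // q; rewrite ltr_distl subrr => /andP[].
- exists (- p.1); first by rewrite oppr_gt0.
  by move=> q; rewrite ltr_distl subrr => /andP[].
- by exists p.2 => // q _; rewrite ltr_distl subrr => /andP[].
- exists (- p.2); first by rewrite oppr_gt0.
  by move=> q _; rewrite ltr_distl subrr => /andP[].
Qed.

(** * Compactness and fine grids *)

Section Mesh.
Variable R : realType.
Implicit Types g h : R -> R * R.

Lemma path_continuous g : {within `[0, 1], continuous g} ->
  forall s : R, 0 <= s <= 1 -> forall e : R, 0 < e -> exists2 d : R, 0 < d & forall t : R, 0 <= t <= 1 ->
    `|t - s| < d -> `|(g t).1 - (g s).1| < e /\ `|(g t).2 - (g s).2| < e.
Proof.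
move=> /subspace_continuousP gc s hs e e0.
have := gc s; rewrite /= in_itv /= => /(_ hs) /cvg_ballP /(_ e e0).
rewrite near_withinE => /nbhs_ballP[d /= d0 H]; exists d => // t ht ts.
have := H t; rewrite /ball /= distrC in_itv /= => /(_ ts ht) [b1 b2].
by split; rewrite distrC.
Qed.

(** Near each pair of parameters the nonzero difference stays in one open half-plane; by compactness
    of the square one mesh size serves all pairs. *)
Lemma uniform_quarter g h : {within `[0, 1], continuous g} -> {within `[0, 1], continuous h} ->
  (forall s t : R, 0 <= s <= 1 -> 0 <= t <= 1 -> g s != h t) ->
  \forall n \near \oo, forall s t : R, 0 <= s <= 1 -> 0 <= t <= 1 ->
    exists k, forall s' t' : R, 0 <= s' <= 1 -> 0 <= t' <= 1 -> `|s' - s| <= n.+1%:R^-1 ->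
      `|t' - t| <= n.+1%:R^-1 -> quarter k (g s' - h t').
Proof.
move=> gc hc gh.
have K := compact_setX (@segment_compact R 0 1) (@segment_compact R 0 1).
move/compact_near_coveringP in K.
have := K nat \oo (fun n st => exists k, forall s' t' : R, 0 <= s' <= 1 -> 0 <= t' <= 1 ->
  `|s' - st.1| <= n.+1%:R^-1 -> `|t' - st.2| <= n.+1%:R^-1 -> quarter k (g s' - h t')) _.
move=> H; have {H} : \forall n \near \oo, `[0, 1] `*` `[0, 1] `<=` (fun st => exists k,
    forall s' t' : R, 0 <= s' <= 1 -> 0 <= t' <= 1 ->
  `|s' - st.1| <= n.+1%:R^-1 -> `|t' - st.2| <= n.+1%:R^-1 -> quarter k (g s' - h t')).
  apply: H => -[s t] [] /=; rewrite !in_itv /= => hs ht.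
  have [k kp] : exists k, quarter k (g s - h t).
    by apply: quarter_exists; rewrite subr_eq0 gh.
  have [e e0 qe] := quarter_near kp.
  have e2 : 0 < e / 2 by rewrite divr_gt0.
  have [d d0 Hg] := path_continuous gc hs e2.
  have [d' d0' Hh] := path_continuous hc ht e2.
  (* One half of [m] absorbs the distance to the centre of the neighbourhood, the other half one
     mesh width. *)
  pose m : R := Num.min d d'; have m0 : 0 < m / 2 by rewrite divr_gt0 // lt_min d0.
  exists (ball s (m / 2) `*` ball t (m / 2), [set n | n.+1%:R^-1 < m / 2 :> R]).
    split; first by exists (ball s (m / 2), ball t (m / 2)) => //=; split; apply: nbhsx_ballx.
    exact: near_infty_natSinv_lt (PosNum m0).
  move=> [[s1 t1] n] [] /= [bs bt] nm; exists k => s' t' hs' ht' ss tt.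
  have close (x x1 x' : R) : ball x (m / 2) x1 -> `|x' - x1| <= n.+1%:R^-1 -> `|x' - x| < m.
    move=> b1 b2; have {}b1 : `|x - x1| < m / 2 := b1.
    have -> : x' - x = (x' - x1) + (x1 - x) by rewrite subrKA.
    apply: le_lt_trans (ler_normD _ _) _; rewrite [m]splitr.
    by rewrite distrC in b1; apply: ltrD; [exact: le_lt_trans b2 nm | exact: b1].
  have [|g1 g2] := Hg s' hs'.
    by apply: lt_le_trans (close _ _ _ bs ss) _; rewrite ge_min lexx.
  have [|h1 h2] := Hh t' ht'.
    by apply: lt_le_trans (close _ _ _ bt tt) _; rewrite ge_min lexx orbT.
  have tri (a b c c' : R) : `|a - b| < e / 2 -> `|c - c'| < e / 2 -> `|(a - c) - (b - c')| < e.
    by rewrite !ltr_norml => /andP[? ?] /andP[? ?]; apply/andP; split; lra.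
  by apply: qe => /=; apply: tri.
apply: filterS => n H s t hs ht; apply: (H (s, t)).
by split; rewrite /= in_itv.
Qed.

Lemma fine_grid g h : {within `[0, 1], continuous g} -> {within `[0, 1], continuous h} ->
  (forall s t : R, 0 <= s <= 1 -> 0 <= t <= 1 -> g s != h t) ->
  \forall n \near \oo, quartered (fun i j => g (i%:R / n.+1%:R) - h (j%:R / n.+1%:R)) n.+1.
Proof.
move=> gc hc gh; move: (uniform_quarter gc hc gh); apply: filterS => n H i j i_n j_n.
have n0 : 0 < n.+1%:R :> R by rewrite ltr0n.
have frac l : (l <= n.+1)%N -> 0 <= (l%:R / n.+1%:R : R) <= 1.
  by move=> ln; rewrite divr_ge0 ?ler0n //= ler_pdivrMr // mul1r ler_nat.
have [k Hk] := H _ _ (frac _ (ltnW i_n)) (frac _ (ltnW j_n)).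
have same l : `|l%:R / n.+1%:R - l%:R / n.+1%:R| <= (n.+1%:R^-1 : R).
  by rewrite subrr normr0 invr_ge0 ltW.
have next l : `|l.+1%:R / n.+1%:R - l%:R / n.+1%:R| <= (n.+1%:R^-1 : R).
  by rewrite -mulrBl -natrB // subSnn mul1r ger0_norm // invr_ge0 ltW.
by exists k; apply/and4P; split; apply: Hk => //; apply: frac => //; apply: ltnW.
Qed.

Lemma no_drawing (p : nat -> R * R) (g : nat * nat -> R -> R * R) (E : seq (nat * nat)) :
  (forall e, e \in E -> [/\ {within `[0, 1], continuous g e}, g e 0 = p e.1 & g e 1 = p e.2]) ->
  (forall e f, (e, f) \in independent_pairs E -> forall s t : R, 0 <= s <= 1 -> 0 <= t <= 1 ->
     g e s != g f t) -> ~~ van_kampen E.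
Proof.
move=> gE disj.
pose fine n ef := quartered (fun i j => g ef.1 (i%:R / n.+1%:R) - g ef.2 (j%:R / n.+1%:R)) n.+1.
have [n grid] : exists n, forall ef, ef \in independent_pairs E -> fine n ef.
  have near ef : ef \in independent_pairs E -> \forall n \near \oo, fine n ef.
    move=> efP; have [/= /gE[c1 _ _] /gE[c2 _ _] _] := independent_pairs_mem efP.
    by apply: fine_grid => // s t; apply: disj; case: ef efP {c1 c2}.
  suff /filter_ex[n Hn] : \forall n \near \oo, forall ef, ef \in independent_pairs E -> fine n ef.
    by exists n.
  elim: (independent_pairs E) near => [|ef P IH] near; first by near=> n.
  apply: filterS2 (near ef (mem_head _ _)) (IH _) => [n h1 h2 ef'|ef' efP].
    by rewrite inE => /orP[/eqP->|/h2].
  by apply: near; rewrite inE efP orbT.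
pose W e i := g e (i%:R / n.+1%:R).
apply: (@van_kampen_vanishes R p W n.+1 E _ _ _ grid) => // e /gE[_ g0 g1]; rewrite /W.
  by rewrite mul0r.
by rewrite divff // pnatr_eq0.
Unshelve. all: by end_near. Qed.

End Mesh.

(** Numbering the vertices by [v] reduces the obstruction to a computation with lists of numbers. *)
Lemma van_kampen_nonplanar (R : realType) (G : sgraph) (v : nat -> G) m (E : seq (nat * nat)) :
  {in [pred k | (k < m)%N] &, injective v} ->
  all (fun e => [&& (e.1 < m)%N, (e.2 < m)%N & edge (v e.1) (v e.2)]) E ->
  van_kampen E -> ~ planar R G.
Proof.
move=> vinj /allP vE vk [pos [arc [pos_inj arcs off disj]]].
pose A (e : nat * nat) := arc [set v e.1; v e.2]%SET.
have /choice[g gP] (e : nat * nat) : exists h : R -> R * R, e \in E -> [/\ {within `[0, 1], continuous h},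
    h 0 = pos (v e.1), h 1 = pos (v e.2) & forall s : R, 0 <= s <= 1 -> A e (h s)].
  have [/vE/and3P[_ _ /arcs[h [hc _ h0 h1 Ah]]]|_] := boolP (e \in E); last by exists (fun=> 0).
  by exists h => _; split=> // s hs; rewrite /A Ah; exists s => //=; rewrite in_itv.
(* A common point is not interior to the arc of [e], so it is the position of an end of [e]; but the
   arc of [f] contains no vertices besides its own ends. *)
have apart (e f : nat * nat) w : e \in E -> f \in E -> independent e f -> A e w -> A f w -> False.
  move=> /vE/and3P[e1 e2 eE] /vE/and3P[f1 f2 fE] /and4P[i1 i2 i3 i4] we wf.
  have vneq a b : (a < m)%N -> (b < m)%N -> a != b -> v a != v b.
    by move=> am bm; apply: contraNneq => /vinj->.
  have on_vertex a : (a < m)%N -> a != f.1 -> a != f.2 -> w = pos (v a) -> False.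
    move=> am a1 a2 wa; apply: (off _ _ (v a) fE); split; first by rewrite -wa.
    by case=> /pos_inj/eqP; apply/negP; apply: vneq.
  have ef : [set v e.1; v e.2]%SET != [set v f.1; v f.2]%SET.
    apply/eqP=> /setP/(_ (v e.1)); rewrite !finset.inE eqxx.
    by rewrite (negPf (vneq _ _ e1 f1 i1)) (negPf (vneq _ _ e1 f2 i2)).
  have [] : (set0 : set (R * R)) w; rewrite -(disj _ _ _ _ eE fE ef); split=> //; split=> //.
  by case; apply: on_vertex.
have := @no_drawing R (pos \o v) g E; rewrite vk => /(_ _ _)/negP; apply=> //.
  by move=> e /gP[].
move=> e f /independent_pairs_mem[/= eE fE ind] s t hs ht; apply/eqP=> st.
have [_ _ _ /(_ _ hs) h1] := gP _ eE; have [_ _ _ /(_ _ ht)] := gP _ fE.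
by rewrite -st; apply: apart h1.
Qed.

(** * The two forbidden graphs *)

Lemma isomorphic_sym G H : isomorphic G H -> isomorphic H G.
Proof.
by case=> f [g fK gK] fE; exists g; [exists f | move=> x y; rewrite -fE !gK].
Qed.

Lemma nonplanar_K5 (R : realType) G : isomorphic (complete_graph 5) G -> ~ planar R G.
Proof.
case=> f fb fE; apply: (@van_kampen_nonplanar R G (fun k => f (inord k)) 5
  [seq (i, j) | i <- iota 0 5, j <- iota i.+1 (4 - i)]); last by vm_compute.
  by move=> i j; rewrite !inE => i5 j5 /(bij_inj fb)/(congr1 val); rewrite /= !inordK.
apply/allP=> e /allpairsPdep[i [j [iI jI -> {e}]]]; move: iI jI; rewrite !mem_iota => /andP[_ i5] /andP[ij j5].
have {}j5 : (j < 5)%N by apply: leq_trans j5 _; rewrite addSn subnKC.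
rewrite /= i5 j5 fE /edge /= /complete_rel -val_eqE /= !inordK //.
by rewrite neq_ltn ij.
Qed.

Lemma nonplanar_K33 (R : realType) G : isomorphic (complete_bipartite 3 3) G -> ~ planar R G.
Proof.
case=> f fb fE; pose v k : complete_bipartite 3 3 := if (k < 3)%N then inl (inord k) else inr (inord (k - 3)).
apply: (@van_kampen_nonplanar R G (f \o v) 6 [seq (i, j) | i <- iota 0 3, j <- iota 3 3]); last by vm_compute.
  pose u (x : complete_bipartite 3 3) := match x with inl a => a : nat | inr b => (3 + b)%N end.
  have vK k : (k < 6)%N -> u (v k) = k.
    move=> k6; rewrite /v; case: ltnP => k3 /=; first by rewrite inordK.
    by rewrite inordK ?subnKC // ltn_subLR.
  by move=> i j i6 j6 /(bij_inj fb)/(congr1 u); rewrite !vK.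
apply/allP=> e /allpairsP[[i j] [iI jI -> {e}]]; move: iI jI; rewrite !mem_iota => /andP[_ i3] /andP[j3 j6].
by rewrite /= (ltn_trans i3) // j6 fE /v i3 ltnNge j3.
Qed.

Lemma nonplanar_minor (R : realType) (G : sgraph) : ~ planar R G ->
  minor (complete_graph 5) G \/ minor (complete_bipartite 3 3) G.
Proof.
move=> npl; apply: contrapT => /not_orP[h5 h33]; apply: npl.
have [r rl] : exists r, realizer (@edge G) [set: G]%SET r.
  apply: kfree_realizer; [exact: edge_sym | exact: edge_irrefl | split].
    by move=> h; apply: h5; apply: model_minor.
  by move=> h; apply: h33; apply: model_minor.
exact: realizer_planar rl.
Qed.

Theorem theorem15 (R : realType) (G : sgraph) :
  forbidden_minors (planar R) G <->
  isomorphic G (complete_graph 5) \/ isomorphic G (complete_bipartite 3 3).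
Proof.
have v5 : #|complete_graph 5| = 5%N by rewrite card_ord.
have v33 : #|complete_bipartite 3 3| = 6%N by rewrite card_sum !card_ord.
split=> [[npl min]|].
  case: (nonplanar_minor npl) => /min m; [left|right]; apply: isomorphic_sym; apply: m.
    by apply: nonplanar_K5; exists id => //; exists id.
  by apply: nonplanar_K33; exists id => //; exists id.
case=> GK; have KG := isomorphic_sym GK; split.
- exact: nonplanar_K5.
- move=> H /nonplanar_minor Hm HG.
  have [n1 e1 iso1] := minor_measure HG.
  have [n2 e2 iso2] := minor_measure (minor_iso GK).
  (* The minor contained in [H] bounds its sizes from below and the copy [G] of K5 from above; K33
     would have too many vertices. *)
  case: Hm => /minor_measure[n3 e3 _]; rewrite ?card_edges_K5 ?card_edges_K33 ?v5 ?v33 in n1 e1 n2 e2 n3 e3.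
    have nn : #|H| = #|G| by apply/eqP; rewrite eqn_leq n1 (leq_trans n2).
    by apply: iso1 => //; apply/eqP; rewrite eqn_leq e1 (leq_trans e2).
  by have := leq_trans n3 (leq_trans n1 n2).
- exact: nonplanar_K33.
- move=> H /nonplanar_minor Hm HG.
  have [n1 e1 iso1] := minor_measure HG.
  have [n2 e2 iso2] := minor_measure (minor_iso GK).
  case: Hm => /minor_measure[n3 e3 _]; rewrite ?card_edges_K5 ?card_edges_K33 ?v5 ?v33 in n1 e1 n2 e2 n3 e3.
    by have := leq_trans e3 (leq_trans e1 e2).
  have nn : #|H| = #|G| by apply/eqP; rewrite eqn_leq n1 (leq_trans n2).
  by apply: iso1 => //; apply/eqP; rewrite eqn_leq e1 (leq_trans e2).
Qed.
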